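(* Let $\mu=\mu_1\times\dots\times\mu_K$ be a product-form probability distribution on $(S,\mathcal{S})$, let $\gamma$ be an unnormalized (but finite) unsigned measure on $(S,\mathcal{S})$ that is absolutely continuous with respect to $\mu$, let $w:=d\gamma/d\mu$, and let $\pi:=\gamma/\gamma(S)$ and $w^\pi:=w/\gamma(S)$. Let $\pi^N_\times(\varphi):=\mu^N_\times(w\varphi)/\mu^N_\times(w)$ and $\pi^N(\varphi):=\mu^N(w\varphi)/\mu^N(w)$ be, respectively, the product-form and the standard self-normalized importance sampling estimators of $\pi(\varphi)$. If $w\varphi$ belongs to $L^2_\mu$, then $\pi^N_\times(\varphi)$ is strongly consistent ($\pi^N_\times(\varphi)\to\pi(\varphi)$ almost surely as $N\to\infty$), asymptotically normal ($N^{1/2}[\pi^N_\times(\varphi)-\pi(\varphi)]\Rightarrow\mathcal{N}(0,\sigma^2_{\pi,\times}(\varphi))$ as $N\to\infty$), and its asymptotic variance is bounded above by that of $\pi^N(\varphi)$: $$\sigma^2_{\pi,\times}(\varphi)=\sigma^2_\times(w^\pi[\varphi-\pi(\varphi)])\leq\sigma^2(w^\pi[\varphi-\pi(\varphi)])=\sigma^2_\pi(\varphi).$$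
   Context: $K>1$ is an integer and $[N]:=\{1,\dots,N\}$ for every positive integer $N$. For each $k\in[K]$, $\mu_k$ is a probability distribution on a measurable space $(S_k,\mathcal{S}_k)$; $S:=S_1\times\dots\times S_K$ and $\mathcal{S}$ is the product sigma-algebra. $\varphi$ is a real-valued test function on $S$. $\mu(\psi):=\int\psi\,d\mu$ (similarly for $\gamma$ and $\pi$), and $L^2_\mu$ is the space of square $\mu$-integrable real-valued functions on $S$. $X^1,X^2,\dots$ are i.i.d. samples from $\mu$, with $X^n=(X^n_1,\dots,X^n_K)$; $\mu^N(\psi):=N^{-1}\sum_{n=1}^N\psi(X^n)$ and $\mu^N_\times(\psi):=N^{-K}\sum_{\mathbf{n}\in[N]^K}\psi(X^{\mathbf{n}})$, where $X^{\mathbf{n}}:=(X^{n_1}_1,\dots,X^{n_K}_K)$ for $\mathbf{n}=(n_1,\dots,n_K)$. For a function $\psi$ on $S$, $\sigma^2(\psi):=\mu([\psi-\mu(\psi)]^2)$ and $\sigma^2_\times(\psi):=\sum_{k=1}^K\mu_k([\mu_{\{k\}^c}(\psi)-\mu(\psi)]^2)$, where $\mu_{\{k\}^c}(\psi)$ is the function on $S_k$ obtained by integrating all arguments of $\psi$ except the $k$-th with respect to $\prod_{l\neq k}\mu_l$; such partial integrals are assumed to be well-defined at every point. $\sigma^2_{\pi,\times}(\varphi)$ and $\sigma^2_\pi(\varphi)$ denote the asymptotic variances (after centring and scaling by $N^{1/2}$) of $\pi^N_\times(\varphi)$ and $\pi^N(\varphi)$, respectively. $\Rightarrow$ denotes convergence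 in distribution.
   Formalization: Asymptotic normality of both estimators is stated only when σ²(w^π[φ−π(φ)]) is finite; wφ∈L²_μ alone does not ensure this (w=x₁^(−2/3), φ=1_{x₁>1/2} on [0,1]²) and the claim then fails. Also φ is measurable and γ(S)>0. *)

(* Defs.v *)
From HB Require Import structures.
From mathcomp Require Import all_boot all_order all_algebra.
From mathcomp Require Import all_classical all_reals all_analysis.

Set Implicit Arguments.
Unset Strict Implicit.
Unset Printing Implicit Defensive.

Import Order.TTheory GRing.Theory Num.Theory.
Import numFieldNormedType.Exports.

Local Open Scope classical_set_scope.
Local Open Scope ring_scope.

Definition cylinders (n : nat) (d : 'I_n -> measure_display)
    (S : forall k, measurableType (d k)) : set (set (forall k, S k)) :=
  [set B | exists k (A : set (S k)), measurable A /\ B = [set x | A (x k)]].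
Arguments cylinders {n d} S _.

(* S_1 x ... x S_n with its product sigma-algebra; elements are dependent
   functions. *)
Definition prodT (n : nat) (d : 'I_n -> measure_display)
    (S : forall k, measurableType (d k)) :=
  g_sigma_algebraType (cylinders S).
Arguments prodT {n d} S.

Lemma measurable_coord (n : nat) (d : 'I_n -> measure_display)
    (S : forall k, measurableType (d k)) (k : 'I_n) :
  measurable_fun setT (fun x : prodT S => x k).
Proof.
move=> _ A mA; rewrite setTI; apply: sub_sigma_algebra.
by exists k, A.
Qed.

Lemma measurable_prodT (d0 : measure_display) (T : measurableType d0)
    (n : nat) (d : 'I_n -> measure_display)
    (S : forall k, measurableType (d k)) (f : T -> prodT S) :
  (forall k, measurable_fun setT (fun x => f x k)) -> measurable_fun setT f.
Proof.
move=> mf; apply: (@measurability _ _ T (prodT S) setT f (cylinders S)) => //.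
move=> _ [_ [k [A [mA ->]]] <-].
exact: mf.
Qed.

Section glue.
Variables (n : nat) (d : 'I_n -> measure_display).
Variables (S : forall k, measurableType (d k)) (k : 'I_n).

(* The point whose k-th coordinate is p.1 and whose other coordinates, indexed
   through lift k : 'I_n.-1 -> 'I_n, are given by p.2. *)
Definition glue (p : S k * prodT (fun l => S (lift k l))) : prodT S :=
  fun i => match unliftP k i with
  | UnliftSome j e => eq_rect_r (fun i => S i) (p.2 j) e
  | UnliftNone e => eq_rect_r (fun i => S i) p.1 e
  end.

Lemma glue_self p : glue p k = p.1.
Proof.
rewrite /glue; case: unliftP => [j e|e].
  by exfalso; have := neq_lift k j; rewrite -e eqxx.
by rewrite (Prop_irrelevance e erefl).
Qed.

Lemma glue_lift p l : glue p (lift k l) = p.2 l.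
Proof.
rewrite /glue; case: unliftP => [j e|e]; last first.
  by exfalso; have := neq_lift k l; rewrite e eqxx.
have jl := lift_inj e; subst j.
by rewrite (Prop_irrelevance e erefl).
Qed.

Lemma measurable_glue : measurable_fun setT glue.
Proof.
apply: measurable_prodT => i; case: (unliftP k i) => [j ->|->].
  have -> : glue^~ (lift k j) = (fun p => p.2 j).
    by apply/funext => p; exact: glue_lift.
  exact: (@measurableT_comp _ _ _ _ (prodT (fun l => S (lift k l))) _
    (fun x => x j) setT snd (@measurable_coord _ _ _ j) measurable_snd).
have -> : glue^~ k = fst by apply/funext => p; exact: glue_self.
exact: measurable_fst.
Qed.

HB.instance Definition _ :=
  @isMeasurableFun.Build _ _ _ _ glue measurable_glue.
End glue.

(* mu_1 x ... x mu_n, split as mu_1 x (mu_2 x ... x mu_n); prod_probE below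
   gives its values on boxes. *)
Fixpoint prod_prob (R : realType) (n : nat) :
    forall (d : 'I_n -> measure_display) (S : forall k, measurableType (d k)),
    (forall k, probability (S k) R) -> probability (prodT S) R :=
  match n with
  | 0 => fun d S _ => dirac (point : prodT S)
  | n'.+1 => fun d S mu =>
      distribution (mu ord0 \x prod_prob (fun l => mu (lift ord0 l)))%E
        (@glue n'.+1 d S ord0)
  end.

Lemma prod_probE (R : realType) (n : nat) (d : 'I_n -> measure_display)
    (S : forall k, measurableType (d k)) (mu : forall k, probability (S k) R)
    (A : forall k, set (S k)) :
  (forall k, measurable (A k)) ->
  prod_prob mu [set x | forall k, A k (x k)] = (\prod_k mu k (A k))%E.
Proof.
elim: n d S mu A => [|n IH] d S mu A mA.
  by rewrite big_ord0 /= diracE mem_set//= => -[].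
rewrite big_ord_recl -IH => [|//].
rewrite -product_measure1E//; last first.
  have -> : [set x : prodT (fun l => S (lift ord0 l)) |
      forall l, A (lift ord0 l) (x l)] = \bigcap_(l in [set: 'I_n])
      ((fun x : prodT (fun l => S (lift ord0 l)) => x l)
        @^-1` (A (lift ord0 l))).
    by apply/seteqP; split => x /= h; [move=> l _; exact: h|move=> l; exact: h].
  apply: fin_bigcap_measurable => [|l _]; first exact: finite_finset.
  rewrite -[X in measurable X]setTI.
  exact: (@measurable_coord _ _ _ l measurableT _ (mA _)).
rewrite /= /distribution /pushforward; congr (product_measure1 _ _ _).
apply/seteqP; split => -[x y] /=.
  move=> h; split => [|l]; first by have := h ord0; rewrite glue_self.
  by have := h (lift ord0 l); rewrite glue_lift.
move=> [Ax Ay] k; case: (unliftP ord0 k) => [j ->|->].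
  by rewrite glue_lift; exact: Ay.
by rewrite glue_self.
Qed.

Section variances.
Variables (R : realType) (K : nat) (d : 'I_K -> measure_display).
Variables (S : forall k, measurableType (d k)).
Variable mu : forall k, probability (S k) R.
Implicit Type psi : prodT S -> R.

(* mu_{{k}^c}(psi), as a function on S k. For mu-integrable psi the integral
   exists for mu k-almost every x; the default value taken at the remaining
   points does not affect sigma2_cross. *)
Definition partial_mean (k : 'I_K) psi (x : S k) : R :=
  \int[prod_prob (fun l => mu (lift k l))]_y psi (glue (x, y)).

(* Values in [0, +oo]. *)
Definition sigma2 psi : \bar R :=
  (\int[prod_prob mu]_x
     ((psi x - \int[prod_prob mu]_y psi y) ^+ 2)%R%:E)%E.

Definition sigma2_cross psi : \bar R :=
  (\sum_(k < K) \int[mu k]_x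
     ((partial_mean psi x - \int[prod_prob mu]_y psi y) ^+ 2)%R%:E)%E.
End variances.

Section estimators.
Variables (R : realType) (K : nat) (d : 'I_K -> measure_display).
Variables (S : forall k, measurableType (d k)).
Implicit Types (w phi psi : prodT S -> R) (x : nat -> prodT S).

(* Sample paths are indexed from 0, so that the first N samples are
   x 0, ..., x N.-1. *)
Definition emp_mean (N : nat) psi x : R := N%:R^-1 * \sum_(n < N) psi (x n).

Definition emp_mean_cross (N : nat) psi x : R :=
  (N ^ K)%:R^-1 *
  \sum_(n : {ffun 'I_K -> 'I_N}) psi (fun k => x (n k) k).

(* By the convention 0^-1 = 0, these are 0 when their denominator is. *)
Definition snis (N : nat) w phi x : R :=
  emp_mean N (w \* phi) x / emp_mean N w x.

Definition snis_cross (N : nat) w phi x : R :=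
  emp_mean_cross N (w \* phi) x / emp_mean_cross N w x.
End estimators.

Section probability.
Variables (R : realType) (dO : measure_display) (Omega : measurableType dO).
Variable P : probability Omega R.

Definition mutually_independent (d : measure_display) (T : measurableType d)
    (X : nat -> {RV P >-> T}) :=
  forall (J : seq nat) (A : nat -> set T), uniq J ->
    (forall n, measurable (A n)) ->
    P (\bigcap_(n in [set` J]) X n @^-1` A n) =
    (\prod_(n <- J) P (X n @^-1` A n))%E.

Definition iid (d : measure_display) (T : measurableType d)
    (mu : probability T R) (X : nat -> {RV P >-> T}) :=
  mutually_independent X /\
  forall n (A : set T), measurable A -> distribution P (X n) A = mu A.

(* N(m, v), parametrised by its variance v >= 0. The case v = 0 is treated
   apart because normal_prob m 0 is not the Dirac mass at m. *)
Definition gaussian (m v : R) : probability (measurableTypeR R) R :=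
  if v == 0 then (dirac (m : measurableTypeR R) : probability _ _)
  else (normal_prob m (Num.sqrt v) : probability _ _).

Definition cvg_in_distribution (Z : nat -> Omega -> R)
    (nu : probability (measurableTypeR R) R) :=
  (forall N, measurable_fun setT (Z N)) /\
  forall f : R -> R, continuous f -> bounded_fun f ->
    (fun N => \int[P]_omega f (Z N omega)) @ \oo --> \int[nu]_x f x.

(* The estimator Z of theta is asymptotically normal with asymptotic
   variance v. *)
Definition asymptotically_normal (Z : nat -> Omega -> R) (theta v : R) :=
  cvg_in_distribution
    (fun N omega => Num.sqrt N%:R * (Z N omega - theta)) (gaussian 0 v).
End probability.

(* Main.v *)
Require Import Defs.
From HB Require Import structures.
From mathcomp Require Import all_boot all_order all_algebra.
From mathcomp Require Import all_classical all_reals all_analysis.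
From mathcomp Require Import measurable_realfun.
From mathcomp Require Import ring lra.

(** Put psi = w^pi (phi - pi(phi)); it has mu-mean 0.  Whenever the
    denominators do not vanish, sqrt N (pi^N_x(phi) - pi(phi)) is
    sqrt N mu^N_x(psi) divided by mu^N_x(w^pi), and likewise for pi^N; since
    mu(w^pi) = 1, everything comes down to averages of one fixed function over
    the samples, or over all their coordinatewise recombinations X^n.

    _Consistency._ Write U_N(f) for mu^N_x(f).  Two index vectors drawn at
    random share a coordinate with frequency at most K/N, and otherwise the
    recombinations are independent; truncating f and computing a second moment
    gives U_N(f) -> mu(f) in L^1 ([cross_L1_lln]).  To reach almost sure
    convergence, observe that U_N, U_(N+1), ... do not change when the k-th
    coordinates of the first N samples are permuted, separately for each k.
    Hence E[U_m(f) g] = E[U_N(f) g] for m <= N and every bounded g depending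
    on the later averages only ([emp_mean_cross_exchangeable]): the sequence is
    a reverse martingale.  Splitting the event that |U_N(f)| exceeds lambda for
    some N >= m according to the last such N bounds its probability by
    E|U_m(f)| / lambda ([maximal_inequality]), and the right-hand side
    vanishes as m grows ([cross_strong_law]).

    _Asymptotic normality._ Let h(x) be the sum over k of mu_{k^c}(psi)(x_k)
    ([hajek]).  Being a sum of functions of one coordinate, h has the same
    average over the recombinations as over the samples, and its variance is
    sigma^2_x(psi).  The residual r = psi - h has conditional mean zero given
    any single coordinate ([bil_residual]), so r(X^n) and r(X^n') are
    uncorrelated unless n and n' agree in two coordinates, which has frequency
    at most K^2/N^2; thus N E[U_N(r)^2] = O(1/N) ([hajek_approximation]).
    What remains is the central limit theorem for sqrt N mu^N(h), proved by
    Lindeberg's replacement method for functions with a third-order Taylor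
    estimate ([clt_taylor]).  Smooth steps have such an estimate, and
    they suffice to recover all bounded continuous functions ([portmanteau])
    and to absorb the random denominator ([step_cvg_slutsky],
    [ratio_slutsky]).

    _Comparison of variances._ h is the orthogonal projection of psi onto the
    sums of functions of one coordinate, and a projection decreases the
    L^2-norm ([proj_var_le]). *)

Set Implicit Arguments.
Unset Strict Implicit.
Unset Printing Implicit Defensive.

Import Order.TTheory GRing.Theory Num.Theory.
Import numFieldNormedType.Exports.

Local Open Scope classical_set_scope.
Local Open Scope ring_scope.

(** * Integrals of real-valued functions *)

Definition rintegrable (dT : measure_display) (T : measurableType dT)
    (R : realType) (mu : set T -> \bar R) (f : T -> R) : Prop :=
  mu.-integrable setT (EFin \o f).

Section rintegrable_measure.
Context (dT : measure_display) (T : measurableType dT) (R : realType).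
Variable mu : {measure set T -> \bar R}.
Implicit Types f g : T -> R.
Local Notation ri := (rintegrable mu).

Lemma ri_measurable f : ri f -> measurable_fun setT f.
Proof. by move=> /measurable_int/measurable_EFinP. Qed.

Lemma ri_le f g : measurable_fun setT f -> ri g ->
  (forall x, `|f x| <= g x) -> ri f.
Proof.
move=> mf ig fg; apply: le_integrable ig => //; first exact/measurable_EFinP.
by move=> x _; rewrite /= lee_fin (le_trans (fg x))// ler_norm.
Qed.

Lemma riD f g : ri f -> ri g -> ri (fun x => f x + g x).
Proof. by move=> fi gi; exact: (integrableD measurableT fi gi). Qed.

Lemma riZ c f : ri f -> ri (fun x => c * f x).
Proof. by move=> fi; exact: (integrableZl measurableT c fi). Qed.

Lemma riN f : ri f -> ri (fun x => - f x).
Proof.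
by move=> /(riZ (-1)); congr ri; apply/funext => x; rewrite mulN1r.
Qed.

Lemma riB f g : ri f -> ri g -> ri (fun x => f x - g x).
Proof. by move=> fi /riN gi; exact: riD. Qed.

Lemma ri_abs f : ri f -> ri (fun x => `|f x|).
Proof. exact: integrable_norm. Qed.

Lemma ri_sum (I : Type) (s : seq I) (F : I -> T -> R) :
  (forall i, ri (F i)) -> ri (fun x => \sum_(i <- s) F i x).
Proof.
move=> iF; elim: s => [|i s IH].
  rewrite (_ : (fun _ => _) = cst 0); first exact: integrable0.
  by apply/funext => x; rewrite big_nil.
rewrite (_ : (fun _ => _) = (fun x => F i x + \sum_(i <- s) F i x)).
  exact: riD.
by apply/funext => x; rewrite big_cons.
Qed.

(** |f g| <= f^2 + g^2. *)
Lemma riM_sqr f g : measurable_fun setT f -> measurable_fun setT g ->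
  ri (fun x => f x ^+ 2) -> ri (fun x => g x ^+ 2) -> ri (fun x => f x * g x).
Proof.
move=> mf mg f2 g2; apply: (ri_le _ (riD f2 g2)).
  exact: measurable_funM.
by move=> x; rewrite normrM -(real_normK (num_real (f x)))
  -(real_normK (num_real (g x))); nra.
Qed.

Lemma ri_sqrD f g : measurable_fun setT f -> measurable_fun setT g ->
  ri (fun x => f x ^+ 2) -> ri (fun x => g x ^+ 2) ->
  ri (fun x => (f x + g x) ^+ 2).
Proof.
move=> mf mg f2 g2; have := riD (riD f2 (riZ 2 (riM_sqr mf mg f2 g2))) g2.
by congr ri; apply/funext => x; ring.
Qed.

Lemma ri_sqrZ c f : ri (fun x => f x ^+ 2) -> ri (fun x => (c * f x) ^+ 2).
Proof.
by move=> /(riZ (c ^+ 2)); congr ri; apply/funext => x; rewrite exprMn.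
Qed.

Lemma ri_sqrB f g : measurable_fun setT f -> measurable_fun setT g ->
  ri (fun x => f x ^+ 2) -> ri (fun x => g x ^+ 2) ->
  ri (fun x => (f x - g x) ^+ 2).
Proof.
move=> mf mg f2 g2; have := riD (riB f2 (riZ 2 (riM_sqr mf mg f2 g2))) g2.
by congr ri; apply/funext => x; ring.
Qed.

Lemma riM_bnd c f g : ri f -> measurable_fun setT g ->
  (forall x, `|g x| <= c) -> ri (fun x => f x * g x).
Proof.
move=> fi mg gc; apply: (ri_le _ (riZ c (ri_abs fi))).
  by apply: measurable_funM => //; exact: ri_measurable.
by move=> x; rewrite normrM mulrC ler_wpM2r.
Qed.

Lemma RintD f g : ri f -> ri g ->
  \int[mu]_x (f x + g x) = \int[mu]_x f x + \int[mu]_x g x.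
Proof. by move=> fi gi; rewrite RintegralD. Qed.

Lemma RintB f g : ri f -> ri g ->
  \int[mu]_x (f x - g x) = \int[mu]_x f x - \int[mu]_x g x.
Proof. by move=> fi gi; rewrite RintegralB. Qed.

Lemma RintZ c f : ri f -> \int[mu]_x (c * f x) = c * \int[mu]_x f x.
Proof. by move=> fi; rewrite RintegralZl. Qed.

Lemma Rint_sum (I : Type) (s : seq I) (F : I -> T -> R) :
  (forall i, ri (F i)) ->
  \int[mu]_x (\sum_(i <- s) F i x) = \sum_(i <- s) \int[mu]_x F i x.
Proof.
move=> iF; elim: s => [|i s IH].
  rewrite big_nil -(@Rintegral_set0 _ _ _ mu (cst 0)) /Rintegral integral_set0.
  by rewrite integral0_eq// => x _; rewrite big_nil.
rewrite big_cons -IH -RintD//; last exact: ri_sum.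
by apply: eq_Rintegral => x _; rewrite big_cons.
Qed.

Lemma ler_Rint f g : ri f -> ri g -> (forall x, f x <= g x) ->
  \int[mu]_x f x <= \int[mu]_x g x.
Proof. by move=> fi gi fg; apply: le_Rintegral. Qed.

Lemma normr_Rint_le f : ri f -> `|\int[mu]_x f x| <= \int[mu]_x `|f x|.
Proof. by move=> fi; apply: le_normr_Rintegral. Qed.

Lemma RintK f : ri f -> (\int[mu]_x (f x)%:E)%E = (\int[mu]_x f x)%:E.
Proof. by move=> fi; rewrite fineK//; exact: integrable_fin_num. Qed.

Lemma Rint_dct (f_ : nat -> T -> R) f g :
  (forall n, measurable_fun setT (f_ n)) -> ri g ->
  (forall n x, `|f_ n x| <= g x) ->
  (forall x, (fun n => f_ n x) @ \oo --> f x) ->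
  (fun n => \int[mu]_x f_ n x) @ \oo --> \int[mu]_x f x.
Proof.
move=> mf ig fg cf.
have mfl : measurable_fun setT f.
  by apply: (@measurable_fun_cvg _ _ _ _ f_) => // x _; exact: cf.
have [|||||fi _ h] := @dominated_convergence _ _ _ mu setT measurableT
  (fun n => EFin \o f_ n) (EFin \o f) (EFin \o g).
- by move=> n; exact/measurable_EFinP.
- exact/measurable_EFinP.
- by apply/aeW => x _; apply: cvg_EFin; [exact: nearW|exact: cf].
- exact: ig.
- by apply/aeW => x n _ /=; rewrite lee_fin.
apply: fine_cvg; rewrite -RintK//; exact: h.
Qed.

End rintegrable_measure.

(** The law of Y, for functions Y that are not packaged as random variables and
    for P that need not be a probability: Lebesgue measure is used below. *)
Definition has_law (d1 d2 : measure_display) (T1 : measurableType d1)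
    (T2 : measurableType d2) (R : realType) (P : set T1 -> \bar R)
    (Y : T1 -> T2) (nu : set T2 -> \bar R) :=
  measurable_fun setT Y /\
  forall A, measurable A -> P (Y @^-1` A) = nu A.

Section laws.
Context (d1 d2 : measure_display) (T1 : measurableType d1).
Context (T2 : measurableType d2) (R : realType).
Variables (P : {measure set T1 -> \bar R}) (nu : {measure set T2 -> \bar R}).
Variables (Y : T1 -> T2) (Ylaw : has_law P Y nu).

Lemma law_ge0_integral (f : T2 -> \bar R) : measurable_fun setT f ->
  (forall y, 0 <= f y)%E -> (\int[P]_x f (Y x) = \int[nu]_y f y)%E.
Proof.
case: Ylaw => mY PY mf f0.
transitivity (\int[pushforward P Y]_y f y)%E.
  by rewrite ge0_integral_pushforward.
by apply: eq_measure_integral => A mA _; exact: PY.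
Qed.

(** Both sides are the same combination of the integrals of the positive and the
    negative part. *)
Lemma law_Rint (f : T2 -> R) : measurable_fun setT f ->
  \int[P]_x f (Y x) = \int[nu]_y f y.
Proof.
move=> mf; rewrite /Rintegral integralE [in RHS]integralE.
under eq_integral do rewrite (funepos_comp (EFin \o f) Y).
under [X in (_ - X)%E]eq_integral do rewrite (funeneg_comp (EFin \o f) Y).
have mf' : measurable_fun setT (EFin \o f) by exact/measurable_EFinP.
rewrite (law_ge0_integral (measurable_funepos mf'))//.
by rewrite (law_ge0_integral (measurable_funeneg mf')).
Qed.

Lemma law_ri (f : T2 -> R) : measurable_fun setT f ->
  rintegrable P (fun x => f (Y x)) <-> rintegrable nu f.
Proof.
move=> mf; have mf' : measurable_fun setT (EFin \o f) by exact/measurable_EFinP.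
have mY := Ylaw.1.
have E := law_ge0_integral (measurableT_comp (@abse_measurable R setT) mf')
  (fun y => abse_ge0 _).
split => /integrableP[_ h]; apply/integrableP; split => //.
- by rewrite -E.
- exact: (measurableT_comp mf').
- by rewrite [ltLHS]E.
Qed.

End laws.

Section probability_integrals.
Context (dT : measure_display) (T : measurableType dT) (R : realType).
Variable mu : probability T R.
Implicit Types f g : T -> R.
Local Notation ri := (rintegrable mu).

Lemma ri_cst c : ri (fun=> c).
Proof. exact: finite_measure_integrable_cst. Qed.

Lemma ri_bounded c f : measurable_fun setT f -> (forall x, `|f x| <= c) -> ri f.
Proof. by move=> mf fc; exact: (ri_le mf (ri_cst c)). Qed.

Lemma ri_of_sqr f : measurable_fun setT f -> ri (fun x => f x ^+ 2) -> ri f.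
Proof.
move=> mf f2; apply: (ri_le mf (riD (ri_cst 1) f2)) => x.
by rewrite -(real_normK (num_real (f x))); have := normr_ge0 (f x); nra.
Qed.

Lemma Rint_cst c : \int[mu]_x c = c.
Proof.
rewrite (Rintegral_cst mu measurableT) -[RHS]mulr1; congr (_ * _).
exact: (congr1 fine (@probability_setT _ _ _ mu)).
Qed.

Lemma Rint_centred_sqr f : measurable_fun setT f -> ri (fun x => f x ^+ 2) ->
  \int[mu]_x ((f x - \int[mu]_y f y) ^+ 2) =
  \int[mu]_x (f x ^+ 2) - (\int[mu]_x f x) ^+ 2.
Proof.
move=> mf f2; have fi := ri_of_sqr mf f2; set m := \int[mu]_x f x.
transitivity (\int[mu]_x (f x ^+ 2 + (- (2 * m) * f x + m ^+ 2))).
  by apply: eq_Rintegral => x _; ring.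
rewrite RintD//; last exact/riD/ri_cst/riZ.
rewrite RintD//; [|exact: riZ|exact: ri_cst].
by rewrite RintZ// Rint_cst -/m; ring.
Qed.

Lemma sqr_Rint_le f : measurable_fun setT f -> ri (fun x => f x ^+ 2) ->
  (\int[mu]_x f x) ^+ 2 <= \int[mu]_x (f x ^+ 2).
Proof.
move=> mf f2; rewrite -subr_ge0 -Rint_centred_sqr//.
by apply: Rintegral_ge0 => x _; exact: sqr_ge0.
Qed.

End probability_integrals.

Section real_fubini.
Context (d1 d2 : measure_display) (T1 : measurableType d1).
Context (T2 : measurableType d2) (R : realType).
Variables (m1 : probability T1 R) (m2 : probability T2 R).
Variable F : T1 * T2 -> R.
Hypothesis Fi : rintegrable (m1 \x m2)%E F.

Let mF : measurable_fun setT (EFin \o F).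
Proof. exact: measurable_int Fi. Qed.

(** The inner integral may be infinite on a null set, where its real-valued
    version is 0; this only decreases its absolute value. *)
Lemma ri_fubini : rintegrable m1 (fun x => \int[m2]_y F (x, y)).
Proof.
have h := integrable_fubini_F Fi.
have mf : measurable_fun setT (fun x => \int[m2]_y F (x, y)).
  by apply: (measurableT_comp (@fine_measurable R setT measurableT));
    exact: measurable_int h.
apply: le_integrable h => //; first exact/measurable_EFinP.
have absfine (e : \bar R) : (`|(fine e)%:E| <= `|e|)%E.
  by case: e => [r||] /=; rewrite ?normr0 ?leey.
by move=> x _; exact: absfine.
Qed.

Lemma Rint_fubini :
  \int[m1]_x (\int[m2]_y F (x, y)) = \int[(m1 \x m2)%E]_z F z.
Proof.
congr fine; rewrite -integral12_prod_meas1//.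
apply: ae_eq_integral => //.
- exact: measurable_int ri_fubini.
- exact: measurable_int (integrable_fubini_F Fi).
have := ae_integrable1 Fi; apply: filterS => x Fx _.
exact: (esym (RintK Fx)).
Qed.

Lemma Rint_fubini21 :
  \int[m2]_y (\int[m1]_x F (x, y)) = \int[(m1 \x m2)%E]_z F z.
Proof.
have h := measurable_fubini_G Fi.
congr fine; rewrite -integral21_prod_meas1//.
apply: ae_eq_integral => //.
- apply/measurable_EFinP.
  by apply: (measurableT_comp (@fine_measurable R setT measurableT));
    exact: h.
have := ae_integrable2 Fi; apply: filterS => x Fx _.
exact: (esym (RintK Fx)).
Qed.

End real_fubini.

(** * Laws on product spaces *)

Section law_facts.
Context (d1 d2 d3 : measure_display) (T1 : measurableType d1).
Context (T2 : measurableType d2) (T3 : measurableType d3) (R : realType).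

Lemma law_comp (P : set T1 -> \bar R) (nu : set T2 -> \bar R)
    (rho : set T3 -> \bar R) (Y : T1 -> T2) (Z : T2 -> T3) :
  has_law P Y nu -> has_law nu Z rho -> has_law P (Z \o Y) rho.
Proof.
move=> [mY PY] [mZ nuZ]; split; first exact: measurableT_comp.
move=> A mA; rewrite -nuZ// comp_preimage PY//.
by rewrite -[X in measurable X]setTI; exact: mZ.
Qed.

Lemma law_snd (m1 : probability T1 R) (m2 : probability T2 R) :
  has_law (m1 \x m2)%E snd m2.
Proof.
split; first exact: measurable_snd.
move=> A mA; have -> : snd @^-1` A = [set: T1] `*` A.
  by apply/seteqP; split => -[x y] //= [].
by rewrite product_measure1E// [X in (X * _)%E](@probability_setT _ _ _ m1) mul1e.
Qed.

Lemma law_fst (m1 : probability T1 R) (m2 : probability T2 R) :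
  has_law (m1 \x m2)%E fst m1.
Proof.
split; first exact: measurable_fst.
move=> A mA; have -> : fst @^-1` A = A `*` [set: T2].
  by apply/seteqP; split => -[x y] //= [].
by rewrite product_measure1E// [X in (_ * X)%E](@probability_setT _ _ _ m2) mule1.
Qed.

(** Rectangles are stable under intersection and generate the product
    sigma-algebra. *)
Lemma law_on_rectangles (P : probability T1 R) (m2 : probability T2 R)
    (m3 : probability T3 R) (Y : T1 -> T2 * T3) :
  measurable_fun setT Y ->
  (forall A B, measurable A -> measurable B ->
    P (Y @^-1` (A `*` B)) = (m2 A * m3 B)%E) ->
  has_law P Y (m2 \x m3)%E.
Proof.
move=> mY PY; split => // A mA.
pose Yf := @isMeasurableFun.Build _ _ _ _ Y mY.
pose Ym : {RV P >-> (T2 * T3)%type} := HB.pack Y Yf.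
exact/esym/(@product_measure_unique _ _ _ _ _ m2 m3 (distribution P Ym)).
Qed.

End law_facts.

Section product_spaces.
Context (R : realType) (n : nat) (d : 'I_n -> measure_display).
Context (S : forall k, measurableType (d k)).

Definition box (A : forall k, set (S k)) : set (prodT S) :=
  [set x | forall k, A k (x k)].

Lemma measurable_preimage_coord k (A : set (S k)) : measurable A ->
  measurable [set x : prodT S | A (x k)].
Proof. by move=> mA; apply: sub_sigma_algebra; exists k, A. Qed.

Lemma measurable_box (A : forall k, set (S k)) :
  (forall k, measurable (A k)) -> measurable (box A).
Proof.
move=> mA; rewrite (_ : box A =
    \bigcap_(k in [set: 'I_n]) [set x : prodT S | A k (x k)]); last first.
  by apply/seteqP; split => x /= h; [move=> k _; exact: h|move=> k; exact: h].
apply: fin_bigcap_measurable => [|k _]; first exact: finite_finset.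
exact: measurable_preimage_coord.
Qed.

(** In the box, the set prescribed at the coordinate l has type set (S l), so A
    itself has to be transported along k = l. *)
Lemma cylinder_box k (A : set (S k)) : measurable A ->
  exists A' : forall l, set (S l), [/\ forall l, measurable (A' l),
    A' k = A, forall l, l != k -> A' l = setT &
    [set x : prodT S | A (x k)] = box A'].
Proof.
move=> mA.
pose A' l : set (S l) := [set y | forall e : k = l, A (eq_rect_r S y e)].
have A'k : A' k = A.
  apply/seteqP; split => y /=; first by move=> /(_ erefl).
  by move=> Ay e; rewrite (Prop_irrelevance e erefl).
have A'l l : l != k -> A' l = setT.
  by move=> lk; apply/seteqP; split => // y _ e; case/eqP: lk.
exists A'; split => //.
  by move=> l; have [->|lk] := eqVneq l k; [rewrite A'k|rewrite A'l].
apply/seteqP; split => x /= h.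
  move=> l; have [->|lk] := eqVneq l k; first by rewrite A'k.
  by rewrite A'l.
by have := h k; rewrite A'k.
Qed.

Lemma prodT_generated (G : set (set (prodT S))) :
  (forall B, G B -> measurable B) ->
  (forall k (A : set (S k)), measurable A ->
    <<s G >> [set x : prodT S | A (x k)]) ->
  @measurable _ (prodT S) = <<s G >>.
Proof.
move=> mG Gcyl; apply/seteqP; split => B.
  apply: smallest_sub; first exact: smallest_sigma_algebra.
  by move=> _ [k [A [mA ->]]]; exact: Gcyl.
apply: smallest_sub => //; exact: sigma_algebra_measurable.
Qed.

(** Boxes form a pi-system that contains the cylinders. *)
Lemma box_unique (m1 m2 : probability (prodT S) R) :
  (forall A : forall k, set (S k), (forall k, measurable (A k)) ->
    m1 (box A) = m2 (box A)) ->
  forall B, measurable B -> m1 B = m2 B.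
Proof.
move=> m12 B mB.
pose G := [set B | exists A : forall k, set (S k),
  (forall k, measurable (A k)) /\ B = box A].
have GT : G setT by exists (fun=> setT); split => //; apply/seteqP; split.
apply: (@measure_unique _ R (prodT S) G (fun=> setT)) => //.
- apply: prodT_generated => [_ [A [mA ->]]|k A mA]; first exact: measurable_box.
  have [A' [mA' _ _ ->]] := cylinder_box mA.
  by apply: sub_sigma_algebra; exists A'.
- move=> _ _ [A [mA ->]] [A' [mA' ->]]; exists (fun k => A k `&` A' k).
  split => [k|]; first exact: measurableI.
  by apply/seteqP; split => x; [move=> [h h'] k; split|move=> h; split=> k;
    have [] := h k].
- by rewrite bigcup_const.
- by move=> _ [A [mA ->]]; exact: m12.
- by move=> _; exact: le_lt_trans (probability_le1 m1 measurableT) (ltry _).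
Qed.

Lemma law_on_boxes (dT : measure_display) (T : measurableType dT)
    (P : probability T R) (Y : T -> prodT S) (nu : probability (prodT S) R) :
  measurable_fun setT Y ->
  (forall A : forall k, set (S k), (forall k, measurable (A k)) ->
    P (Y @^-1` box A) = nu (box A)) ->
  has_law P Y nu.
Proof.
move=> mY PY; split => // A mA.
pose Yf := @isMeasurableFun.Build _ _ _ _ Y mY.
pose Ym : {RV P >-> prodT S} := HB.pack Y Yf.
exact: (@box_unique (distribution P Ym) nu).
Qed.

End product_spaces.

Section product_laws.
Context (R : realType) (n : nat) (d : 'I_n -> measure_display).
Context (S : forall k, measurableType (d k)).
Variable mu_ : forall k, probability (S k) R.
Let mu := prod_prob mu_.

Lemma law_coord k : has_law mu (fun x => x k) (mu_ k).
Proof.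
split; first exact: measurable_coord.
move=> A mA; have [A' [mA' A'k A'l e]] := cylinder_box mA.
transitivity (mu (box A')); first by rewrite -e.
rewrite /mu prod_probE// (bigD1 k)//= A'k big1 ?mule1// => l lk.
by rewrite A'l// probability_setT.
Qed.

(** The definition of the product probability splits off the first
    coordinate; any other coordinate can be split off as well. *)
Lemma law_glue k :
  has_law (mu_ k \x prod_prob (fun l => mu_ (lift k l)))%E (@Defs.glue n d S k) mu.
Proof.
apply: (law_on_boxes (P := (mu_ k \x prod_prob (fun l => mu_ (lift k l)))%E)).
  exact: measurable_glue.
move=> A mA; rewrite /mu prod_probE// (bigD1_ord k)//= -prod_probE//.
rewrite -[in RHS]product_measure1E//; last first.
  exact: (@measurable_box n.-1 (fun l => d (lift k l)) (fun l => S (lift k l))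
    (fun l => A (lift k l)) (fun l => mA (lift k l))).
congr (product_measure1 _ _ _); apply/seteqP; split => -[x y] /=.
  move=> h; split => [|l]; first by have := h k; rewrite glue_self.
  by have := h (lift k l); rewrite glue_lift.
move=> [Ax Ay] l; case: (unliftP k l) => [j ->|->].
  by rewrite glue_lift; exact: Ay.
by rewrite glue_self.
Qed.

(** Resampling from b all coordinates of a except the k-th.  Conditional
    expectation given the k-th coordinate becomes integration over b. *)
Definition repl k (a b : prodT S) : prodT S :=
  fun l => if l == k then a l else b l.

Lemma repl_self k a b : repl k a b k = a k.
Proof. by rewrite /repl eqxx. Qed.

Lemma repl_neq k l a b : l != k -> repl k a b l = b l.
Proof. by move=> /negbTE lk; rewrite /repl lk. Qed.

Lemma measurable_repl k :
  measurable_fun setT (fun p : prodT S * prodT S => repl k p.1 p.2).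
Proof.
apply: measurable_prodT => l; rewrite /repl; case: (l == k).
  exact: (measurableT_comp (@measurable_coord _ _ S l) measurable_fst).
exact: (measurableT_comp (@measurable_coord _ _ S l) measurable_snd).
Qed.

Lemma measurable_repl2 k a : measurable_fun setT (repl k a).
Proof.
apply: measurable_prodT => l; rewrite /repl; case: (l == k) => //.
exact: measurable_coord.
Qed.

(** If a and b are independent, a k is still independent of the other coordinates
    of b. *)
Lemma law_repl k : has_law (mu \x mu)%E (fun p => repl k p.1 p.2) mu.
Proof.
apply: (law_on_boxes (P := (mu \x mu)%E)); first exact: measurable_repl.
move=> A mA; pose A' l := if l == k then setT else A l.
have mA' l : measurable (A' l) by rewrite /A'; case: ifP.
have -> : (fun p => repl k p.1 p.2) @^-1` box A =
    [set a | A k (a k)] `*` box A'.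
  apply/seteqP; split => -[a b] /=.
    move=> h; split; first by have := h k; rewrite repl_self.
    move=> l; rewrite /A'; have [->|lk] := eqVneq l k => //.
    by have := h l; rewrite repl_neq.
  move=> [Aa Ab] l; have [->|lk] := eqVneq l k; first by rewrite repl_self.
  by rewrite repl_neq//; have := Ab l; rewrite /A' (negbTE lk).
transitivity (mu [set a | A k (a k)] * mu (box A'))%E.
  by apply: product_measure1E;
    [exact: measurable_preimage_coord|exact: measurable_box].
rewrite (law_coord k).2// /mu !prod_probE// (bigD1 k)//=.
rewrite [in RHS](bigD1 k)//=; congr (_ * _)%E.
rewrite /A' eqxx probability_setT mul1e.
by apply: eq_bigr => l /negbTE ->.
Qed.

(** Integrating out the coordinates other than the k-th amounts to resampling
    them. *)
Lemma partial_mean_repl k (g : prodT S -> R) (a : prodT S) :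
  measurable_fun setT g ->
  \int[mu]_b g (repl k a b) = partial_mean mu_ g (a k).
Proof.
move=> mg.
rewrite -(law_Rint (law_glue k) (measurableT_comp mg (measurable_repl2 k a))).
have reE p : repl k a (Defs.glue p) = Defs.glue (a k, p.2).
  apply: functional_extensionality_dep => l; rewrite /repl; have [->|lk] := eqVneq l k.
    by rewrite glue_self.
  case: (unliftP k l) lk => [j ->|->]; first by rewrite !glue_lift.
  by rewrite eqxx.
under eq_Rintegral do rewrite /= reE.
have mga : measurable_fun setT (fun y => g (@Defs.glue n d S k (a k, y))).
  apply: (measurableT_comp mg).
  by apply: (measurableT_comp (@measurable_glue _ _ S k)).
exact: (law_Rint (law_snd _ _) mga).
Qed.

End product_laws.

(** * Joint laws of entries of an i.i.d. sample *)

Section arrays.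
Context (R : realType) (K : nat) (d : 'I_K -> measure_display).
Context (S : forall k, measurableType (d k)).
Variable mu_ : forall k, probability (S k) R.
Let mu := prod_prob mu_.

Definition array m := prodT (fun _ : 'I_m => prodT S).

Definition array_prob m : probability (array m) R :=
  prod_prob (fun _ : 'I_m => mu).

Definition cells m (A : 'I_m -> forall k, set (S k)) : set (array m) :=
  [set y | forall i k, A i k (y i k)].

Lemma cellsE m (A : 'I_m -> forall k, set (S k)) :
  cells A = @box m _ (fun _ => prodT S) (fun i => box (A i)).
Proof. by []. Qed.

Lemma measurable_cells m (A : 'I_m -> forall k, set (S k)) :
  (forall i k, measurable (A i k)) -> measurable (cells A).
Proof.
move=> mA; rewrite cellsE; apply: measurable_box => i.
exact: measurable_box.
Qed.

Lemma array_prob_cells m (A : 'I_m -> forall k, set (S k)) :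
  (forall i k, measurable (A i k)) ->
  array_prob m (cells A) = (\prod_(i < m) \prod_k mu_ k (A i k))%E.
Proof.
move=> mA; rewrite cellsE /array_prob prod_probE; last first.
  by move=> i; exact: measurable_box.
by apply: eq_bigr => i _; exact: prod_probE.
Qed.

Lemma measurable_array (dT : measure_display) (T : measurableType dT) m
    (Y : T -> array m) :
  (forall i k, measurable_fun setT (fun t => Y t i k)) -> measurable_fun setT Y.
Proof. by move=> mY; do 2 apply: measurable_prodT => ?; exact: mY. Qed.

(** The pi-system argument again, one level deeper: cells prescribe a set for
    every coordinate of every row. *)
Lemma law_on_cells (dT : measure_display) (T : measurableType dT)
    (P : probability T R) m (Y : T -> array m) :
  measurable_fun setT Y ->
  (forall A : 'I_m -> forall k, set (S k), (forall i k, measurable (A i k)) ->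
    P (Y @^-1` cells A) = (\prod_(i < m) \prod_k mu_ k (A i k))%E) ->
  has_law P Y (array_prob m).
Proof.
move=> mY PY; split => // B mB.
pose Yf := @isMeasurableFun.Build _ _ _ _ Y mY.
pose Ym : {RV P >-> array m} := HB.pack Y Yf.
pose G := [set B | exists A : 'I_m -> forall k, set (S k),
  (forall i k, measurable (A i k)) /\ B = cells A].
have GT : G setT by exists (fun _ _ => setT); split => //; apply/seteqP; split.
apply: (@measure_unique _ R (array m) G (fun=> setT) _ _ _ _
  (distribution P Ym)) => //.
- apply: prodT_generated => [_ [A [mA ->]]|i A mA]; first exact: measurable_cells.
  have h : measurable_fun setT
      ((fun y : g_sigma_algebraType G => (y : array m) i) : _ -> prodT S).
    apply: measurable_prodT => k _ C mC; rewrite setTI.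
    have [C' [mC' C'k C'l e]] := cylinder_box mC.
    apply: sub_sigma_algebra.
    exists (fun j => if j == i then C' else fun=> setT); split.
      by move=> j l; case: ifP.
    apply/seteqP; split => y /=.
      rewrite -[C (y i k)]/([set x : prodT S | C (x k)] (y i)) e => Cy j l.
      by have [->|ji] := eqVneq j i; [exact: Cy|].
    move=> h; rewrite -[C (y i k)]/([set x : prodT S | C (x k)] (y i)) e => l.
    by have := h i l; rewrite eqxx.
  by have := h measurableT A mA; rewrite setTI.
- move=> _ _ [A [mA ->]] [A' [mA' ->]]; exists (fun i k => A i k `&` A' i k).
  split => [i k|]; first exact: measurableI.
  by apply/seteqP; split => x; [move=> [h h'] i k; split|
    move=> h; split=> i k; have [] := h i k].
- by rewrite bigcup_const.
- by move=> _ [A [mA ->]]; exact: etrans (PY _ mA) (esym (array_prob_cells mA)).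
- by move=> _; exact: le_lt_trans (probability_le1 _ measurableT) (ltry _).
Qed.

Lemma law_array_row m (i : 'I_m) : has_law (array_prob m) (fun y => y i) mu.
Proof. exact: (@law_coord R m _ (fun=> prodT S) (fun=> mu)). Qed.

Lemma law_array_pair :
  has_law (array_prob 2) (fun y => (y ord0, y (lift ord0 ord0))) (mu \x mu)%E.
Proof.
have mY : measurable_fun setT
    (fun y : array 2 => (y ord0, y (lift ord0 ord0))).
  by apply/measurable_fun_pairP; split; exact: measurable_coord.
apply: law_on_rectangles => // A C mA mC.
transitivity (array_prob 2 (@box 2 _ (fun=> prodT S)
    (fun i => if i == ord0 then A else C))).
  congr (array_prob 2 _); apply/seteqP; split => y /=.
    by move=> [Ay Cy] i; case: (unliftP ord0 i) => [j ->|->] //; rewrite ord1.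
  by move=> h; split; [exact: (h ord0)|exact: (h (lift ord0 ord0))].
rewrite /array_prob prod_probE => [|i]; last by case: ifP.
by rewrite !big_ord_recl big_ord0/= mule1.
Qed.

Context (dO : measure_display) (Omega : measurableType dO).
Variables (P : probability Omega R) (X : nat -> {RV P >-> prodT S}).
Hypothesis iidX : iid mu X.

Definition entries m (idx : 'I_m -> 'I_K -> nat) (omega : Omega) : array m :=
  fun i k => X (idx i k) omega k.

Lemma measurable_entries m (idx : 'I_m -> 'I_K -> nat) :
  measurable_fun setT (entries idx).
Proof.
apply: measurable_array => i k.
exact: (measurableT_comp (@measurable_coord _ _ S k)).
Qed.

(** The entries of an i.i.d. sample are independent along rows and along columns.
    Row i of the new array takes its k-th coordinate from the sample numbered
    idx i k; injectivity in i for each k says that no entry of the sample is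
    used twice.  On a cell, the constraints on the sample numbered j are
    collected into the box C j, and the product over j and k is
    rearranged into one over i and k. *)
Lemma law_entries m (idx : 'I_m -> 'I_K -> nat) :
  (forall k, injective (idx ^~ k)) -> has_law P (entries idx) (array_prob m).
Proof.
move=> idx_inj; apply: law_on_cells; first exact: measurable_entries.
move=> A mA.
pose L := (\max_(i < m) \max_(k < K) (idx i k).+1)%N.
have ltL i k : (idx i k < L)%N.
  apply: leq_trans (leq_bigmax i); exact: (leq_bigmax k).
pose C j k := [set x | forall i, idx i k = j -> A i k x].
have CE j k i : idx i k = j -> C j k = A i k.
  move=> ij; apply/seteqP; split => x /=; first exact.
  by move=> Ax i' i'j; rewrite (idx_inj k i' i)// i'j.
have C0 j k : (forall i, idx i k <> j) -> C j k = setT.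
  by move=> nj; apply/seteqP; split => // x _ i /nj.
have mC j k : measurable (C j k).
  have [[i ij]|nj] := pselect (exists i, idx i k = j).
    by rewrite (CE _ _ i).
  by rewrite C0// => i ij; apply: nj; exists i.
have muC j k : mu_ k (C j k) = (\prod_(i | idx i k == j) mu_ k (A i k))%E.
  have [[i ij]|nj] := pselect (exists i, idx i k = j).
    rewrite (CE _ _ i)// (big_pred1 i)// => i' /=.
    by rewrite -ij; apply/eqP/eqP => [/idx_inj|->].
  rewrite C0; last by move=> i ij; apply: nj; exists i.
  rewrite probability_setT big_pred0// => i; apply/eqP => ij.
  by apply: nj; exists i.
have -> : entries idx @^-1` cells A =
    \bigcap_(j in [set` iota 0 L]) X j @^-1` box (C j).
  apply/seteqP; split => omega /=.
    by move=> h j _ k i ij; have := h i k; rewrite /entries ij.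
  move=> h i k; rewrite /entries; apply: (h (idx i k)) => //=.
  by rewrite mem_iota add0n ltL.
case: iidX => indep lawX; transitivity (\prod_(j <- iota 0 L) P (X j @^-1` box (C j)))%E.
  apply: (indep (iota 0 L) (fun j => box (C j)) (iota_uniq 0 L)) => j.
  exact: measurable_box.
have -> : iota 0 L = index_iota 0 L by rewrite /index_iota subn0.
rewrite big_mkord.
transitivity (\prod_(j < L) \prod_k \prod_(i | idx i k == j) mu_ k (A i k))%E.
  apply: eq_bigr => j _; have := lawX j _ (measurable_box (mC j)).
  rewrite /distribution /pushforward => ->.
  rewrite /mu prod_probE//; apply: eq_bigr => k _; exact: muC.
rewrite exchange_big [RHS]exchange_big; apply: eq_bigr => k _ /=.
rewrite (exchange_big_dep predT)//=; apply: eq_bigr => i _.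
by rewrite (big_pred1 (Ordinal (ltL i k))).
Qed.

End arrays.

(** * Averages of identically distributed, mostly independent points *)

Section finite_averages.
Context (R : realType) (dT dO : measure_display) (T : measurableType dT).
Context (Omega : measurableType dO).
Variables (mu : probability T R) (P : probability Omega R) (I : finType).

(** Expanding the square, only the bad pairs contribute, and each contributes at
    most c by Cauchy-Schwarz. *)
Lemma sqr_sum_le (Y : I -> Omega -> R) (bad : rel I) (c : R) :
  (forall i, measurable_fun setT (Y i)) ->
  (forall i, rintegrable P (fun omega => Y i omega ^+ 2)) ->
  (forall i, \int[P]_omega (Y i omega ^+ 2) <= c) ->
  (forall i j, ~~ bad i j -> \int[P]_omega (Y i omega * Y j omega) = 0) ->
  \int[P]_omega ((\sum_i Y i omega) ^+ 2) <=
    #|[pred p : I * I | bad p.1 p.2]|%:R * c.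
Proof.
move=> mY Y2 Yc Ybad.
have YY i j : rintegrable P (fun omega => Y i omega * Y j omega).
  exact: riM_sqr.
have -> : \int[P]_omega ((\sum_i Y i omega) ^+ 2) =
    \sum_(p : I * I) \int[P]_omega (Y p.1 omega * Y p.2 omega).
  rewrite -Rint_sum//; apply: eq_Rintegral => omega _.
  by rewrite expr2 big_distrlr/= pair_big.
rewrite (bigID (fun p => bad p.1 p.2))/= [X in _ + X]big1 ?addr0; last first.
  by move=> p /Ybad.
apply: (@le_trans _ _ (\sum_(p : I * I | bad p.1 p.2) c)).
  apply: ler_sum => p _.
  have h : \int[P]_omega (Y p.1 omega * Y p.2 omega) <=
      \int[P]_omega (2^-1 * Y p.1 omega ^+ 2 + 2^-1 * Y p.2 omega ^+ 2).
    apply: ler_Rint => //; first by apply: riD; exact: riZ.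
    move=> omega; have := sqr_ge0 (Y p.1 omega - Y p.2 omega); lra.
  apply: (le_trans h); rewrite RintD; [|exact: riZ|exact: riZ].
  by rewrite !RintZ//; have := Yc p.1; have := Yc p.2; lra.
by rewrite sumr_const mulr_natl.
Qed.

Implicit Types f : T -> R.
Variables (Z : I -> Omega -> T) (bad : rel I).
Hypothesis lawZ : forall i, has_law P (Z i) mu.

Definition average (f : T -> R) (omega : Omega) : R :=
  #|I|%:R^-1 * \sum_i f (Z i omega).

Lemma ri_comp i f : rintegrable mu f -> rintegrable P (fun omega => f (Z i omega)).
Proof. by move=> fi; apply/(law_ri (lawZ i)) => //; exact: ri_measurable fi. Qed.

Lemma ri_average f : rintegrable mu f -> rintegrable P (average f).
Proof. by move=> fi; apply/riZ/ri_sum => i; exact: ri_comp. Qed.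

Lemma averageB f g omega :
  average (fun x => f x - g x) omega = average f omega - average g omega.
Proof. by rewrite /average sumrB mulrBr. Qed.

Lemma average_cst (c : R) omega : (0 < #|I|)%N -> average (fun=> c) omega = c.
Proof.
move=> I0; rewrite /average sumr_const -[X in _ * X]mulr_natr mulrCA mulVf ?mulr1//.
by rewrite pnatr_eq0 -lt0n.
Qed.

(** An average is a contraction from L1(mu) to L1(P): this is how the part of f
    beyond the cutoff is controlled without second moments. *)
Lemma average_contraction f : rintegrable mu f ->
  \int[P]_omega `|average f omega| <= \int[mu]_x `|f x|.
Proof.
move=> fi; have fa := ri_abs fi.
have mfa := ri_measurable fa.
apply: (@le_trans _ _ (\int[P]_omega average (fun x => `|f x|) omega)).
  apply: ler_Rint; [exact/ri_abs/ri_average|exact: ri_average|].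
  move=> omega; rewrite /average normrM ger0_norm// ler_wpM2l//.
  exact: ler_norm_sum.
rewrite RintZ; last by apply: ri_sum => i; exact: (ri_comp i fa).
rewrite Rint_sum; last by move=> i; exact: (ri_comp i fa).
under eq_bigr => i _ do rewrite (law_Rint (lawZ i) mfa).
rewrite sumr_const -[X in _ * X]mulr_natr mulrCA.
have [->|I0] := eqVneq #|I| 0%N; first by rewrite invr0 mul0r mulr0 Rintegral_ge0.
by rewrite mulVf ?mulr1// pnatr_eq0.
Qed.

(** The frequency of pairs of indices whose points may be dependent. *)
Definition bad_ratio : R := #|[pred p : I * I | bad p.1 p.2]|%:R / #|I|%:R ^+ 2.

Lemma bad_ratio_ge0 : 0 <= bad_ratio.
Proof. by rewrite divr_ge0// sqr_ge0. Qed.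

Lemma ri_average_sqr f : measurable_fun setT f ->
  rintegrable mu (fun x => f x ^+ 2) ->
  rintegrable P (fun omega => average f omega ^+ 2).
Proof.
move=> mf f2.
have Z2 i : rintegrable P (fun omega => f (Z i omega) ^+ 2).
  exact: (ri_comp i f2).
have mZ i : measurable_fun setT (fun omega => f (Z i omega)).
  exact: (measurableT_comp mf (lawZ i).1).
apply: ri_sqrZ.
elim: (index_enum I) => [|i s IH].
  rewrite (_ : (fun _ => _) = fun=> 0); first exact: ri_cst.
  by apply/funext => omega; rewrite big_nil expr0n.
rewrite (_ : (fun _ => _) = fun omega =>
    (f (Z i omega) + \sum_(j <- s) f (Z j omega)) ^+ 2); last first.
  by apply/funext => omega; rewrite big_cons.
apply: ri_sqrD => //; exact: measurable_sum.
Qed.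

Lemma average_sqr_le f : measurable_fun setT f ->
  rintegrable mu (fun x => f x ^+ 2) ->
  (forall i j, ~~ bad i j ->
    \int[P]_omega (f (Z i omega) * f (Z j omega)) = 0) ->
  \int[P]_omega (average f omega ^+ 2) <= bad_ratio * \int[mu]_x (f x ^+ 2).
Proof.
move=> mf f2 fbad.
have mfX : measurable_fun setT (fun x => f x ^+ 2) by exact: measurable_funX.
have Zc i : \int[P]_omega (f (Z i omega) ^+ 2) <= \int[mu]_x (f x ^+ 2).
  by rewrite (law_Rint (lawZ i) mfX).
have := @sqr_sum_le (fun i omega => f (Z i omega)) bad (\int[mu]_x (f x ^+ 2)).
move=> /(_ (fun i => measurableT_comp mf (lawZ i).1)).
move=> /(_ (fun i => ri_comp i f2)).
move=> /(_ (fun i => Zc i)).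
move=> /(_ fbad) h.
have E : \int[P]_omega (average f omega ^+ 2) =
    (#|I|%:R ^+ 2)^-1 * \int[P]_omega ((\sum_i f (Z i omega)) ^+ 2).
  have [I0|I0] := eqVneq #|I| 0%N.
    rewrite I0 expr0n invr0 mul0r -[RHS](Rint_cst P 0).
    by apply: eq_Rintegral => omega _; rewrite /average I0 invr0 mul0r expr0n.
  have I1 : #|I|%:R != 0 :> R by rewrite pnatr_eq0.
  rewrite -RintZ; last first.
    have := riZ (#|I|%:R ^+ 2) (ri_average_sqr mf f2); congr rintegrable.
    by apply/funext => omega; rewrite /average exprMn mulrA -exprMn divff// expr1n mul1r.
  by apply: eq_Rintegral => omega _; rewrite /average exprMn exprVn.
rewrite E /bad_ratio mulrAC mulrC ler_wpM2r// invr_ge0 sqr_ge0 //.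
Qed.

Hypothesis lawZ2 : forall i j, ~~ bad i j ->
  has_law P (fun omega => (Z i omega, Z j omega)) (mu \x mu)%E.

Lemma uncorrelated f : measurable_fun setT f ->
  rintegrable mu (fun x => f x ^+ 2) -> \int[mu]_x f x = 0 ->
  forall i j, ~~ bad i j ->
  \int[P]_omega (f (Z i omega) * f (Z j omega)) = 0.
Proof.
move=> mf f2 f0 i j ij.
have mf1 : measurable_fun setT (fun p : T * T => f p.1).
  exact: (measurableT_comp mf measurable_fst).
have mf2 : measurable_fun setT (fun p : T * T => f p.2).
  exact: (measurableT_comp mf measurable_snd).
rewrite (law_Rint (lawZ2 ij) (measurable_funM mf1 mf2)).
rewrite -Rint_fubini /=; last first.
  apply: riM_sqr => //.
    by apply/(law_ri (law_fst mu mu) (f := fun x => f x ^+ 2)) => //;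
      exact: measurable_funX.
  by apply/(law_ri (law_snd mu mu) (f := fun x => f x ^+ 2)) => //;
    exact: measurable_funX.
rewrite -[RHS](Rint_cst mu 0); apply: eq_Rintegral => x _.
by rewrite RintZ ?f0 ?mulr0//; exact: ri_of_sqr.
Qed.

Definition cutoff (c : R) (f : T -> R) x := if `|f x| <= c then f x else 0.

Lemma measurable_cutoff c f : measurable_fun setT f ->
  measurable_fun setT (cutoff c f).
Proof.
move=> mf; apply: measurable_fun_ifT => //.
by apply: measurable_fun_ler => //; exact: measurableT_comp.
Qed.

Lemma cutoff_bound c f x : 0 <= c -> `|cutoff c f x| <= c.
Proof. by move=> c0; rewrite /cutoff; case: ifP => // _; rewrite normr0. Qed.

(** Split f into its cutoff g and the rest.  The rest costs its L1-norm twice,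
    once in the average and once in the mean.  The centred function h = g - m has
    variance at most c^2, and |y| <= eps + y^2 / eps applied to
    its average turns the second-moment bound into a bound in L1. *)
Lemma average_L1_deviation f (c eps : R) : (0 < #|I|)%N -> rintegrable mu f ->
  0 <= c -> 0 < eps ->
  \int[P]_omega `|average f omega - \int[mu]_x f x| <=
  2 * \int[mu]_x `|f x - cutoff c f x| + eps + bad_ratio * c ^+ 2 / eps.
Proof.
move=> I0 fi c0 e0; set g := cutoff c f.
have mf := ri_measurable fi.
have mg : measurable_fun setT g by exact: measurable_cutoff.
have gi : rintegrable mu g by apply: (@ri_bounded _ _ _ mu c g mg) => x; exact: cutoff_bound.
have gsqr x : `|g x ^+ 2| <= c ^+ 2.
  by rewrite ger0_norm ?sqr_ge0// -real_normK ?num_real// lerXn2r ?nnegrE//;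
    exact: cutoff_bound.
have g2 : rintegrable mu (fun x => g x ^+ 2).
  by apply: ri_bounded gsqr; exact: measurable_funX.
set m := \int[mu]_x g x; pose h x := g x - m.
have mh : measurable_fun setT h by exact: measurable_funB.
have h2 : rintegrable mu (fun x => h x ^+ 2).
  by apply: ri_sqrB => //; exact: ri_cst.
have h0 : \int[mu]_x h x = 0 by rewrite RintB ?Rint_cst ?subrr//; exact: ri_cst.
have h2c : \int[mu]_x (h x ^+ 2) <= c ^+ 2.
  rewrite Rint_centred_sqr//.
  rewrite lerBlDr (@le_trans _ _ (c ^+ 2)) ?lerDl ?sqr_ge0//.
  rewrite -[leRHS](Rint_cst mu); apply: ler_Rint => //; first exact: ri_cst.
  by move=> x; exact: le_trans (ler_norm _) (gsqr x).
have fgi : rintegrable mu (fun x => f x - g x) by exact: riB.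
have ah2 := ri_average_sqr mh h2.
pose B omega := `|average (fun x => f x - g x) omega| +
  (eps + eps^-1 * average h omega ^+ 2) + \int[mu]_x `|f x - g x|.
apply: (@le_trans _ _ (\int[P]_omega B omega)).
  apply: ler_Rint.
  - by apply/ri_abs/riB; [exact: ri_average|exact: ri_cst].
  - apply: riD; last exact: ri_cst.
    apply: riD; first exact/ri_abs/ri_average.
    by apply: riD; [exact: ri_cst|exact: riZ].
  move=> omega; rewrite /B.
  have -> : average f omega - \int[mu]_x f x =
      average (fun x => f x - g x) omega + average h omega
      - \int[mu]_x (f x - g x).
    by rewrite !averageB average_cst// RintB// -/m; ring.
  apply: (le_trans (ler_normB _ _)); apply: lerD; last exact: normr_Rint_le.
  apply: (le_trans (ler_normD _ _)); rewrite lerD2l.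
  have := normr_ge0 (average h omega); rewrite -[X in _ <= _ + _ * X]real_normK ?num_real//.
  move: `|average h omega| => y y0.
  have : 0 <= eps^-1 * (y - eps) ^+ 2 by rewrite mulr_ge0 ?sqr_ge0// invr_ge0 ltW.
  have -> : eps^-1 * (y - eps) ^+ 2 = eps^-1 * y ^+ 2 - 2 * y + eps.
    by field; rewrite gt_eqF.
  by lra.
rewrite /B RintD; last 2 first.
- apply: riD; first exact/ri_abs/ri_average.
  by apply: riD; [exact: ri_cst|exact: riZ].
- exact: ri_cst.
rewrite RintD; [|exact/ri_abs/ri_average|by apply: riD; [exact: ri_cst|exact: riZ]].
rewrite RintD; [|exact: ri_cst|exact: riZ].
rewrite RintZ// !Rint_cst.
have := average_contraction fgi.
have : eps^-1 * \int[P]_omega (average h omega ^+ 2) <= bad_ratio * c ^+ 2 / eps.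
  rewrite mulrC ler_pM2r ?invr_gt0//; apply: le_trans (average_sqr_le mh h2 (uncorrelated mh h2 h0)) _.
  by rewrite ler_wpM2l// bad_ratio_ge0.
by lra.
Qed.

Lemma cutoff_L1 f : rintegrable mu f ->
  (fun c : nat => \int[mu]_x `|f x - cutoff c%:R f x|) @ \oo --> 0.
Proof.
move=> fi; have mf := ri_measurable fi.
rewrite -[X in _ --> X](Rint_cst mu 0).
apply: (@Rint_dct _ _ _ mu _ _ (fun x => `|f x|)).
- move=> c; apply: measurableT_comp => //; apply: measurable_funB => //.
  exact: measurable_cutoff.
- exact: ri_abs.
- move=> c x; rewrite normr_id /cutoff; case: ifP => _; last by rewrite subr0.
  by rewrite subrr normr0.
move=> x; apply: cvg_near_cst; near=> c.
rewrite /cutoff ifT ?subrr ?normr0//.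
by near: c; exact: nbhs_infty_ger.
Unshelve. all: by end_near. Qed.

End finite_averages.

(** * Counting pairs of index vectors with common coordinates *)

Section agreement_count.
Variables K N : nat.
Local Open Scope nat_scope.

(** Pairs of functions are functions into pairs, and being equal at the
    coordinates in A is a product condition: there, N of the N^2 pairs remain. *)
Lemma card_agree (A : pred 'I_K) :
  #|[pred p : {ffun 'I_K -> 'I_N} * {ffun 'I_K -> 'I_N} |
     [forall k, A k ==> (p.1 k == p.2 k)]]| * N ^ #|A| <= (N ^ K) ^ 2.
Proof.
pose F k : pred ('I_N * 'I_N) := fun q => A k ==> (q.1 == q.2).
pose zipf (p : {ffun 'I_K -> 'I_N} * {ffun 'I_K -> 'I_N}) :
  {ffun 'I_K -> 'I_N * 'I_N} := [ffun k => (p.1 k, p.2 k)].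
have zipf_inj : injective zipf.
  move=> [a b] [a' b'] /ffunP h.
  by congr (_, _); apply/ffunP => k; have := h k; rewrite !ffunE => -[].
rewrite -(fintype.card_image zipf_inj).
have cF k : #|F k| * N ^ A k = N ^ 2.
  rewrite /F; case: (A k) => /=; last first.
    rewrite muln1 (eq_card (B := predT)) => [|p]; last by rewrite inE.
    by rewrite card_prod card_ord -mulnn.
  rewrite expn1 -mulnn; congr (_ * _).
  rewrite -[RHS](card_ord N).
  have dinj : injective (fun i : 'I_N => (i, i)) by move=> i j [].
  rewrite -(fintype.card_image dinj); apply: eq_card => -[i j].
  apply/idP/fintype.imageP => [/eqP/= ->|[l _ [-> ->]]]; last exact/eqP.
  by exists j.
apply: (@leq_trans (#|family F| * N ^ #|A|)).
  rewrite leq_mul2r; apply/orP; right; apply/subset_leq_card/fintype.subsetP => q.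
  move=> /fintype.imageP[p /forallP pA ->]; apply/familyP => k.
  by rewrite ffunE; exact: pA.
rewrite card_family.
have -> : foldr muln 1 [seq #|F x| | x : 'I_K] = \prod_(k < K) #|F k|.
  by rewrite foldrE big_image.
have -> : N ^ #|A| = \prod_(k < K) N ^ A k.
  rewrite -expn_sum; congr (_ ^ _); rewrite -sum1_card big_mkcond /=.
  by apply: eq_bigr => k _; rewrite unfold_in; case: (A k).
rewrite -big_split/= (eq_bigr (fun=> N ^ 2))//.
by rewrite prod_nat_const card_ord -!expnM mulnC.
Qed.
End agreement_count.

Lemma card_exists_le (J T : finType) (Q : J -> pred T) :
  (#|[pred p | [exists j, Q j p]]| <= \sum_j #|Q j|)%N.
Proof.
rewrite -sum1_card big_mkcond /=.
under [leqRHS]eq_bigr => j _ do rewrite -sum1_card big_mkcond /=.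
rewrite exchange_big /=; apply: leq_sum => p _.
rewrite inE; case: existsP => [[j Qj]|//].
by rewrite (bigD1 j)//= unfold_in Qj.
Qed.

Section bad_pairs.
Context (R : realType) (K N : nat).
Hypothesis N0 : (0 < N)%N.
Let I : finType := {ffun 'I_K -> 'I_N}.
Local Open Scope ring_scope.

(** Index vectors without a common coordinate give independent recombinations. *)
Definition share : rel I := fun a b => [exists k, a k == b k].

(** The pairs for which the residuals of the projection may be correlated. *)
Definition share2 : rel I := fun a b =>
  [exists kl : 'I_K * 'I_K,
    [&& kl.1 != kl.2, a kl.1 == b kl.1 & a kl.2 == b kl.2]].

Let cardI : #|I|%:R = (N ^ K)%:R :> R.
Proof. by rewrite card_ffun !card_ord. Qed.

(** Each prescribed agreement divides the frequency by N. *)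
Lemma bad_ratio_agree (A : pred 'I_K) (m : nat) (Q : pred (I * I)) :
  #|A| = m -> (forall p, Q p -> forall k, A k -> p.1 k == p.2 k) ->
  #|Q|%:R / #|I|%:R ^+ 2 <= (N%:R ^+ m)^-1 :> R.
Proof.
move=> Am QA; rewrite cardI -(natrX _ (N ^ K) 2).
have NK : 0 < ((N ^ K) ^ 2)%:R :> R by rewrite ltr0n !expn_gt0 N0.
have Nm : 0 < N%:R ^+ m :> R by rewrite exprn_gt0// ltr0n.
rewrite ler_pdivrMr// ler_pdivlMl// -natrX mulrC -natrM ler_nat.
rewrite -Am; apply: leq_trans (card_agree N A); rewrite leq_mul2r.
apply/orP; right; apply/subset_leq_card/fintype.subsetP => p Qp.
by rewrite inE; apply/forallP => k; apply/implyP; exact: QA.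
Qed.

Lemma share_ratio : bad_ratio R share <= K%:R / N%:R.
Proof.
rewrite /bad_ratio.
apply: (@le_trans _ _ (\sum_(k < K) N%:R^-1)); last first.
  by rewrite sumr_const card_ord mulr_natl.
apply: (@le_trans _ _ (\sum_(k < K)
    #|[pred p : I * I | p.1 k == p.2 k]|%:R / #|I|%:R ^+ 2)).
  rewrite -mulr_suml ler_wpM2r ?invr_ge0 ?sqr_ge0// -natr_sum ler_nat.
  exact: (card_exists_le (fun k (p : I * I) => p.1 k == p.2 k)).
apply: ler_sum => k _; rewrite -[N%:R]expr1.
by apply: (@bad_ratio_agree (pred1 k)); [exact: card1|move=> p Qp _ /eqP ->].
Qed.

Lemma share2_ratio : bad_ratio R share2 <= K%:R ^+ 2 / N%:R ^+ 2.
Proof.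
rewrite /bad_ratio.
apply: (@le_trans _ _ (\sum_(kl : 'I_K * 'I_K) (N%:R ^+ 2)^-1)); last first.
  by rewrite sumr_const card_prod card_ord -(natrX _ K 2) mulr_natl mulnn.
pose Q (kl : 'I_K * 'I_K) (p : I * I) := [&& kl.1 != kl.2,
  p.1 kl.1 == p.2 kl.1 & p.1 kl.2 == p.2 kl.2].
apply: (@le_trans _ _ (\sum_(kl : 'I_K * 'I_K) #|Q kl|%:R / #|I|%:R ^+ 2)).
  rewrite -mulr_suml ler_wpM2r ?invr_ge0 ?sqr_ge0// -natr_sum ler_nat.
  exact: (card_exists_le Q).
apply: ler_sum => -[k l] _; have [->|kl] := eqVneq k l.
  rewrite (eq_card0 (A := Q (l, l))) ?mul0r ?invr_ge0 ?exprn_ge0//.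
  by move=> p; rewrite unfold_in /Q /= eqxx.
apply: (@bad_ratio_agree (pred2 k l)); first by rewrite card2 kl.
by move=> p /and3P[_ /= pk pl] j /orP[]/eqP ->.
Qed.

Lemma diagonal_ratio : bad_ratio R (@eq_op 'I_N) = 1 / N%:R.
Proof.
rewrite /bad_ratio card_ord.
have -> : #|[pred p : 'I_N * 'I_N | p.1 == p.2]| = N.
  have dinj : injective (fun i : 'I_N => (i, i)) by move=> i j [].
  rewrite -[RHS](card_ord N) -(fintype.card_image dinj); apply: eq_card => -[i j].
  apply/idP/fintype.imageP => [/eqP/= ->|[l _ [-> ->]]]; last exact/eqP.
  by exists j.
by rewrite expr2 invfM mulrA mulfV ?mul1r// pnatr_eq0 -lt0n.
Qed.

End bad_pairs.

(** The bound of [average_L1_deviation] forces convergence to 0: the cutoff level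
    c is chosen first, so that tau c is small, and then N. *)
Lemma cvg0_deviation (R : realType) (D r : nat -> R) (tau : nat -> R) :
  (forall N, 0 <= D N) -> tau @ \oo --> 0 -> r @ \oo --> 0 ->
  (forall N c eps, (0 < N)%N -> 0 < eps ->
    D N <= 2 * tau c + eps + r N * c%:R ^+ 2 / eps) ->
  D @ \oo --> 0.
Proof.
move=> D0 tau0 r0 Dle; apply/cvgrPdist_le => e e0.
have e8 : 0 < e / 8 by lra.
have [c _ /(_ c (leqnn c))] : \forall c \near \oo, `|0 - tau c| <= e / 8.
  by have /cvgrPdist_le/(_ _ e8) := tau0.
rewrite /= sub0r normrN => tc.
have rc0 : (fun N => r N * c%:R ^+ 2 / (e / 8)) @ \oo --> 0.
  rewrite -[X in _ --> X](mul0r (c%:R ^+ 2 / (e / 8))).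
  under eq_fun do rewrite -mulrA.
  exact: cvgMr_tmp.
near=> N; rewrite sub0r normrN ger0_norm//.
have rN : `|0 - r N * c%:R ^+ 2 / (e / 8)| <= e / 8.
  by near: N; have /cvgrPdist_le/(_ _ e8) := rc0.
apply: (le_trans (Dle N c (e / 8) _ e8)); first by near: N; exists 1%N.
move: rN; rewrite sub0r normrN => /(le_trans (ler_norm _)) rN.
have := le_trans (ler_norm _) tc; lra.
Unshelve. all: by end_near. Qed.

(** * Laws of large numbers in L1 *)

Section cross_averages.
Context (R : realType) (K : nat) (d : 'I_K -> measure_display).
Context (S : forall k, measurableType (d k)).
Variable mu_ : forall k, probability (S k) R.
Let mu := prod_prob mu_.
Context (dO : measure_display) (Omega : measurableType dO).
Variables (P : probability Omega R) (X : nat -> {RV P >-> prodT S}).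
Hypothesis iidX : iid mu X.
Implicit Types (f : prodT S -> R) (N : nat).

(** The recombination X^a: its k-th coordinate comes from the sample numbered
    a k. *)
Definition mixed (a : 'I_K -> nat) (omega : Omega) : prodT S :=
  fun k => X (a k) omega k.

Lemma law_mixed a : has_law P (mixed a) mu.
Proof.
apply: (law_comp (@law_entries _ _ _ _ mu_ _ _ P X iidX 1 (fun _ => a) _)
  (law_array_row mu_ ord0)) => k i j _.
by rewrite !ord1.
Qed.

Lemma law_mixed2 a b : (forall k, a k != b k) ->
  has_law P (fun omega => (mixed a omega, mixed b omega)) (mu \x mu)%E.
Proof.
move=> ab; pose idx (i : 'I_2) := if i == ord0 then a else b.
apply: (law_comp (@law_entries _ _ _ _ mu_ _ _ P X iidX 2 idx _)
  (law_array_pair mu_)) => k i j.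
rewrite /idx; case: (unliftP ord0 i) => [i' ->|->];
  case: (unliftP ord0 j) => [j' ->|->] //=; rewrite ?ord1//.
- by move=> e; have := ab k; rewrite e eqxx.
- by move=> e; have := ab k; rewrite e eqxx.
Qed.

Lemma law_single n : has_law P (X n) mu.
Proof. by split => [//|A mA]; exact: iidX.2. Qed.

Lemma law_single2 i j : i != j ->
  has_law P (fun omega => (X i omega, X j omega)) (mu \x mu)%E.
Proof. by move=> ij; exact: (@law_mixed2 (fun=> i) (fun=> j)). Qed.

Let Zc N (n : {ffun 'I_K -> 'I_N}) := mixed (fun k => n k).

Lemma emp_mean_crossE N f omega :
  emp_mean_cross N f (X^~ omega) = average (@Zc N) f omega.
Proof. by rewrite /emp_mean_cross /average card_ffun !card_ord. Qed.

Lemma emp_meanE N f omega :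
  emp_mean N f (X^~ omega) = average (fun i : 'I_N => X i) f omega.
Proof. by rewrite /emp_mean /average card_ord. Qed.

Lemma law_Zc N (n : {ffun 'I_K -> 'I_N}) : has_law P (Zc n) mu.
Proof. exact: law_mixed. Qed.

Lemma law_Zc2 N (n n' : {ffun 'I_K -> 'I_N}) : ~~ share n n' ->
  has_law P (fun omega => (Zc n omega, Zc n' omega)) (mu \x mu)%E.
Proof.
move=> /existsPn nn'; apply: law_mixed2 => k; exact: nn'.
Qed.

Let Kcard N : (0 < N)%N -> (0 < #|{ffun 'I_K -> 'I_N}|)%N.
Proof. by move=> N0; rewrite card_ffun !card_ord expn_gt0 N0. Qed.

Let invN_cvg (c : R) : (fun N : nat => c / N%:R) @ \oo --> 0.
Proof.
have := cvgMl_tmp (a := c) (@cvg_harmonic R).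
rewrite mulr0 => h; rewrite -cvg_shiftS; exact: h.
Qed.

Lemma cross_L1_lln f : rintegrable mu f ->
  (fun N => \int[P]_omega `|emp_mean_cross N f (X^~ omega) - \int[mu]_x f x|)
    @ \oo --> 0.
Proof.
move=> fi; apply: (cvg0_deviation (r := fun N => K%:R / N%:R) _ (cutoff_L1 fi)).
- by move=> N; exact: Rintegral_ge0.
- exact: invN_cvg.
move=> N c eps N0 e0.
under eq_Rintegral do rewrite emp_mean_crossE.
apply: (le_trans (average_L1_deviation (@law_Zc N) (@law_Zc2 N) (Kcard N0) fi
  (ler0n _ c) e0)).
by rewrite lerD2l ler_pM2r ?invr_gt0// ler_wpM2r ?sqr_ge0 ?share_ratio.
Qed.

Lemma std_L1_lln f : rintegrable mu f ->
  (fun N => \int[P]_omega `|emp_mean N f (X^~ omega) - \int[mu]_x f x|)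
    @ \oo --> 0.
Proof.
move=> fi; apply: (cvg0_deviation (r := fun N => 1 / N%:R) _ (cutoff_L1 fi)).
- by move=> N; exact: Rintegral_ge0.
- exact: invN_cvg.
move=> N c eps N0 e0.
under eq_Rintegral do rewrite emp_meanE.
have N1 : (0 < #|'I_N|)%N by rewrite card_ord.
have law2 (i j : 'I_N) : ~~ (i == j) ->
    has_law P (fun omega => (X i omega, X j omega)) (mu \x mu)%E.
  by move=> ij; exact: law_single2.
apply: (le_trans (average_L1_deviation (fun i : 'I_N => law_single i) law2 N1 fi
  (ler0n _ c) e0)).
by rewrite lerD2l ler_pM2r ?invr_gt0// ler_wpM2r ?sqr_ge0// diagonal_ratio.
Qed.

(** The order 1/N is that of the scaling: N E[U_N(f)^2] stays bounded. *)
Lemma cross_sqr_le N f : (0 < N)%N -> measurable_fun setT f ->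
  rintegrable mu (fun x => f x ^+ 2) -> \int[mu]_x f x = 0 ->
  \int[P]_omega (emp_mean_cross N f (X^~ omega) ^+ 2) <=
    K%:R / N%:R * \int[mu]_x (f x ^+ 2).
Proof.
move=> N0 mf f2 f0.
under eq_Rintegral do rewrite emp_mean_crossE.
apply: (le_trans (average_sqr_le (@law_Zc N) mf f2
  (uncorrelated (@law_Zc2 N) mf f2 f0))).
by rewrite ler_wpM2r ?share_ratio// Rintegral_ge0// => x _; exact: sqr_ge0.
Qed.

Lemma std_sqr_le N f : (0 < N)%N -> measurable_fun setT f ->
  rintegrable mu (fun x => f x ^+ 2) -> \int[mu]_x f x = 0 ->
  \int[P]_omega (emp_mean N f (X^~ omega) ^+ 2) <=
    1 / N%:R * \int[mu]_x (f x ^+ 2).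
Proof.
move=> N0 mf f2 f0.
under eq_Rintegral do rewrite emp_meanE.
have law2 (i j : 'I_N) : ~~ (i == j) ->
    has_law P (fun omega => (X i omega, X j omega)) (mu \x mu)%E.
  by move=> ij; exact: law_single2.
rewrite -(diagonal_ratio R N0).
exact: (average_sqr_le (fun i : 'I_N => law_single i) mf f2
  (uncorrelated law2 mf f2 f0)).
Qed.

End cross_averages.

(** * A maximal inequality for product-form averages *)

Section maximal_inequality.
Context (R : realType) (K : nat) (d : 'I_K -> measure_display).
Context (S : forall k, measurableType (d k)).
Variable mu_ : forall k, probability (S k) R.
Let mu := prod_prob mu_.
Context (dO : measure_display) (Omega : measurableType dO).
Variables (P : probability Omega R) (X : nat -> {RV P >-> prodT S}).
Hypothesis iidX : iid mu X.
Implicit Types (a : 'I_K -> nat) (x : nat -> prodT S).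

(** The transposition of 0 and j. *)
Definition swap0 (j i : nat) : nat :=
  if i == 0%N then j else if i == j then 0%N else i.

Lemma swap0K j : involutive (swap0 j).
Proof.
move=> i; rewrite /swap0; case: (eqVneq i 0%N) => [->|i0].
  by case: (eqVneq j 0%N) => // _; rewrite eqxx.
case: (eqVneq i j) => [->|ij]; first by rewrite eqxx.
by rewrite (negbTE i0) (negbTE ij).
Qed.

Lemma swap0_lt j i N : (j < N)%N -> (i < N)%N -> (swap0 j i < N)%N.
Proof.
by move=> jN iN; rewrite /swap0; do 2 case: ifP => // _; apply: leq_ltn_trans jN.
Qed.

(** The k-th coordinates of the samples numbered 0 and a k are exchanged, for
    each k separately; the first sample becomes the recombination X^a. *)
Definition reorder a x : nat -> prodT S := fun i k => x (swap0 (a k) i) k.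

Lemma emp_mean_cross_reorder N f a x : (forall k, (a k < N)%N) ->
  emp_mean_cross N f (reorder a x) = emp_mean_cross N f x :> R.
Proof.
move=> aN; rewrite /emp_mean_cross; congr (_ * _).
pose h (n : {ffun 'I_K -> 'I_N}) : {ffun 'I_K -> 'I_N} :=
  [ffun k => Ordinal (swap0_lt (aN k) (ltn_ord (n k)))].
have hK : involutive h.
  by move=> n; apply/ffunP => k; rewrite !ffunE; apply/val_inj; rewrite /= swap0K.
rewrite [RHS](reindex_inj (inv_inj hK)); apply: eq_bigr => n _; congr (f _).
by apply: functional_extensionality_dep => k; rewrite ffunE.
Qed.

Lemma emp_mean_cross_local N f x x' : (forall i, (i < N)%N -> x i = x' i) ->
  emp_mean_cross N f x = emp_mean_cross N f x' :> R.
Proof.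
move=> xx'; rewrite /emp_mean_cross; congr (_ * _); apply: eq_bigr => n _.
by congr (f _); apply: functional_extensionality_dep => k; rewrite xx'.
Qed.

Definition array_seq M (y : array S M.+1) : nat -> prodT S := fun i => y (inord i).

Lemma measurable_emp_mean_cross_array N M f : measurable_fun setT f ->
  measurable_fun setT (fun y : array S M.+1 => emp_mean_cross N f (array_seq y) : R).
Proof.
move=> mf; apply: measurable_funM => //; apply: measurable_sum => n.
apply: (measurableT_comp mf); apply: measurable_prodT => k.
have my : measurable_fun setT (fun y : array S M.+1 => y (inord (n k))).
  exact: (@measurable_coord _ _ (fun=> prodT S)).
exact: (measurableT_comp (@measurable_coord _ _ S k) my).
Qed.

Lemma measurable_emp_mean_cross N f : measurable_fun setT f ->
  measurable_fun setT (fun omega => emp_mean_cross N f (X^~ omega) : R).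
Proof.
move=> mf; apply: measurable_funM => //; apply: measurable_sum => n.
apply: (measurableT_comp mf); apply: measurable_prodT => k.
exact: (measurableT_comp (@measurable_coord _ _ S k)).
Qed.

(** The test functions against which the averages form a reverse martingale.  They
    involve finitely many samples, so that the law of a finite array suffices. *)
Definition exchangeable N M (g : (nat -> prodT S) -> R) :=
  [/\ measurable_fun setT (fun y : array S M.+1 => g (array_seq y)),
      forall x x', (forall i, (i <= M)%N -> x i = x' i) -> g x = g x' &
      forall a x, (forall k, (a k < N)%N) -> g (reorder a x) = g x].

(** Reordering preserves the joint law of the entries, leaves g alone, and moves
    the recombination X^a to the first sample. *)
Lemma exchangeable_swap N M g (f : prodT S -> R) a : (N <= M.+1)%N ->
  measurable_fun setT f -> exchangeable N M g -> (forall k, (a k < N)%N) ->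
  \int[P]_omega (f (mixed X a omega) * g (X^~ omega)) =
  \int[P]_omega (f (X 0 omega) * g (X^~ omega)).
Proof.
move=> NM mf [mg locg invg] aN.
pose F (y : array S M.+1) := f (y ord0) * g (array_seq y).
have mF : measurable_fun setT F.
  apply: measurable_funM => //; apply: (measurableT_comp mf).
  exact: (@measurable_coord _ _ (fun=> prodT S)).
pose id_ (i : 'I_M.+1) (k : 'I_K) : nat := i.
pose sw (i : 'I_M.+1) (k : 'I_K) := swap0 (a k) i.
have lawid := @law_entries _ _ _ _ mu_ _ _ P X iidX M.+1 id_
  (fun k i j e => val_inj e).
have lawsw := @law_entries _ _ _ _ mu_ _ _ P X iidX M.+1 sw
  (fun k i j e => val_inj (inv_inj (@swap0K (a k)) e)).
transitivity (\int[P]_omega F (entries X sw omega)).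
  apply: eq_Rintegral => omega _; rewrite /F; congr (f _ * _).
  rewrite -(invg a (X^~ omega))//; apply: locg => i iM.
  apply: functional_extensionality_dep => k.
  by rewrite /reorder /array_seq /entries /sw inordK.
rewrite (law_Rint lawsw mF) -(law_Rint lawid mF).
apply: eq_Rintegral => omega _; rewrite /F; congr (f _ * _).
apply: locg => i iM; apply: functional_extensionality_dep => k.
by rewrite /array_seq /entries /id_ inordK.
Qed.

(** The right-hand side does not depend on m, so that U_m and U_N have the same
    expectation against g for m <= N: this is the reverse martingale property. *)
Lemma emp_mean_cross_exchangeable m N M g (f : prodT S -> R) : (0 < m)%N -> (m <= N)%N ->
  (N <= M.+1)%N -> rintegrable mu f -> exchangeable N M g ->
  measurable_fun setT (fun omega => g (X^~ omega)) -> (forall x, `|g x| <= 1) ->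
  \int[P]_omega (emp_mean_cross m f (X^~ omega) * g (X^~ omega)) =
  \int[P]_omega (f (X 0 omega) * g (X^~ omega)).
Proof.
move=> m0 mN NM fi eg mg g1; have mf := ri_measurable fi.
have fig a : rintegrable P (fun omega => f (mixed X a omega) * g (X^~ omega)).
  apply: (@riM_bnd _ _ _ _ 1) => //.
  by apply/(law_ri (law_mixed iidX a)).
rewrite [RHS](_ : _ = (m ^ K)%:R^-1 * \sum_(n : {ffun 'I_K -> 'I_m})
    \int[P]_omega (f (mixed X (fun k => n k) omega) * g (X^~ omega))).
  rewrite -Rint_sum// -RintZ; last exact: ri_sum.
  by apply: eq_Rintegral => omega _; rewrite /emp_mean_cross -mulrA mulr_suml.
rewrite (eq_bigr (fun=> \int[P]_omega (f (X 0 omega) * g (X^~ omega)))).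
  rewrite sumr_const -[X in _ * X]mulr_natr mulrCA card_ffun !card_ord mulVf.
    by rewrite mulr1.
  by rewrite pnatr_eq0 -lt0n expn_gt0 m0.
move=> n _; apply: (exchangeable_swap NM) => // k.
exact: leq_trans (ltn_ord _) mN.
Qed.

(** Below, q N is the indicator of |U_N| <= lambda and Q m M that of
    |U_N| <= lambda for all N between m and M.  So (1 - q N) * Q N.+1 M is the indicator
    that N is the last index up to M with |U_N| > lambda; these events are
    disjoint, and g multiplies such an indicator by the sign of U_N. *)
Variable f : prodT S -> R.
Hypothesis fi : rintegrable mu f.
Let u N x := emp_mean_cross N f x.
Let U N omega := u N (X^~ omega).
Variable lambda : R.

Let q N x : R := if `|u N x| <= lambda then 1 else 0.
Let Q m M x : R := \prod_(m <= N < M.+1) q N x.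
Let g N M x : R :=
  (if 0 <= u N x then 1 else -1) * ((1 - q N x) * Q N.+1 M x).

Let q01 N x : 0 <= q N x <= 1.
Proof. by rewrite /q; case: ifP => _; rewrite ?ler01 lexx. Qed.

Let Q01 m M x : 0 <= Q m M x <= 1.
Proof.
rewrite prodr_ge0 => [|N _]; last by case/andP: (q01 N x).
by rewrite prodr_ile1.
Qed.

Let gap N M x : (1 - q N x) * Q N.+1 M x >= 0.
Proof.
by case/andP: (q01 N x) => _ q1; case/andP: (Q01 N.+1 M x) => Q0 _;
  rewrite mulr_ge0// subr_ge0.
Qed.

Let gap_telescope m M x : (m <= M.+1)%N ->
  \sum_(m <= N < M.+1) (1 - q N x) * Q N.+1 M x = 1 - Q m M x.
Proof.
move=> mM; have Q1 : 1 = Q M.+1 M x by rewrite /Q big_geq.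
rewrite [in RHS]Q1.
rewrite -(telescope_sumr (fun N => Q N M x) mM) !big_nat.
apply: eq_bigr => N /andP[_ NM]; have -> : Q N M x = q N x * Q N.+1 M x by rewrite /Q big_ltn.
by rewrite mulrBl mul1r.
Qed.

Let measurable_q d' (T : measurableType d') (h : T -> nat -> prodT S) N :
  measurable_fun setT (fun t => u N (h t)) ->
  measurable_fun setT (fun t => q N (h t)).
Proof.
move=> mh; apply: measurable_fun_ifT => //; apply: measurable_fun_ler => //.
exact: measurableT_comp.
Qed.

Let measurable_Q d' (T : measurableType d') (h : T -> nat -> prodT S) N M :
  (forall N, measurable_fun setT (fun t => u N (h t))) ->
  measurable_fun setT (fun t => Q N M (h t)).
Proof. by move=> mh; apply: measurable_prod => N' _; exact: measurable_q. Qed.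

Let measurable_g d' (T : measurableType d') (h : T -> nat -> prodT S) N M :
  (forall N, measurable_fun setT (fun t => u N (h t))) ->
  measurable_fun setT (fun t => g N M (h t)).
Proof.
move=> mh; apply: measurable_funM.
  by apply: measurable_fun_ifT => //; exact: measurable_fun_ler.
by apply: measurable_funM; [apply: measurable_funB => //; exact: measurable_q|
  exact: measurable_Q].
Qed.

Let g_ext N M x x' : (N <= M)%N ->
  (forall N', (N <= N' <= M)%N -> u N' x = u N' x') -> g N M x = g N M x'.
Proof.
move=> NM xx'; have qq N' : (N <= N' <= M)%N -> q N' x = q N' x'.
  by move=> NN'; rewrite /q xx'.
rewrite /g xx' ?leqnn// qq ?leqnn//; congr (_ * (_ * _)).
rewrite /Q !big_nat; apply: eq_bigr => N' /andP[NN' N'M]; apply: qq.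
by rewrite (ltnW NN').
Qed.

Let exchangeable_g N M : (N <= M)%N -> exchangeable N M (g N M).
Proof.
move=> NM; have mf := ri_measurable fi; split.
- by apply: measurable_g => N'; exact: measurable_emp_mean_cross_array.
- move=> x x' xx'; apply: g_ext => // N' /andP[NN' N'M].
  by apply: emp_mean_cross_local => i iN'; apply: xx'; exact: ltnW (leq_trans iN' N'M).
- move=> a x aN; apply: g_ext => // N' /andP[NN' N'M].
  by apply: emp_mean_cross_reorder => k; exact: leq_trans (aN k) NN'.
Qed.

Let mU N : measurable_fun setT (U N).
Proof. exact: measurable_emp_mean_cross (ri_measurable fi). Qed.

Let riU N : rintegrable P (U N).
Proof.
apply/riZ/ri_sum => n.
by apply/(law_ri (law_mixed iidX _)) => //; exact: ri_measurable fi.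
Qed.

Let riUbnd N (h : Omega -> R) : measurable_fun setT h -> (forall omega, `|h omega| <= 1) ->
  rintegrable P (fun omega => U N omega * h omega).
Proof. by move=> mh h1; exact: riM_bnd. Qed.

Let g_bnd N M x : `|g N M x| <= (1 - q N x) * Q N.+1 M x.
Proof.
by rewrite /g normrM [X in _ * X]ger0_norm//; case: ifP => _;
  rewrite ?normrN normr1 mul1r.
Qed.

Let gap_le1 N M x : (1 - q N x) * Q N.+1 M x <= 1.
Proof.
case/andP: (q01 N x) => q0 q1; case/andP: (Q01 N.+1 M x) => Q0 Q1.
by rewrite mulr_ile1// ?subr_ge0// lerBlDr lerDl.
Qed.

(** On the event that N is the last crossing, lambda is at most |U_N| = U_N times its
    sign.  The sign and the event only involve U_N, ..., U_M, so U_N may be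
    replaced by U_m, and the sum over the disjoint events is at most E|U_m|. *)
Lemma maximal_inequality m M : (0 < m)%N -> (m <= M.+1)%N ->
  lambda * \int[P]_omega (1 - Q m M (X^~ omega)) <= \int[P]_omega `|U m omega|.
Proof.
move=> m0 mM.
have mgap N : measurable_fun setT
    (fun omega => (1 - q N (X^~ omega)) * Q N.+1 M (X^~ omega)).
  apply: measurable_funM; last exact: (@measurable_Q _ _ (fun omega => X^~ omega)).
  apply: measurable_funB => //.
  exact (@measurable_q _ _ (fun omega => X^~ omega) N (mU N)).
have mg N : measurable_fun setT (fun omega => g N M (X^~ omega)).
  exact: (@measurable_g _ _ (fun omega => X^~ omega)).
have rgap N : rintegrable P
    (fun omega => (1 - q N (X^~ omega)) * Q N.+1 M (X^~ omega)).
  by apply: (@ri_bounded _ _ _ P 1) => // omega; rewrite ger0_norm.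
have g1 N x : `|g N M x| <= 1 by exact: le_trans (g_bnd _ _ _) (gap_le1 _ _ _).
have rUgap N : rintegrable P
    (fun omega => `|U m omega| * ((1 - q N (X^~ omega)) * Q N.+1 M (X^~ omega))).
  by apply: (@riM_bnd _ _ _ _ 1) => //; [exact: ri_abs|
    move=> omega; rewrite ger0_norm].
have main N : (m <= N <= M)%N ->
    lambda * \int[P]_omega ((1 - q N (X^~ omega)) * Q N.+1 M (X^~ omega)) <=
    \int[P]_omega (`|U m omega| *
      ((1 - q N (X^~ omega)) * Q N.+1 M (X^~ omega))).
  move=> /andP[mN NM]; rewrite -RintZ//.
  apply: (@le_trans _ _ (\int[P]_omega (U N omega * g N M (X^~ omega)))).
    apply: ler_Rint; [exact: riZ|exact: riUbnd|move=> omega].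
    have -> : U N omega * g N M (X^~ omega) =
        `|U N omega| * ((1 - q N (X^~ omega)) * Q N.+1 M (X^~ omega)).
      rewrite /g (mulrA (U N omega)); congr (_ * _); rewrite -/(U N omega).
      case: (leP 0 (U N omega)) => U0.
        by rewrite mulr1 ger0_norm.
      by rewrite mulrN1 ltr0_norm.
    rewrite !mulrA ler_wpM2r//; first by case/andP: (Q01 N.+1 M (X^~ omega)).
    rewrite /q -/(U N omega); case: ifPn => [_|]; first by rewrite subrr !mulr0.
    by rewrite subr0 !mulr1 -ltNge => /ltW.
  have N0 : (0 < N)%N by exact: leq_trans m0 mN.
  rewrite (emp_mean_cross_exchangeable N0 (leqnn N) (leqW NM) fi
    (exchangeable_g NM) (mg N) (g1 N)).
  rewrite -(emp_mean_cross_exchangeable m0 mN (leqW NM) fi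
    (exchangeable_g NM) (mg N) (g1 N)).
  apply: ler_Rint => //; first exact: riUbnd.
  move=> omega; apply: (le_trans (ler_norm _)); rewrite normrM ler_wpM2l//.
under eq_Rintegral do rewrite -gap_telescope//.
rewrite Rint_sum// mulr_sumr.
apply: (@le_trans _ _ (\sum_(m <= N < M.+1) \int[P]_omega (`|U m omega| *
    ((1 - q N (X^~ omega)) * Q N.+1 M (X^~ omega))))).
  by rewrite !big_nat; apply: ler_sum => N; rewrite ltnS; exact: main.
rewrite -Rint_sum//; apply: ler_Rint; [exact: ri_sum|exact: ri_abs|move=> omega].
rewrite -mulr_sumr gap_telescope// ler_piMr// lerBlDr lerDl.
by case/andP: (Q01 m M (X^~ omega)).
Qed.

End maximal_inequality.

(** * The strong law for product-form averages *)

Section strong_law.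
Context (R : realType) (K : nat) (d : 'I_K -> measure_display).
Context (S : forall k, measurableType (d k)).
Variable mu_ : forall k, probability (S k) R.
Let mu := prod_prob mu_.
Context (dO : measure_display) (Omega : measurableType dO).
Variables (P : probability Omega R) (X : nat -> {RV P >-> prodT S}).
Hypothesis iidX : iid mu X.

Lemma emp_mean_crossB_cst N (f : prodT S -> R) c (x : nat -> prodT S) :
  (0 < N)%N ->
  emp_mean_cross N (fun y => f y - c) x = emp_mean_cross N f x - c.
Proof.
move=> N0; rewrite /emp_mean_cross sumrB mulrBr; congr (_ - _).
rewrite sumr_const card_ffun !card_ord -[X in _ * X]mulr_natr mulrCA mulVf ?mulr1//.
by rewrite pnatr_eq0 -lt0n expn_gt0 N0.
Qed.

(** Let M, then m, tend to infinity in the maximal inequality; the bound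
    E|U_m| / lambda vanishes by the L1 law.  All events are written as limits of
    [0, 1]-valued functions, to which dominated convergence applies. *)
Lemma frequently_large_negligible (f : prodT S -> R) (lambda : R) :
  rintegrable mu f -> \int[mu]_x f x = 0 -> 0 < lambda ->
  {ae P, forall omega, exists m, forall N, (m <= N)%N ->
    `|emp_mean_cross N f (X^~ omega)| <= lambda}.
Proof.
move=> fi f0 l0; have mf := ri_measurable fi.
pose U N omega := emp_mean_cross N f (X^~ omega).
have mU N : measurable_fun setT (U N) by exact: measurable_emp_mean_cross.
pose q N omega : R := if `|U N omega| <= lambda then 1 else 0.
have mq N : measurable_fun setT (q N).
  apply: measurable_fun_ifT => //; apply: measurable_fun_ler => //.
  exact: measurableT_comp.
pose pM m M omega := 1 - \prod_(m <= N < M.+1) q N omega.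
have mpM m M : measurable_fun setT (pM m M).
  by apply: measurable_funB => //; apply: measurable_prod => N _; exact: mq.
have pMb m M omega : `|pM m M omega| <= 1.
  have Q0 : 0 <= \prod_(m <= N < M.+1) q N omega.
    by apply: prodr_ge0 => N _; rewrite /q; case: ifP.
  have Q1 : \prod_(m <= N < M.+1) q N omega <= 1.
    by apply: prodr_ile1 => N _; rewrite /q; case: ifP => _; rewrite ?ler01 lexx.
  by rewrite /pM ler_norml; lra.
pose p m omega : R :=
  if `[< exists2 N, (m <= N)%N & lambda < `|U N omega| >] then 1 else 0.
have pMp m omega : (fun M => pM m M omega) @ \oo --> p m omega.
  apply: cvg_near_cst; rewrite /p; case: asboolP => [[N mN NU]|none].
    have qN : q N omega = 0 by rewrite /q ifF//; apply/negbTE; rewrite -ltNge.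
    exists N => // M /= NM; rewrite /pM (big_cat_nat (n := N)) ?leqW//=.
    by rewrite [X in _ * X]big_ltn// qN mul0r mulr0 subr0.
  apply: nearW => M; rewrite /pM big_nat big1 ?subrr// => N /andP[mN _].
  rewrite /q; case: ifPn => //; rewrite -ltNge => NU.
  by exfalso; apply: none; exists N.
have mp m : measurable_fun setT (p m).
  by apply: (@measurable_fun_cvg _ _ _ _ (pM m)) => // omega _; exact: pMp.
have p1 m omega : `|p m omega| <= 1.
  by rewrite /p; case: ifP => _; rewrite ?normr1 ?normr0 ?ler01.
have r0 := cross_L1_lln iidX fi.
have pr m : (0 < m)%N ->
    lambda * \int[P]_omega p m omega <= \int[P]_omega `|U m omega|.
  move=> m0; rewrite mulrC -ler_pdivlMr//.
  apply: (cvgr_to_le (Rint_dct (mpM m) (ri_cst P 1) (pMb m) (pMp m))).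
  near=> M; rewrite ler_pdivlMr// mulrC.
  have mM : (m <= M.+1)%N by near: M; exists m => // M /= /leqW.
  exact: (maximal_inequality iidX fi lambda m0 mM).
pose b omega : R :=
  if `[< forall m, exists2 N, (m <= N)%N & lambda < `|U N omega| >] then 1 else 0.
have pb omega : (fun m => p m omega) @ \oo --> b omega.
  apply: cvg_near_cst; rewrite /b; case: asboolP => [B|/existsNP[m Bm]].
    by apply: nearW => m; rewrite /p asboolT.
  exists m => // m' /= mm'; rewrite /p asboolF// => -[N m'N NU].
  by apply: Bm; exists N => //; exact: leq_trans mm' m'N.
have mb : measurable_fun setT b.
  by apply: (@measurable_fun_cvg _ _ _ _ p) => // omega _; exact: pb.
have b1 omega : `|b omega| <= 1.
  by rewrite /b; case: ifP => _; rewrite ?normr1 ?normr0 ?ler01.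
have b0 : \int[P]_omega b omega = 0.
  apply/eqP; rewrite eq_le; apply/andP; split; last first.
    by apply: Rintegral_ge0 => omega _; rewrite /b; case: ifP.
  rewrite -(mulr0 lambda^-1).
  have h : (fun m => lambda^-1 * \int[P]_omega `|U m omega|) @ \oo --> lambda^-1 * 0.
    apply: cvgMl_tmp; move: r0; rewrite f0.
    by under eq_fun do under eq_Rintegral do rewrite subr0.
  apply: (ler_cvg_to (Rint_dct mp (ri_cst P 1) p1 pb) h).
  near=> m; rewrite ler_pdivlMl//; apply: pr.
  by near: m; exists 1%N.
pose B := b @^-1` [set 1].
have mB : measurable B by rewrite -[B]setTI; exact: mb.
exists B; split => //.
  have -> : P B = (\int[P]_omega (\1_B omega)%:E)%E by rewrite integral_indic// setIT.
  have -> : \1_B = b :> (Omega -> R).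
    apply/funext => omega; rewrite indicE /b; case: asboolP => h.
      by rewrite mem_set// /B /= /b asboolT.
    rewrite memNset// /B /= /b asboolF// => /eqP.
    by rewrite eq_sym oner_eq0.
  rewrite RintK ?b0//; exact: ri_bounded b1.
move=> omega /= /forallNP h; rewrite /B /= /b asboolT// => m.
have /existsNP[N /not_implyP[mN /negP]] := h m.
by rewrite -ltNge => NU; exists N.
Unshelve. all: by end_near. Qed.

Lemma cross_strong_law (f : prodT S -> R) : rintegrable mu f ->
  {ae P, forall omega,
    (fun N => emp_mean_cross N f (X^~ omega)) @ \oo --> \int[mu]_x f x}.
Proof.
move=> fi; set c := \int[mu]_x f x.
have gi : rintegrable mu (fun x => f x - c) by apply: riB => //; exact: ri_cst.
have g0 : \int[mu]_x (f x - c) = 0.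
  by rewrite RintB ?Rint_cst ?subrr//; exact: ri_cst.
have j0 j : 0 < (j.+1%:R : R)^-1 by rewrite invr_gt0.
have := ae_foralln (fun j : nat => frequently_large_negligible gi g0 (j0 j)).
apply: filterS => omega h; apply/cvgrPdist_le => e e0.
have [j _ /(_ j (leqnn j))/= je] : \forall j \near \oo, `|0 - (j.+1%:R : R)^-1| <= e.
  by have /cvgrPdist_le/(_ _ e0) := @cvg_harmonic R.
have [m Nm] := h j; near=> N.
have N0 : (0 < N)%N by near: N; exists 1%N.
rewrite distrC -emp_mean_crossB_cst//; apply: (@le_trans _ _ j.+1%:R^-1).
  by apply: Nm; near: N; exists m.
by rewrite sub0r normrN in je; exact: le_trans (ler_norm _) je.
Unshelve. all: by end_near. Qed.

End strong_law.

(** * The projection onto sums of functions of one coordinate *)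

Section ae_integrals.
Context (R : realType) (dT : measure_display) (T : measurableType dT).
Variable mu : probability T R.

Lemma ri_ae_le (f g : T -> R) : measurable_fun setT f -> rintegrable mu g ->
  {ae mu, forall x, `|f x| <= g x} -> rintegrable mu f.
Proof.
move=> mf gi fg; apply/integrableP; split; first exact/measurable_EFinP.
have /integrableP[mg] := ri_abs gi; apply: le_lt_trans.
apply: ae_ge0_le_integral => //.
- by apply: measurableT_comp => //; exact/measurable_EFinP.
- by apply: measurableT_comp.
by apply: filterS fg => x fg _ /=; rewrite lee_fin normr_id (le_trans fg)// ler_norm.
Qed.

Lemma ae_eq_Rint (f g : T -> R) : measurable_fun setT f ->
  measurable_fun setT g -> {ae mu, forall x, f x = g x} ->
  \int[mu]_x f x = \int[mu]_x g x.
Proof.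
move=> mf mg fg; congr fine; apply: ae_eq_integral => //.
- exact/measurable_EFinP.
- exact/measurable_EFinP.
by apply: filterS fg => x -> _.
Qed.

End ae_integrals.

Section projection.
Context (R : realType) (K : nat) (d : 'I_K -> measure_display).
Context (S : forall k, measurableType (d k)).
Variable mu_ : forall k, probability (S k) R.
Let mu := prod_prob mu_.
Implicit Types (f g : prodT S -> R) (k l : 'I_K) (a b c : prodT S).
Local Notation ri := (rintegrable mu).

Definition sqri f := measurable_fun setT f /\ ri (fun x => f x ^+ 2).

(** The conditional expectation of g given the k-th coordinate. *)
Definition proj k g (a : prodT S) : R := \int[mu]_b g (repl k a b).

(** E[f(a) g(a')] for a' that agrees with a at k and is independent of it elsewhere:
    this is how two recombinations sharing exactly the coordinate k behave. *)
Definition bil k f g : R :=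
  \int[(mu \x mu)%E]_p (f p.1 * g (repl k p.1 p.2)).

Lemma repl_repl k a b c : repl k (repl k a b) c = repl k a c.
Proof.
by apply: functional_extensionality_dep => l; rewrite /repl; case: (l == k).
Qed.

Lemma repl_repl_neq k l a b c : l != k -> repl l (repl k a b) c = repl l b c.
Proof.
move=> lk; apply: functional_extensionality_dep => j; rewrite /repl.
by case: eqVneq => // ->; rewrite (negbTE lk).
Qed.

Lemma proj_repl k g a b : proj k g (repl k a b) = proj k g a.
Proof. by apply: eq_Rintegral => c _; rewrite repl_repl. Qed.

Lemma proj_repl_neq k l g a b : l != k ->
  proj l g (repl k a b) = proj l g b.
Proof. by move=> lk; apply: eq_Rintegral => c _; rewrite repl_repl_neq. Qed.

Lemma ri_repl k g : ri g ->
  rintegrable (mu \x mu)%E (fun p => g (repl k p.1 p.2)).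
Proof. by move=> gi; apply/(law_ri (law_repl mu_ k)) => //; exact: ri_measurable gi. Qed.

Lemma ri_proj k g : ri g -> ri (proj k g).
Proof. by move=> /(ri_repl k)/ri_fubini. Qed.

Lemma Rint_proj k g : ri g -> \int[mu]_a proj k g a = \int[mu]_a g a.
Proof.
move=> gi; rewrite (Rint_fubini (ri_repl k gi)).
by rewrite (law_Rint (law_repl mu_ k))//; exact: ri_measurable gi.
Qed.

Lemma sqri_ri g : sqri g -> ri g.
Proof. by move=> [mg g2]; exact: ri_of_sqr. Qed.

Lemma sqri_proj k g : sqri g -> sqri (proj k g).
Proof.
move=> gs; have [mg g2] := gs; have gi := sqri_ri gs.
have mp := ri_measurable (ri_proj k gi); split => //.
apply: (ri_ae_le _ (ri_proj k g2)); first exact: measurable_funX.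
have := ae_integrable1 (ri_repl k g2); apply: filterS => a ga.
rewrite ger0_norm ?sqr_ge0//; apply: sqr_Rint_le => //.
exact: (measurableT_comp mg (@measurable_repl2 _ _ S k a)).
Qed.

Lemma sqriD f g : sqri f -> sqri g -> sqri (fun x => f x + g x).
Proof. by move=> [mf f2] [mg g2]; split; [exact: measurable_funD|exact: ri_sqrD]. Qed.

Lemma sqriB f g : sqri f -> sqri g -> sqri (fun x => f x - g x).
Proof. by move=> [mf f2] [mg g2]; split; [exact: measurable_funB|exact: ri_sqrB]. Qed.

Lemma sqri_sum (I : Type) (s : seq I) (F : I -> prodT S -> R) :
  (forall i, sqri (F i)) -> sqri (fun x => \sum_(i <- s) F i x).
Proof.
move=> sF; elim: s => [|i s IH].
  rewrite (_ : (fun _ => _) = fun=> 0).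
    by split => //; exact: (ri_cst mu (0 ^+ 2)).
  by apply/funext => x; rewrite big_nil.
rewrite (_ : (fun _ => _) = fun x => F i x + \sum_(i <- s) F i x).
  exact: sqriD.
by apply/funext => x; rewrite big_cons.
Qed.

Lemma sqriM f g : sqri f -> sqri g -> ri (fun x => f x * g x).
Proof. by move=> [mf f2] [mg g2]; exact: riM_sqr. Qed.

Lemma ri_bil k f g : sqri f -> sqri g ->
  rintegrable (mu \x mu)%E (fun p => f p.1 * g (repl k p.1 p.2)).
Proof.
move=> [mf f2] [mg g2]; apply: riM_sqr.
- exact: (measurableT_comp mf measurable_fst).
- exact: (measurableT_comp mg (@measurable_repl _ _ S k)).
- by apply/(law_ri (law_fst mu mu) (f := fun x => f x ^+ 2)) => //;
    exact: measurable_funX.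
- exact: ri_repl g2.
Qed.

(** proj k is the conditional expectation under this coupling. *)
Lemma bil_proj k f g : sqri f -> sqri g ->
  bil k f g = \int[mu]_a (f a * proj k g a).
Proof.
move=> fs gs; rewrite /bil -(Rint_fubini (ri_bil k fs gs)).
apply: ae_eq_Rint.
- exact: ri_measurable (ri_fubini (ri_bil k fs gs)).
- apply: measurable_funM; first exact: fs.1.
  exact: (sqri_proj k gs).1.
have := ae_integrable1 (ri_repl k (sqri_ri gs)); apply: filterS => a ga.
exact: (RintZ (f a) ga).
Qed.

Lemma bil_invariant k f g : sqri f -> sqri g ->
  (forall a b, f (repl k a b) = f a) -> bil k f g = \int[mu]_a (f a * g a).
Proof.
move=> fs gs fk; rewrite -(law_Rint (law_repl mu_ k)); last first.
  by apply: measurable_funM; [exact: fs.1|exact: gs.1].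
by apply: eq_Rintegral => p _; rewrite fk.
Qed.

Lemma bilB k f g h : sqri f -> sqri g -> sqri h ->
  bil k f (fun x => g x - h x) = bil k f g - bil k f h.
Proof.
move=> fs gs hs; rewrite /bil -RintB; [|exact: ri_bil|exact: ri_bil].
by apply: eq_Rintegral => p _; rewrite mulrBr.
Qed.

Lemma bil_sum k f (I : Type) (s : seq I) (F : I -> prodT S -> R) : sqri f ->
  (forall i, sqri (F i)) ->
  bil k f (fun x => \sum_(i <- s) F i x) = \sum_(i <- s) bil k f (F i).
Proof.
move=> fs sF; rewrite /bil -Rint_sum => [|i]; last exact: ri_bil.
by apply: eq_Rintegral => p _; rewrite mulr_sumr.
Qed.

Variable psi : prodT S -> R.
Hypothesis psi_sqri : sqri psi.
Hypothesis psi0 : \int[mu]_x psi x = 0.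

Let ps k := sqri_proj k psi_sqri.

Lemma proj_self k : proj k (proj k psi) = proj k psi.
Proof.
apply/funext => a; rewrite {1}/proj.
under eq_Rintegral do rewrite proj_repl.
exact: Rint_cst.
Qed.

(** proj l psi depends on the coordinate l only, which is independent of the
    coordinate k; its mean is 0 because psi is centred. *)
Lemma proj_other k l a : l != k -> proj k (proj l psi) a = 0.
Proof.
move=> lk; rewrite {1}/proj.
under eq_Rintegral do rewrite proj_repl_neq//.
by rewrite Rint_proj//; exact: sqri_ri.
Qed.

(** The Hajek projection of psi. *)
Definition hajek (a : prodT S) : R := \sum_k proj k psi a.

Lemma sqri_hajek : sqri hajek.
Proof. exact: sqri_sum. Qed.

Lemma hajek0 : \int[mu]_a hajek a = 0.
Proof.
rewrite Rint_sum => [|k]; last exact: sqri_ri.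
by rewrite big1// => k _; rewrite Rint_proj//; exact: sqri_ri.
Qed.

Definition proj_var : R := \sum_k \int[mu]_a (proj k psi a ^+ 2).

Lemma psi_proj k : \int[mu]_a (proj k psi a * psi a) = \int[mu]_a (proj k psi a ^+ 2).
Proof.
by rewrite -(bil_invariant (k := k)) ?bil_proj//; exact: proj_repl.
Qed.

Lemma proj_proj k l : l != k -> \int[mu]_a (proj k psi a * proj l psi a) = 0.
Proof.
move=> lk; rewrite -(bil_invariant (k := k)) ?bil_proj//; last exact: proj_repl.
rewrite -[RHS](Rint_cst mu 0); apply: eq_Rintegral => a _.
by rewrite proj_other// mulr0.
Qed.

Lemma proj_hajek k :
  \int[mu]_a (proj k psi a * hajek a) = \int[mu]_a (proj k psi a ^+ 2).
Proof.
transitivity (\int[mu]_a (\sum_l proj k psi a * proj l psi a)).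
  by apply: eq_Rintegral => a _; rewrite mulr_sumr.
rewrite Rint_sum => [|l]; last exact: sqriM.
rewrite (bigD1 k)//= big1 ?addr0 => [|l lk]; last exact: proj_proj.
by apply: eq_Rintegral => a _; rewrite expr2.
Qed.

(** The summands of the projection are centred functions of different independent
    coordinates, hence orthogonal. *)
Lemma hajek_sqr : \int[mu]_a (hajek a ^+ 2) = proj_var.
Proof.
transitivity (\int[mu]_a (\sum_k proj k psi a * hajek a)).
  by apply: eq_Rintegral => a _; rewrite -mulr_suml expr2.
rewrite Rint_sum => [|k]; last by apply: sqriM => //; exact: sqri_hajek.
by apply: eq_bigr => k _; exact: proj_hajek.
Qed.

(** Pythagoras: the square norm of psi minus its projection is the difference of
    the two sides. *)
Lemma proj_var_le : proj_var <= \int[mu]_a (psi a ^+ 2).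
Proof.
have hs := sqri_hajek; have [mpsi psi2] := psi_sqri.
have E : \int[mu]_a ((psi a - hajek a) ^+ 2) = \int[mu]_a (psi a ^+ 2) - proj_var.
  have ph : \int[mu]_a (hajek a * psi a) = proj_var.
    transitivity (\int[mu]_a (\sum_k proj k psi a * psi a)).
      by apply: eq_Rintegral => a _; rewrite -mulr_suml.
    rewrite Rint_sum => [|k]; last exact: sqriM.
    by apply: eq_bigr => k _; exact: psi_proj.
  transitivity (\int[mu]_a (psi a ^+ 2 + (- 2 * (hajek a * psi a) + hajek a ^+ 2))).
    by apply: eq_Rintegral => a _; ring.
  have hp : ri (fun a => hajek a * psi a) by exact: sqriM.
  rewrite RintD//; last by apply: riD; [exact: riZ|exact: hs.2].
  rewrite RintD//; [|exact: riZ|exact: hs.2].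
  by rewrite RintZ// ph hajek_sqr; ring.
by rewrite -subr_ge0 -E Rintegral_ge0// => a _; exact: sqr_ge0.
Qed.

Definition residual (a : prodT S) : R := psi a - hajek a.

Lemma sqri_residual : sqri residual.
Proof. by apply: sqriB => //; exact: sqri_hajek. Qed.

Lemma residual0 : \int[mu]_a residual a = 0.
Proof.
rewrite RintB ?psi0 ?hajek0 ?subrr//; first exact: sqri_ri.
by apply: sqri_ri; exact: sqri_hajek.
Qed.

(** The projection of the residual on the coordinate k vanishes: proj k fixes
    proj k psi and kills the other summands. *)
Lemma bil_residual k : bil k residual residual = 0.
Proof.
have rs := sqri_residual; have hs := sqri_hajek.
rewrite bilB// bil_sum// bil_proj// (bigD1 k)//= big1 => [|l lk].
  by rewrite addr0 bil_proj// proj_self subrr.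
rewrite bil_proj// -[RHS](Rint_cst mu 0); apply: eq_Rintegral => a _.
by rewrite proj_other ?mulr0.
Qed.

End projection.

(** * Approximating a product-form average by a sample average *)

Section hajek_approximation.
Context (R : realType) (K : nat) (d : 'I_K -> measure_display).
Context (S : forall k, measurableType (d k)).
Variable mu_ : forall k, probability (S k) R.
Let mu := prod_prob mu_.
Variable psi : prodT S -> R.
Hypothesis psi_sqri : sqri mu_ psi.
Hypothesis psi0 : \int[mu]_x psi x = 0.

Let proj_mean k a : proj mu_ k psi a = partial_mean mu_ psi (a k).
Proof. by rewrite /proj partial_mean_repl//; exact: psi_sqri.1. Qed.

Lemma sigma2E : sigma2 mu_ psi = (\int[mu]_x (psi x ^+ 2))%:E.
Proof.
rewrite /sigma2 -/mu psi0; have [_ psi2] := psi_sqri.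
by rewrite -RintK//; apply: eq_integral => x _; rewrite subr0.
Qed.

Lemma sigma2_crossE : sigma2_cross mu_ psi = (proj_var mu_ psi)%:E.
Proof.
rewrite /sigma2_cross /proj_var -sumEFin; apply: eq_bigr => k _.
rewrite -/mu psi0.
have [mp p2] := sqri_proj k psi_sqri.
rewrite -(RintK p2).
have mpm : measurable_fun setT (fun x : S k => (partial_mean mu_ psi x ^+ 2)%:E).
  apply/measurable_EFinP/measurable_funX.
  pose fillk (x : S k) : prodT S := Defs.glue (x, point).
  have mfill : measurable_fun setT fillk.
    by apply: (measurableT_comp (@measurable_glue _ _ S k)).
  rewrite (_ : partial_mean mu_ psi = proj mu_ k psi \o fillk); last first.
    by apply/funext => x /=; rewrite proj_mean /fillk glue_self.
  exact: measurableT_comp.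
rewrite -(law_ge0_integral (law_coord mu_ k)) => [||x]; last 2 first.
- by under eq_fun do rewrite subr0.
- by rewrite lee_fin sqr_ge0.
by apply: eq_integral => a _; rewrite subr0 proj_mean.
Qed.

(** Each value of n k is attained by N^(K-1) index vectors. *)
Lemma sum_ffun_coord (N : nat) (k : 'I_K) (F : 'I_N -> R) :
  \sum_(n : {ffun 'I_K -> 'I_N}) F (n k) = N%:R ^+ K.-1 * \sum_i F i.
Proof.
pose G (l : 'I_K) (i : 'I_N) := if l == k then F i else 1.
transitivity (\sum_(n : {ffun 'I_K -> 'I_N}) \prod_l G l (n l)).
  apply: eq_bigr => n _; rewrite (bigD1 k)//= big1 ?mulr1 => [|l lk].
    by rewrite /G eqxx.
  by rewrite /G (negbTE lk).
rewrite -bigA_distr_bigA (bigD1 k)//= mulrC; congr (_ * _).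
  rewrite (eq_bigr (fun=> N%:R)) => [|l lk].
    by rewrite prodr_const; congr (_ ^+ _); rewrite cardC1 card_ord.
  by rewrite /G (negbTE lk) sumr_const card_ord.
by apply: eq_bigr => i _; rewrite /G eqxx.
Qed.

(** Recombining coordinates does not affect a sum of functions of one
    coordinate. *)
Lemma emp_mean_cross_additive (N : nat) (x : nat -> prodT S) : (0 < N)%N ->
  emp_mean_cross N (hajek mu_ psi) x = emp_mean N (hajek mu_ psi) x.
Proof.
move=> N0; rewrite /emp_mean_cross /emp_mean /hajek.
rewrite exchange_big [in RHS]exchange_big /= !mulr_sumr; apply: eq_bigr => k _.
under eq_bigr do rewrite proj_mean.
under [in RHS]eq_bigr do rewrite proj_mean.
rewrite (sum_ffun_coord k (fun i => partial_mean mu_ psi (x i k))) mulrA.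
congr (_ * _); have K0 : (0 < K)%N by case: k => m; case: (K).
have NR : (N%:R : R) != 0 by rewrite pnatr_eq0 -lt0n.
rewrite natrX -[in N%:R ^+ K](prednK K0) exprS invfM -mulrA mulVf ?mulr1//.
by rewrite expf_neq0.
Qed.

Context (dO : measure_display) (Omega : measurableType dO).
Variables (P : probability Omega R) (X : nat -> {RV P >-> prodT S}).
Hypothesis iidX : iid mu X.

Lemma residual_uncorrelated (a b : 'I_K -> nat) :
  (forall k l, k != l -> ~~ ((a k == b k) && (a l == b l))) ->
  \int[P]_omega (residual mu_ psi (mixed X a omega) *
                 residual mu_ psi (mixed X b omega)) = 0.
Proof.
move=> ab; have rs := sqri_residual psi_sqri; have [mr r2] := rs.
have [[k akbk]|none] := pselect (exists k, a k == b k); last first.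
  have diff k : a k != b k by apply/negP => akbk; apply: none; exists k.
  rewrite (law_Rint (law_mixed2 iidX diff)
    (f := fun p => residual mu_ psi p.1 * residual mu_ psi p.2)); last first.
    apply: measurable_funM; first exact: (measurableT_comp mr measurable_fst).
    exact: (measurableT_comp mr measurable_snd).
  rewrite -Rint_fubini /=; last first.
    apply: riM_sqr.
    - exact: (measurableT_comp mr measurable_fst).
    - exact: (measurableT_comp mr measurable_snd).
    - by apply/(law_ri (law_fst mu mu) (f := fun x => residual mu_ psi x ^+ 2)) => //;
        exact: measurable_funX.
    - by apply/(law_ri (law_snd mu mu) (f := fun x => residual mu_ psi x ^+ 2)) => //;
        exact: measurable_funX.
  rewrite -[RHS](Rint_cst mu 0); apply: eq_Rintegral => x _.
  rewrite RintZ; last exact: sqri_ri rs.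
  by rewrite (residual0 psi_sqri psi0) mulr0.
pose b' l := if l == k then (b k).+1 else b l.
have diff l : a l != b' l.
  rewrite /b'; have [->|lk] := eqVneq l k.
    by rewrite (eqP akbk) neq_ltn ltnSn.
  by have := ab k l; rewrite eq_sym lk akbk /= => /(_ isT).
have mb omega : mixed X b omega = repl k (mixed X a omega) (mixed X b' omega).
  apply: functional_extensionality_dep => l; rewrite /repl /mixed /b'.
  by case: eqVneq => // ->; rewrite (eqP akbk).
under eq_Rintegral do rewrite mb.
rewrite (law_Rint (law_mixed2 iidX diff)
  (f := fun p => residual mu_ psi p.1 * residual mu_ psi (repl k p.1 p.2))).
  exact: (bil_residual psi_sqri psi0 k).
exact: ri_measurable (ri_bil k rs rs).
Qed.

Lemma cross_residual_sqr_le N : (0 < N)%N ->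
  \int[P]_omega (emp_mean_cross N (residual mu_ psi) (X^~ omega) ^+ 2) <=
    K%:R ^+ 2 / N%:R ^+ 2 * \int[mu]_x (residual mu_ psi x ^+ 2).
Proof.
move=> N0; have [mr r2] := sqri_residual psi_sqri.
under eq_Rintegral do rewrite emp_mean_crossE.
apply: (le_trans (average_sqr_le (bad := @share2 K N) _ mr r2 _)).
- by move=> n; exact: law_mixed.
- move=> n n' nn'; apply: residual_uncorrelated => k l kl.
  move: nn'; rewrite /share2 => /existsPn/(_ (k, l)) /=.
  by rewrite kl.
by rewrite ler_wpM2r ?share2_ratio// Rintegral_ge0// => x _; exact: sqr_ge0.
Qed.

(** The difference is sqrt N times the product-form average of the residual.
    Recombinations that share no coordinate are independent, those that share
    exactly one are uncorrelated for the residual, and two common coordinates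
    have frequency at most K^2/N^2. *)
Lemma hajek_approximation N : (0 < N)%N ->
  \int[P]_omega ((Num.sqrt N%:R * emp_mean_cross N psi (X^~ omega)
    - Num.sqrt N%:R * emp_mean N (hajek mu_ psi) (X^~ omega)) ^+ 2) <=
  K%:R ^+ 2 * \int[mu]_x (residual mu_ psi x ^+ 2) / N%:R.
Proof.
move=> N0; have [mr r2] := sqri_residual psi_sqri.
have E omega : (Num.sqrt N%:R * emp_mean_cross N psi (X^~ omega)
    - Num.sqrt N%:R * emp_mean N (hajek mu_ psi) (X^~ omega)) ^+ 2 =
    N%:R * emp_mean_cross N (residual mu_ psi) (X^~ omega) ^+ 2.
  rewrite -mulrBr exprMn sqr_sqrtr// -emp_mean_cross_additive//.
  by rewrite -mulrBr -sumrB.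
under eq_Rintegral do rewrite E.
rewrite RintZ; last first.
  have : rintegrable P (fun omega => average
      (fun n : {ffun 'I_K -> 'I_N} => mixed X (fun k => n k))
      (residual mu_ psi) omega ^+ 2).
    by apply: (ri_average_sqr _ mr r2) => n; exact: law_mixed.
  by congr rintegrable; apply/funext => omega; rewrite emp_mean_crossE.
have N1 : 0 < N%:R :> R by rewrite ltr0n.
rewrite mulrC -ler_pdivlMr//; apply: le_trans (cross_residual_sqr_le N0) _.
by rewrite le_eqVlt; apply/orP; left; apply/eqP; field; rewrite gt_eqF.
Qed.

End hajek_approximation.

(** * Moments of the normal distribution *)

Section normal_integrals.
Context (R : realType).
Local Notation leb := (@lebesgue_measure R).

Lemma lebesgue_translation (c : R) : has_law leb (fun x => x + c) leb.
Proof.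
have mc : measurable_fun setT (fun x : R => x + c) by exact: measurable_funD.
split => // A mA.
apply/esym/(@lebesgue_measure_unique R
  (pushforward leb ((fun x => x + c) : _ -> measurableTypeR R))) => //.
move=> _ [[a b]] _ <-; rewrite /=.
transitivity (leb `]a - c, b - c]%classic); last first.
  congr (leb _); apply/esym.
  by apply/seteqP; split => x /=; rewrite !in_itv/= lerBrDr ltrBlDr.
rewrite !lebesgue_measure_itv/= !lte_fin ltrD2r; case: ifP => // _.
by rewrite -!EFinB; congr (_%:E); ring.
Qed.

(** normal_prob is defined by its values on sets; its density is identified
    through uniqueness of the Radon-Nikodym derivative. *)
Lemma normal_ge0_integral (m s : R) (f : R -> \bar R) :
  measurable_fun setT f -> (forall x, 0 <= f x)%E ->
  (\int[(normal_prob m s : probability (measurableTypeR R) R)]_x f x =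
   \int[leb]_x (f x * (normal_pdf m s x)%:E))%E.
Proof.
move=> mf f0.
have dom := @normal_prob_dominates R m s.
rewrite -(@Radon_Nikodym_SigmaFinite.change_of_variables _ _ _
  (normal_prob m s) leb dom f setT f0 measurableT mf).
have mRN : measurable_fun setT
    (Radon_Nikodym_SigmaFinite.f (normal_prob m s) leb).
  exact: measurable_int (Radon_Nikodym_SigmaFinite.f_integrable dom).
have mpdf : measurable_fun setT (fun x => (normal_pdf m s x)%:E).
  by apply/measurable_EFinP; exact: measurable_normal_pdf.
apply: ae_eq_integral => //; [exact: emeasurable_funM..|].
apply: ae_eqe_mul2l.
apply: integral_ae_eq => //.
- exact: Radon_Nikodym_SigmaFinite.f_integrable.
- move=> E _ mE; rewrite -Radon_Nikodym_SigmaFinite.f_integral//.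
Qed.

Variable s : R.
Hypothesis s0 : 0 < s.
Let sn0 : s != 0. Proof. by rewrite gt_eqF. Qed.
Local Notation N := (normal_prob 0 s : probability (measurableTypeR R) R).

Lemma normal_peakE (b : R) : 0 < b ->
  normal_peak b = (b * Num.sqrt (2 * pi))^-1 :> R.
Proof.
move=> b0; rewrite /normal_peak; congr (_^-1).
have -> : b ^+ 2 * pi *+ 2 = b ^+ 2 * (2 * pi) by rewrite -mulr_natl; ring.
by rewrite sqrtrM ?sqr_ge0// sqrtr_sqr gtr0_norm.
Qed.

(** The second and third moments come from this change of variance: integrating the
    left-hand side gives the value of E exp(c x^2), for every c < 1/(2 s^2), without any
    integration by parts. *)
Lemma normal_pdf_ratio (b x : R) : 0 < b ->
  expR ((s ^- 2 - b ^- 2) / 2 * x ^+ 2) * normal_pdf 0 s x =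
  b / s * normal_pdf 0 b x.
Proof.
move=> b0; rewrite !normal_pdfE ?gt_eqF// !normal_peakE// /normal_fun subr0.
have p0 : Num.sqrt (2 * pi) != 0 :> R.
  by rewrite gt_eqF// sqrtr_gt0 mulr_gt0// pi_gt0.
have -> : expR (- x ^+ 2 / (b ^+ 2 *+ 2)) =
    expR ((s ^- 2 - b ^- 2) / 2 * x ^+ 2) * expR (- x ^+ 2 / (s ^+ 2 *+ 2)).
  by rewrite -expRD; congr expR; field; rewrite !gt_eqF.
by field; rewrite p0 !gt_eqF.
Qed.

Lemma measurable_exp_sqr (c : R) : measurable_fun setT (fun x : R => expR (c * x ^+ 2)).
Proof.
by apply: measurableT_comp => //; apply: measurable_funM.
Qed.

Lemma normal_exp_sqr_eintegral (b : R) : 0 < b ->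
  (\int[N]_x (expR ((s ^- 2 - b ^- 2) / 2 * x ^+ 2))%:E = (b / s)%:E)%E.
Proof.
move=> b0; rewrite normal_ge0_integral; last 2 first.
- by apply/measurable_EFinP; exact: measurable_exp_sqr.
- by move=> x; rewrite lee_fin expR_ge0.
under eq_integral do rewrite -EFinM normal_pdf_ratio// EFinM.
rewrite ge0_integralZl_EFin//; last 3 first.
- by move=> x _; rewrite lee_fin normal_pdf_ge0.
- by apply/measurable_EFinP; exact: measurable_normal_pdf.
- by rewrite divr_ge0// ltW.
by rewrite integral_normal_pdf mule1.
Qed.

Lemma ri_exp_sqr (b : R) : 0 < b ->
  rintegrable N (fun x => expR ((s ^- 2 - b ^- 2) / 2 * x ^+ 2)).
Proof.
move=> b0; apply/integrableP; split.
  by apply/measurable_EFinP; exact: measurable_exp_sqr.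
under eq_integral do rewrite /= ger0_norm ?expR_ge0//.
by rewrite normal_exp_sqr_eintegral// ltry.
Qed.

Lemma normal_exp_sqr (b : R) : 0 < b ->
  \int[N]_x expR ((s ^- 2 - b ^- 2) / 2 * x ^+ 2) = b / s.
Proof. by move=> b0; rewrite /Rintegral normal_exp_sqr_eintegral. Qed.

Let c2 : (s ^- 2 - (2 * s) ^- 2) / 2 = 3 / (8 * s ^+ 2).
Proof. by field. Qed.

Lemma ri_normal_sqr : rintegrable N (fun x => x ^+ 2).
Proof.
have e0 : 0 < 2 * s by rewrite mulr_gt0.
apply: (ri_le _ (riZ (8 * s ^+ 2 / 3) (ri_exp_sqr e0))).
  exact: measurable_funX.
move=> x; rewrite c2 ger0_norm ?sqr_ge0//.
have := expR_ge1Dx (3 / (8 * s ^+ 2) * x ^+ 2).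
have s2 : 0 < 8 * s ^+ 2 / 3 by rewrite divr_gt0// mulr_gt0// exprn_gt0.
rewrite -(ler_pM2l s2); apply: le_trans.
have -> : 8 * s ^+ 2 / 3 * (1 + 3 / (8 * s ^+ 2) * x ^+ 2) = 8 * s ^+ 2 / 3 + x ^+ 2.
  by field.
by rewrite lerDr ltW.
Qed.

Let m2_bound (b : R) : 0 < b ->
  (s ^- 2 - b ^- 2) / 2 * \int[N]_x (x ^+ 2) <= b / s - 1.
Proof.
move=> b0; rewrite -RintZ; last exact: ri_normal_sqr.
have -> : b / s - 1 =
    \int[N]_x (expR ((s ^- 2 - b ^- 2) / 2 * x ^+ 2) - 1).
  by rewrite RintB ?normal_exp_sqr ?Rint_cst//; [exact: ri_exp_sqr|exact: ri_cst].
apply: ler_Rint.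
- by apply: riZ; exact: ri_normal_sqr.
- by apply: riB; [exact: ri_exp_sqr|exact: ri_cst].
by move=> x; rewrite lerBrDl; exact: expR_ge1Dx.
Qed.

(** From 1 + u <= exp u with u = c x^2, c = (s^-2 - b^-2) / 2, one gets
    c E x^2 <= b / s - 1 for all b > 0.  The sign of c changes at b = s, so the
    two sides b > s and b < s give an upper and a lower bound, and both tend to
    s^2 as b tends to s. *)
Lemma normal_sqr : \int[N]_x (x ^+ 2) = s ^+ 2.
Proof.
set m2 := \int[N]_x (x ^+ 2).
have up b : s < b -> m2 * (b + s) <= 2 * s * b ^+ 2.
  move=> sb; have b0 : 0 < b by exact: lt_trans sb.
  have := m2_bound b0; rewrite -/m2.
  have w : 0 < 2 * s ^+ 2 * b ^+ 2 / (b - s).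
    by rewrite divr_gt0 ?subr_gt0// !mulr_gt0// exprn_gt0.
  rewrite -(ler_pM2l w); congr (_ <= _).
    by field; rewrite !gt_eqF// subr_gt0.
  by field; rewrite !gt_eqF// subr_gt0.
have lo b : 0 < b -> b < s -> 2 * s * b ^+ 2 <= m2 * (b + s).
  move=> b0 bs; have := m2_bound b0; rewrite -/m2.
  have w : 0 < 2 * s ^+ 2 * b ^+ 2 / (s - b).
    by rewrite divr_gt0 ?subr_gt0// !mulr_gt0// exprn_gt0.
  have sb : s - b != 0 by rewrite gt_eqF// subr_gt0.
  rewrite -(ler_pM2l w).
  have -> : 2 * s ^+ 2 * b ^+ 2 / (s - b) * ((s ^- 2 - b ^- 2) / 2 * m2) =
      - (m2 * (b + s)).
    by field; rewrite sb !gt_eqF.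
  have -> : 2 * s ^+ 2 * b ^+ 2 / (s - b) * (b / s - 1) = - (2 * s * b ^+ 2).
    by field; rewrite sb !gt_eqF.
  by rewrite lerN2.
have m20 : 0 <= m2 by apply: Rintegral_ge0 => x _; exact: sqr_ge0.
apply/eqP; rewrite eq_le; apply/andP; split; rewrite leNgt; apply/negP => h.
  set del := m2 - s ^+ 2; have del0 : 0 < del by rewrite subr_gt0.
  (* The bound at b = s + t gives del (2 s + t) <= 3 s^2 t + 2 s t^2 <= s del. *)
  pose t := Num.min s (del / (5 * s)).
  have t0 : 0 < t by rewrite lt_min s0 divr_gt0// mulr_gt0.
  have ts : t <= s by rewrite ge_min lexx.
  have td : 5 * s * t <= del by rewrite mulrC -ler_pdivlMr ?mulr_gt0// ge_min lexx orbT.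
  have := up (s + t) (_ : s < s + t); rewrite ltrDl => /(_ t0).
  have -> : m2 = s ^+ 2 + del by rewrite /del; ring.
  have sd : 0 < s * del by exact: mulr_gt0.
  have st : s * (5 * s * t) <= s * del by rewrite ler_pM2l.
  have sst : s * (t * t) <= s * (s * t) by rewrite ler_pM2l// ler_pM2r.
  have dt : 0 < del * t by exact: mulr_gt0.
  have sst0 : 0 < s * (s * t) by rewrite !mulr_gt0.
  nra.
set del := s ^+ 2 - m2; have del0 : 0 < del by rewrite subr_gt0.
(* The bound at b = s - t gives del (2 s - t) <= 3 s^2 t <= s del. *)
pose t := Num.min (s / 2) (del / (4 * s)).
have t0 : 0 < t by rewrite lt_min !divr_gt0// mulr_gt0.
have ts : t <= s / 2 by rewrite ge_min lexx.
have td : 4 * s * t <= del by rewrite mulrC -ler_pdivlMr ?mulr_gt0// ge_min lexx orbT.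
have ts2 : t < s by lra.
have := lo (s - t) (_ : 0 < s - t) (_ : s - t < s).
rewrite subr_gt0 gtrBl => /(_ ts2 t0).
have -> : m2 = s ^+ 2 - del by rewrite /del; ring.
have sd : 0 < s * del by exact: mulr_gt0.
have st : s * (4 * s * t) <= s * del by rewrite ler_pM2l.
have dels : del * t <= s ^+ 2 * t by rewrite ler_pM2r// /del gerBl.
have st0 : 0 < s * (t * t) by rewrite !mulr_gt0.
nra.
Qed.

(** With b = 2 s the exponent is u = 3 x^2 / (8 s^2), and
    (u / 2)^2 <= (exp (u / 2))^2 = exp u. *)
Let quartic_le (x : R) :
  x ^+ 4 <= 256 / 9 * s ^+ 4 * expR ((s ^- 2 - (2 * s) ^- 2) / 2 * x ^+ 2).
Proof.
rewrite c2; set u := 3 / (8 * s ^+ 2) * x ^+ 2.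
have u0 : 0 <= u by rewrite mulr_ge0 ?sqr_ge0// divr_ge0// mulr_ge0// sqr_ge0.
have e2 : (u / 2) ^+ 2 <= expR u.
  have -> : expR u = expR (u / 2) ^+ 2 by rewrite expr2 -expRD; congr expR; field.
  rewrite lerXn2r ?nnegrE ?expR_ge0 ?divr_ge0//.
  by apply: le_trans (expR_ge1Dx _); lra.
have s4 : 0 < 256 / 9 * s ^+ 4 by rewrite mulr_gt0// ?exprn_gt0// divr_gt0.
apply: le_trans (_ : 256 / 9 * s ^+ 4 * (u / 2) ^+ 2 <= _).
  by rewrite le_eqVlt; apply/orP; left; apply/eqP; rewrite /u; field.
by rewrite ler_pM2l.
Qed.

(** 2 |x|^3 <= s x^2 + x^4 / s. *)
Let cube_le (x : R) : `|x| ^+ 3 <= 2^-1 * s * x ^+ 2 +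
  128 / 9 * s ^+ 3 * expR ((s ^- 2 - (2 * s) ^- 2) / 2 * x ^+ 2).
Proof.
have q := quartic_le x.
set E := expR _ in q *.
have h : `|x| ^+ 3 <= 2^-1 * s * x ^+ 2 + (2 * s)^-1 * x ^+ 4.
  rewrite -[x ^+ 2]real_normK ?num_real// (_ : x ^+ 4 = `|x| ^+ 4); last first.
    by rewrite -[4%N]/(2 * 2)%N !exprM real_normK ?num_real.
  have := mulr_ge0 (mulr_ge0 (ltW (_ : 0 < (2 * s)^-1)) (sqr_ge0 `|x|))
    (sqr_ge0 (`|x| - s)).
  rewrite invr_gt0 mulr_gt0// => /(_ isT).
  have -> : (2 * s)^-1 * `|x| ^+ 2 * (`|x| - s) ^+ 2 =
    2^-1 * s * `|x| ^+ 2 + (2 * s)^-1 * `|x| ^+ 4 - `|x| ^+ 3 by field.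
  by rewrite subr_ge0.
apply: (le_trans h); rewrite lerD2l.
have := ler_wpM2l (ltW (_ : 0 < (2 * s)^-1)) q.
rewrite invr_gt0 mulr_gt0// => /(_ isT) /le_trans; apply.
by rewrite le_eqVlt; apply/orP; left; apply/eqP; field.
Qed.

Let ri_cube_bound : rintegrable N (fun x => 2^-1 * s * x ^+ 2 +
  128 / 9 * s ^+ 3 * expR ((s ^- 2 - (2 * s) ^- 2) / 2 * x ^+ 2)).
Proof.
have e0 : 0 < 2 * s by rewrite mulr_gt0.
exact: (riD (riZ (2^-1 * s) ri_normal_sqr)
  (riZ (128 / 9 * s ^+ 3) (ri_exp_sqr e0))).
Qed.

Lemma ri_normal_cube : rintegrable N (fun x => `|x| ^+ 3).
Proof.
apply: (ri_le _ ri_cube_bound).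
  by apply: measurable_funX; exact: normr_measurable.
by move=> x; rewrite ger0_norm ?exprn_ge0//; exact: cube_le.
Qed.

(** 1/2 + 256/9 <= 29; only the order s^3 matters later. *)
Lemma normal_cube : \int[N]_x (`|x| ^+ 3) <= 29 * s ^+ 3.
Proof.
have e0 : 0 < 2 * s by rewrite mulr_gt0.
apply: (le_trans (ler_Rint ri_normal_cube ri_cube_bound cube_le)).
rewrite RintD; [|by apply: riZ; exact: ri_normal_sqr|by apply: riZ; exact: ri_exp_sqr].
rewrite RintZ; last exact: ri_normal_sqr.
rewrite RintZ; last exact: ri_exp_sqr.
rewrite normal_sqr normal_exp_sqr//.
have -> : 2^-1 * s * s ^+ 2 + 128 / 9 * s ^+ 3 * (2 * s / s) = (2^-1 + 256 / 9) * s ^+ 3.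
  by field.
by rewrite ler_wpM2r ?exprn_ge0 ?ltW//; lra.
Qed.

Lemma normal_symmetric : has_law N (fun x : R => - x) N.
Proof.
split; first exact: measurableT_comp.
move=> A mA.
change ((\int[leb]_(x in -%R @^-1` A) (normal_pdf 0 s x)%:E)%E =
  (\int[leb]_(x in A) (normal_pdf 0 s x)%:E)%E).
have lawN : has_law leb (fun x : R => - x) leb.
  by split; [exact: measurableT_comp|exact: lebesgue_measureN].
have mNA : measurable (-%R @^-1` A : set R).
  by rewrite -[X in measurable X]setTI; exact: lawN.1.
rewrite integral_mkcond [RHS]integral_mkcond.
rewrite -(@law_ge0_integral _ _ _ _ R leb leb _ lawN) => [||x]; last 2 first.
- apply/(measurable_restrictT _ _).1 => //; apply/measurable_EFinP.
  by apply: measurable_funTS; exact: measurable_normal_pdf.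
- by rewrite patchE; case: ifP => // _; rewrite lee_fin normal_pdf_ge0.
apply: eq_integral => x _; rewrite !patchE.
have -> : (- x \in -%R @^-1` A) = (x \in A) by apply/idP/idP; rewrite !inE /= opprK.
case: ifP => // _; congr (_%:E).
by rewrite !normal_pdfE// /normal_fun !subr0 sqrrN.
Qed.

Lemma ri_normal_id : rintegrable N (fun x => x).
Proof. by apply: ri_of_sqr => //; exact: ri_normal_sqr. Qed.

Lemma normal_mean : \int[N]_x x = 0.
Proof.
have := @law_Rint _ _ _ _ _ N N _ normal_symmetric (fun x => x) (@measurable_id _ _ _).
have -> : \int[N]_x (- x) = - \int[N]_x x.
  rewrite -mulN1r -RintZ; last exact: ri_normal_id.
  by apply: eq_Rintegral => x _; rewrite mulN1r.
by move=> h; lra.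
Qed.

End normal_integrals.

(** * Convolution of centred Gaussian laws *)

Section gaussian_family.
Context (R : realType).
Local Notation leb := (@lebesgue_measure R).
Local Notation normal s := (normal_prob 0 s : probability (measurableTypeR R) R).
Implicit Types s t v : R.

(** Completing the square: as a function of x, the product of the two densities is
    a normal density times a factor that is the convolution. *)
Lemma normal_pdf_convolution s t (x z : R) : 0 < s -> 0 < t ->
  let u := Num.sqrt (s ^+ 2 + t ^+ 2) in
  normal_pdf 0 t (z - x) * normal_pdf 0 s x =
  normal_pdf 0 u z * normal_pdf (z * s ^+ 2 / u ^+ 2) (s * t / u) x.
Proof.
move=> s0 t0 u.
have st0 : 0 < s ^+ 2 + t ^+ 2 by rewrite addr_gt0// exprn_gt0.
have u0 : 0 < u by rewrite sqrtr_gt0.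
have r0 : 0 < s * t / u by rewrite divr_gt0// mulr_gt0.
have p0 : Num.sqrt (2 * pi) != 0 :> R.
  by rewrite gt_eqF// sqrtr_gt0 mulr_gt0// pi_gt0.
rewrite !normal_pdfE ?gt_eqF// !normal_peakE// /normal_fun !subr0.
rewrite mulrACA [RHS]mulrACA -!expRD; congr (_ * expR _).
  by field; rewrite p0 !gt_eqF.
have u2 : u ^+ 2 = s ^+ 2 + t ^+ 2 by rewrite sqr_sqrtr// ltW.
rewrite !exprMn exprVn u2.
by field; rewrite !gt_eqF.
Qed.

Lemma measurable_plus :
  measurable_fun setT (fun p : measurableTypeR R * measurableTypeR R => (p.1 + p.2 : measurableTypeR R)).
Proof. exact: measurable_funD. Qed.

Section density_convolution.
Variables (P1 P2 P3 : probability (measurableTypeR R) R) (p1 p2 p3 : R -> R).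
Hypothesis mp1 : measurable_fun setT p1.
Hypothesis mp2 : measurable_fun setT p2.
Hypothesis p10 : forall x, 0 <= p1 x.
Hypothesis p20 : forall x, 0 <= p2 x.
Hypothesis density1 : forall f : R -> \bar R, measurable_fun setT f ->
  (forall x, 0 <= f x)%E -> (\int[P1]_x f x = \int[leb]_x (f x * (p1 x)%:E))%E.
Hypothesis density2 : forall f : R -> \bar R, measurable_fun setT f ->
  (forall x, 0 <= f x)%E -> (\int[P2]_x f x = \int[leb]_x (f x * (p2 x)%:E))%E.
Hypothesis density3 : forall f : R -> \bar R, measurable_fun setT f ->
  (forall x, 0 <= f x)%E -> (\int[P3]_x f x = \int[leb]_x (f x * (p3 x)%:E))%E.
Hypothesis conv : forall z,
  (\int[leb]_x ((p2 (z - x)%R)%:E * (p1 x)%:E) = (p3 z)%:E)%E.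

(** Translate the inner integral by x, then exchange the two integrals. *)
Lemma density_convolution :
  has_law (P1 \x P2)%E
    (fun p : measurableTypeR R * measurableTypeR R => (p.1 + p.2 : measurableTypeR R))
    P3.
Proof.
split; first exact: measurable_plus.
move=> A mA.
pose i (z : R) : \bar R := (\1_A z)%:E.
have mi : measurable_fun setT i by apply/measurable_EFinP; exact: measurable_indic.
have i0 z : (0 <= i z)%E by rewrite lee_fin.
have mp1E : measurable_fun setT (fun x => (p1 x)%:E) by exact/measurable_EFinP.
have mp2E : measurable_fun setT (fun x => (p2 x)%:E) by exact/measurable_EFinP.
have p1E0 x : (0 <= (p1 x)%:E)%E by rewrite lee_fin.
have p2E0 x : (0 <= (p2 x)%:E)%E by rewrite lee_fin.
set B := _ @^-1` A.
have mB : measurable B by rewrite -[B]setTI; exact: measurable_plus.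
transitivity (\int[(P1 \x P2)%E]_p (\1_B p)%:E)%E.
  by rewrite integral_indic// setIT.
rewrite fubini_tonelli1//=; last by apply/measurable_EFinP; exact: measurable_indic.
rewrite /fubini_F.
have mx (x : R) : measurable_fun setT
    (fun z : R => i z * (p2 (z - x)%R)%:E)%E.
  apply: emeasurable_funM => //; apply: (measurableT_comp mp2E).
  exact: measurable_funB.
transitivity (\int[P1]_x \int[leb]_z (i z * (p2 ((z : R) - x)%R)%:E))%E.
  apply: eq_integral => x _.
  transitivity (\int[P2]_y i ((y : R) + x)%R)%E.
    by apply: eq_integral => y _; rewrite /i addrC !indicE.
  rewrite density2//; last first.
    by apply: (measurableT_comp mi); exact: measurable_funD.
  rewrite -(@law_ge0_integral _ _ _ _ R leb leb _ (lebesgue_translation x)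
    (fun z : R => i z * (p2 (z - x)%R)%:E)%E)//.
  - by apply: eq_integral => y _; rewrite addrK.
  - exact: mx.
  - by move=> z; rewrite mule_ge0.
pose G (p : measurableTypeR R * measurableTypeR R) : \bar R :=
  (i p.2 * ((p2 (p.2 - p.1)%R)%:E * (p1 p.1)%:E))%E.
have mp2B : measurable_fun setT
    (fun p : measurableTypeR R * measurableTypeR R => (p2 (p.2 - p.1))%:E).
  by apply: (measurableT_comp mp2E); exact: measurable_funB.
have mG : measurable_fun setT G.
  apply: emeasurable_funM; first exact: (measurableT_comp mi measurable_snd).
  by apply: emeasurable_funM => //; exact: (measurableT_comp mp1E measurable_fst).
have G0 p : (0 <= G p)%E by apply: mule_ge0 => //; exact: mule_ge0.
have mix : measurable_fun setT
    (fun x : R => \int[leb]_z (i z * (p2 ((z : R) - x)%R)%:E))%E.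
  apply: (measurable_fun_fubini_tonelli_F (m2 := leb)
    (fun p : measurableTypeR R * measurableTypeR R =>
      (i p.2 * (p2 (p.2 - p.1)%R)%:E)%E)).
    by apply: emeasurable_funM => //; exact: (measurableT_comp mi measurable_snd).
  by move=> p; exact: mule_ge0.
rewrite density1//; last first.
  by move=> x; apply: integral_ge0 => z _; rewrite mule_ge0.
transitivity (\int[leb]_x \int[leb]_z G (x, z))%E.
  apply: eq_integral => x _; rewrite -ge0_integralZr//.
  - by apply: eq_integral => z _; rewrite /G muleA.
  - exact: mx.
  - by move=> z _; rewrite mule_ge0.
rewrite (fubini_tonelli (m1 := leb) (m2 := leb))//.
transitivity (\int[leb]_z (i z * (p3 z)%:E))%E.
  apply: eq_integral => z _; rewrite -conv.
  rewrite -ge0_integralZl//; last 2 first.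
  - apply: emeasurable_funM => //; apply: (measurableT_comp mp2E).
    exact: measurable_funB.
  - by move=> x _; rewrite mule_ge0.
rewrite -density3//.
by rewrite integral_indic// setIT.
Qed.

End density_convolution.

Lemma law_plus_Rint (P1 P2 P3 : probability (measurableTypeR R) R)
    (f : R -> R) (c : R) :
  has_law (P1 \x P2)%E
    (fun p : measurableTypeR R * measurableTypeR R => (p.1 + p.2 : measurableTypeR R))
    P3 ->
  measurable_fun setT f -> (forall x, `|f x| <= c) ->
  \int[P1]_x (\int[P2]_y f (x + y)) = \int[P3]_x f x.
Proof.
move=> lawD mf fc; rewrite -(law_Rint lawD mf).
have fi : rintegrable (P1 \x P2)%E
    (fun p : measurableTypeR R * measurableTypeR R => f (p.1 + p.2)).
  apply: (@ri_bounded _ _ _ (P1 \x P2)%E c) => //.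
  exact: (measurableT_comp mf measurable_plus).
exact: (Rint_fubini fi).
Qed.

Lemma normal_convolution s t : 0 < s -> 0 < t ->
  has_law (normal s \x normal t)%E
    (fun p : measurableTypeR R * measurableTypeR R => (p.1 + p.2 : measurableTypeR R))
    (normal (Num.sqrt (s ^+ 2 + t ^+ 2))).
Proof.
move=> s0 t0.
apply: (@density_convolution _ _ _ (normal_pdf 0 s) (normal_pdf 0 t)
  (normal_pdf 0 (Num.sqrt (s ^+ 2 + t ^+ 2)))).
- exact: measurable_normal_pdf.
- exact: measurable_normal_pdf.
- by move=> x; exact: normal_pdf_ge0.
- by move=> x; exact: normal_pdf_ge0.
- exact: normal_ge0_integral.
- exact: normal_ge0_integral.
- exact: normal_ge0_integral.
move=> z.
under eq_integral => x _ do rewrite -EFinM normal_pdf_convolution// EFinM.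
rewrite ge0_integralZl_EFin//.
- by rewrite integral_normal_pdf mule1.
- by move=> x _; rewrite lee_fin normal_pdf_ge0.
- by apply/measurable_EFinP; exact: measurable_normal_pdf.
- exact: normal_pdf_ge0.
Qed.

Local Notation gauss v := (gaussian 0 v).

Lemma gauss0E : gauss (0 : R) = \d_(0 : measurableTypeR R) :> probability _ _.
Proof. by rewrite /gaussian eqxx. Qed.

Lemma gauss_normalE v : 0 < v -> gauss v = normal (Num.sqrt v).
Proof. by move=> v0; rewrite /gaussian gt_eqF. Qed.

Let Rint_dirac (f : R -> R) : measurable_fun setT f ->
  \int[(\d_(0 : measurableTypeR R) : probability _ R)]_x f x = f 0.
Proof.
move=> mf; rewrite /Rintegral integral_dirac//; last exact/measurable_EFinP.
by rewrite diracT mul1e.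
Qed.

Let ri_dirac (f : R -> R) : measurable_fun setT f ->
  rintegrable (\d_(0 : measurableTypeR R) : probability _ R) f.
Proof.
move=> mf; apply/integrableP; split; first exact/measurable_EFinP.
rewrite integral_dirac//; last first.
  by apply: measurableT_comp => //; exact/measurable_EFinP.
by rewrite diracT mul1e ltry.
Qed.

Lemma gauss0_Rint (f : R -> R) : measurable_fun setT f ->
  \int[gauss 0]_x f x = f 0.
Proof. by move=> mf; rewrite gauss0E Rint_dirac. Qed.

Lemma ri_gauss_sqr v : 0 <= v -> rintegrable (gauss v) (fun x => x ^+ 2).
Proof.
rewrite le_eqVlt => /predU1P[<-|v0]; last first.
  by rewrite gauss_normalE//; apply: ri_normal_sqr; rewrite sqrtr_gt0.
by rewrite gauss0E; apply: ri_dirac; exact: measurable_funX.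
Qed.

Lemma gauss_sqr v : 0 <= v -> \int[gauss v]_x (x ^+ 2) = v.
Proof.
rewrite le_eqVlt => /predU1P[<-|v0]; last first.
  by rewrite gauss_normalE// normal_sqr ?sqrtr_gt0// sqr_sqrtr// ltW.
by rewrite gauss0E Rint_dirac ?expr0n//; exact: measurable_funX.
Qed.

Lemma gauss_mean v : 0 <= v -> \int[gauss v]_x x = 0.
Proof.
rewrite le_eqVlt => /predU1P[<-|v0]; last first.
  by rewrite gauss_normalE// normal_mean ?sqrtr_gt0.
by rewrite gauss0E Rint_dirac.
Qed.

Lemma ri_gauss_cube v : 0 <= v -> rintegrable (gauss v) (fun x => `|x| ^+ 3).
Proof.
rewrite le_eqVlt => /predU1P[<-|v0]; last first.
  by rewrite gauss_normalE//; apply: ri_normal_cube; rewrite sqrtr_gt0.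
by rewrite gauss0E; apply: ri_dirac; apply: measurable_funX; exact: normr_measurable.
Qed.

Lemma gauss_cube v : 0 <= v -> \int[gauss v]_x (`|x| ^+ 3) <= 29 * Num.sqrt v ^+ 3.
Proof.
rewrite le_eqVlt => /predU1P[<-|v0]; last first.
  by rewrite gauss_normalE// normal_cube// sqrtr_gt0.
rewrite gauss0E Rint_dirac ?sqrtr0 ?normr0 ?expr0n ?mulr0//.
by apply: measurable_funX; exact: normr_measurable.
Qed.

(** A variance 0 is that of an empty sum of Gaussian variables, or of a degenerate
    limit law; the law is then a Dirac mass. *)
Lemma gauss_convolution v v' (f : R -> R) (c : R) : 0 <= v -> 0 <= v' ->
  measurable_fun setT f -> (forall x, `|f x| <= c) ->
  \int[gauss v]_x (\int[gauss v']_y f (x + y)) = \int[gauss (v + v')]_x f x.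
Proof.
move=> + + mf fc.
have mfD x : measurable_fun setT (fun y : R => f (x + y)).
  by apply: (measurableT_comp mf); exact: measurable_funD.
rewrite le_eqVlt => /predU1P[<- v'0|v0].
  rewrite gauss0E add0r Rint_dirac; last first.
    have fi : rintegrable (gauss 0 \x gauss v')%E
        (fun p : measurableTypeR R * measurableTypeR R => f (p.1 + p.2)).
      by apply: (@ri_bounded _ _ _ (gauss 0 \x gauss v')%E c) => //;
        exact: (measurableT_comp mf measurable_plus).
    exact: ri_measurable (ri_fubini fi).
  by apply: eq_Rintegral => y _; rewrite add0r.
rewrite le_eqVlt => /predU1P[<-|v'0].
  rewrite gauss0E addr0; apply: eq_Rintegral => x _.
  by rewrite Rint_dirac// addr0.
rewrite (gauss_normalE v0) (gauss_normalE v'0) (gauss_normalE (addr_gt0 v0 v'0)).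
apply: (law_plus_Rint _ mf fc).
have sv : 0 < Num.sqrt v by rewrite sqrtr_gt0.
have sv' : 0 < Num.sqrt v' by rewrite sqrtr_gt0.
have := normal_convolution sv sv'.
by rewrite (sqr_sqrtr (ltW v0)) (sqr_sqrtr (ltW v'0)).
Qed.

End gaussian_family.

(** * Smooth steps *)

Section spline_step.
Context (R : realType).
Implicit Types x u a h : R.

Definition pos_part x : R := Num.max x 0.

(** The distribution function of the sum of three independent uniform variables
    on [0, 1]: it is 0 before 0, 1 after 3, and has a Lipschitz second derivative.
    spline1 and spline2 are its derivatives. *)
Definition spline x : R :=
  (pos_part x ^+ 3 - 3 * pos_part (x - 1) ^+ 3 + 3 * pos_part (x - 2) ^+ 3
   - pos_part (x - 3) ^+ 3) / 6.

Definition spline1 x : R :=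
  (pos_part x ^+ 2 - 3 * pos_part (x - 1) ^+ 2 + 3 * pos_part (x - 2) ^+ 2
   - pos_part (x - 3) ^+ 2) / 2.

Definition spline2 x : R :=
  pos_part x - 3 * pos_part (x - 1) + 3 * pos_part (x - 2) - pos_part (x - 3).

Lemma pos_partP x : (0 <= x /\ pos_part x = x) \/ (x < 0 /\ pos_part x = 0).
Proof.
by rewrite /pos_part; have [x0|x0] := leP 0 x; [left|right].
Qed.

Lemma pos_id x : 0 <= x -> pos_part x = x.
Proof. by move=> x0; rewrite /pos_part max_l. Qed.

Lemma pos_0 x : x <= 0 -> pos_part x = 0.
Proof. by move=> x0; rewrite /pos_part max_r. Qed.

Lemma splines_le0 x : x <= 0 -> [/\ spline x = 0, spline1 x = 0 & spline2 x = 0].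
Proof.
move=> x0; rewrite /spline /spline1 /spline2.
rewrite (@pos_0 x) ?(@pos_0 (x - 1)) ?(@pos_0 (x - 2)) ?(@pos_0 (x - 3)); try lra.
by split; field.
Qed.

Lemma splines01 x : 0 <= x -> x <= 1 ->
  [/\ spline x = x ^+ 3 / 6, spline1 x = x ^+ 2 / 2 & spline2 x = x].
Proof.
move=> x0 x1; rewrite /spline /spline1 /spline2.
rewrite (@pos_id x) ?(@pos_0 (x - 1)) ?(@pos_0 (x - 2)) ?(@pos_0 (x - 3)); try lra.
by split; field.
Qed.

Lemma splines12 x : 1 <= x -> x <= 2 ->
  [/\ spline x = (1 + 3 * (x - 1) + 3 * (x - 1) ^+ 2 - 2 * (x - 1) ^+ 3) / 6,
      spline1 x = (1 + 2 * (x - 1) - 2 * (x - 1) ^+ 2) / 2 &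
      spline2 x = 1 - 2 * (x - 1)].
Proof.
move=> x1 x2; rewrite /spline /spline1 /spline2.
rewrite (@pos_id x) ?(@pos_id (x - 1)) ?(@pos_0 (x - 2)) ?(@pos_0 (x - 3)); try lra.
by split; field.
Qed.

Lemma splines23 x : 2 <= x -> x <= 3 ->
  [/\ spline x = 1 - (3 - x) ^+ 3 / 6, spline1 x = (3 - x) ^+ 2 / 2 &
      spline2 x = x - 3].
Proof.
move=> x2 x3; rewrite /spline /spline1 /spline2.
rewrite (@pos_id x) ?(@pos_id (x - 1)) ?(@pos_id (x - 2)) ?(@pos_0 (x - 3)); try lra.
by split; field.
Qed.

Lemma splines_ge3 x : 3 <= x -> [/\ spline x = 1, spline1 x = 0 & spline2 x = 0].
Proof.
move=> x3; rewrite /spline /spline1 /spline2.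
rewrite (@pos_id x) ?(@pos_id (x - 1)) ?(@pos_id (x - 2)) ?(@pos_id (x - 3)); try lra.
by split; field.
Qed.

Lemma splines_bounds x :
  [/\ 0 <= spline x <= 1, `|spline1 x| <= 1 & `|spline2 x| <= 1].
Proof.
have powers (y : R) : 0 <= y -> y <= 1 ->
    [/\ 0 <= y ^+ 3, y ^+ 3 <= y ^+ 2, 0 <= y ^+ 2 & y ^+ 2 <= y].
  move=> y0 y1; split; [exact: exprn_ge0| |exact: sqr_ge0|].
    by rewrite exprS ler_piMl// exprn_ge0.
  by rewrite expr2 ler_piMl.
have [x0|/ltW x0] := leP x 0.
  by have [-> -> ->] := splines_le0 x0; rewrite normr0 lexx ler01.
have [x1|/ltW x1] := leP x 1.
  have [-> -> ->] := splines01 x0 x1; have [? ? ? ?] := powers x x0 x1.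
  by rewrite !ler_norml; split; apply/andP; split; lra.
have [x2|/ltW x2] := leP x 2.
  have [-> -> ->] := splines12 x1 x2; set t := x - 1.
  have t0 : 0 <= t by rewrite /t; lra.
  have t1 : t <= 1 by rewrite /t; lra.
  have [? ? ? ?] := powers t t0 t1.
  have ? : 0 <= (1 - t) ^+ 2 by exact: sqr_ge0.
  have ? : 0 <= (1 - t) ^+ 2 * (1 + 2 * t) by rewrite mulr_ge0//; lra.
  by rewrite !ler_norml; split; apply/andP; split; lra.
have [x3|/ltW x3] := leP x 3; last first.
  by have [-> -> ->] := splines_ge3 x3; rewrite normr0 lexx ler01.
have [-> -> ->] := splines23 x2 x3; set t := 3 - x.
have -> : x - 3 = - t by rewrite /t; ring.
have t0 : 0 <= t by rewrite /t; lra.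
have t1 : t <= 1 by rewrite /t; lra.
have [? ? ? ?] := powers t t0 t1.
by rewrite !ler_norml; split; apply/andP; split; lra.
Qed.

Lemma spline_le0 x : x <= 0 -> spline x = 0.
Proof. by case/splines_le0. Qed.

Lemma spline_ge3 x : 3 <= x -> spline x = 1.
Proof. by case/splines_ge3. Qed.

Lemma spline01 x : 0 <= spline x <= 1.
Proof. by case: (splines_bounds x). Qed.

Lemma spline1_bound x : `|spline1 x| <= 1.
Proof. by case: (splines_bounds x). Qed.

Lemma spline2_bound x : `|spline2 x| <= 1.
Proof. by case: (splines_bounds x). Qed.

(** On each side of 0 the function is a cubic polynomial, whose expansion is exact
    up to u^3; if x and x + u have opposite signs, x is bounded by u. *)
Lemma pos_part_cube_taylor x u :
  `|pos_part (x + u) ^+ 3 - pos_part x ^+ 3 - 3 * pos_part x ^+ 2 * u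
    - 3 * pos_part x * u ^+ 2| <= `|u| ^+ 3.
Proof.
have cube_mono (y z : R) : 0 <= y -> y <= z -> 0 <= y ^+ 3 <= z ^+ 3.
  by move=> y0 yz; rewrite exprn_ge0//= lerXn2r ?nnegrE//; exact: le_trans yz.
case: (pos_partP (x + u)) => -[xu0 ->]; case: (pos_partP x) => -[x0 ->].
- have -> : (x + u) ^+ 3 - x ^+ 3 - 3 * x ^+ 2 * u - 3 * x * u ^+ 2 = u ^+ 3.
    by ring.
  by rewrite normrX.
- have u0 : 0 <= u by lra.
  rewrite !expr0n/= !(mulr0, mul0r) !subr0 !ger0_norm ?exprn_ge0//.
  by have /andP[] : 0 <= (x + u) ^+ 3 <= u ^+ 3 by apply: cube_mono; lra.
- have u0 : 0 <= - u by lra.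
  have -> : 0 ^+ 3 - x ^+ 3 - 3 * x ^+ 2 * u - 3 * x * u ^+ 2 =
      (- (x + u)) ^+ 3 - (- u) ^+ 3 by ring.
  have -> : `|u| ^+ 3 = (- u) ^+ 3 by rewrite -normrN ger0_norm.
  have /andP[? ?] : 0 <= (- (x + u)) ^+ 3 <= (- u) ^+ 3.
    by apply: cube_mono; lra.
  by rewrite ler_norml; apply/andP; split; lra.
- by rewrite !expr0n/= !(mulr0, mul0r) !subr0 normr0 exprn_ge0.
Qed.

(** The test functions of the central limit theorem: bounded functions f with
    a uniform second-order Taylor expansion, f1 and f2 standing for the
    derivatives of f.  The remainder is bounded by u^2 for large u, so that only second
    moments are required. *)
Definition taylor (C : R) (f f1 f2 : R -> R) :=
  [/\ [/\ measurable_fun setT f, measurable_fun setT f1 & measurable_fun setT f2],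
      forall x, `|f x| <= C, forall x, `|f1 x| <= C, forall x, `|f2 x| <= C &
      forall x u, `|f (x + u) - f x - f1 x * u - f2 x / 2 * u ^+ 2| <=
        C * Num.min (u ^+ 2) (`|u| ^+ 3)].

Lemma spline_taylor x u :
  `|spline (x + u) - spline x - spline1 x * u - spline2 x / 2 * u ^+ 2| <=
    5 / 2 * Num.min (u ^+ 2) (`|u| ^+ 3).
Proof.
set T := `|_|.
have T3 : T <= 4 / 3 * `|u| ^+ 3.
  have t y := pos_part_cube_taylor y u.
  have := t x; have := t (x - 1); have := t (x - 2); have := t (x - 3).
  rewrite /T /spline /spline1 /spline2 !(addrAC _ _ u) !ler_norml.
  by move=> /andP[? ?] /andP[? ?] /andP[? ?] /andP[? ?]; apply/andP; split; lra.
have u0 := normr_ge0 u.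
have uu : u ^+ 2 = `|u| ^+ 2 by rewrite real_normK ?num_real.
have [u1|u1] := leP `|u| 1.
  have u3 : `|u| ^+ 3 <= u ^+ 2.
    by rewrite uu exprS ler_piMl// exprn_ge0.
  by rewrite min_r//; have := exprn_ge0 3 u0; lra.
have u3 : u ^+ 2 <= `|u| ^+ 3.
  by rewrite uu [leRHS]exprS ler_peMl ?exprn_ge0// ltW.
rewrite min_l//.
have T1 : T <= 1 + `|u| + 2^-1 * u ^+ 2.
  rewrite /T; apply: le_trans (ler_normB _ _) _; apply: lerD; last first.
    rewrite normrM [X in _ * X]ger0_norm ?sqr_ge0// ler_wpM2r ?sqr_ge0//.
    by rewrite normrM [X in _ * X]gtr0_norm ?invr_gt0// ler_piMl// spline2_bound.
  apply: le_trans (ler_normB _ _) _; apply: lerD; last first.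
    by rewrite normrM ler_piMl// spline1_bound.
  have := spline01 (x + u); have := spline01 x; rewrite ler_norml.
  by move=> /andP[? ?] /andP[? ?]; lra.
by rewrite uu in T1 *; nra.
Qed.

(** A smooth step from 0 at a to 1 at a + 3h. *)
Definition step a h x := spline ((x - a) / h).

Lemma measurable_pos_part (f : R -> R) : measurable_fun setT f ->
  measurable_fun setT (fun x => pos_part (f x)).
Proof. by move=> mf; exact: measurable_maxr. Qed.

Lemma step01 a h x : 0 <= step a h x <= 1.
Proof. exact: spline01. Qed.

Lemma measurable_affine a h : measurable_fun setT (fun x => (x - a) / h).
Proof. by apply: measurable_funM => //; exact: measurable_funB. Qed.

Lemma measurable_spline :
  [/\ measurable_fun setT spline, measurable_fun setT spline1 &
      measurable_fun setT spline2].
Proof.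
have mp (c : R) (n : nat) : measurable_fun setT (fun x => pos_part (x - c) ^+ n).
  by apply: measurable_funX; apply: measurable_pos_part; exact: measurable_funB.
have mp0 (n : nat) : measurable_fun setT (fun x => pos_part x ^+ n).
  by apply: measurable_funX; exact: measurable_pos_part.
have mc (c : R) (n : nat) : measurable_fun setT (fun x => 3 * pos_part (x - c) ^+ n).
  exact: measurable_funM.
split.
- apply: measurable_funM => //.
  by apply: measurable_funB => //; apply: measurable_funD => //; exact: measurable_funB.
- apply: measurable_funM => //.
  by apply: measurable_funB => //; apply: measurable_funD => //; exact: measurable_funB.
- apply: (@measurable_funB _ _ _ _ _ (fun x => pos_part (x - 3) ^+ 1)); last exact: (mp 3 1).
  apply: (measurable_funD _ (mc 2 1)); apply: (measurable_funB _ (mc 1 1)).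
  exact: (mp0 1).
Qed.

Lemma step_taylor a h : 0 < h -> exists C f1 f2, taylor C (step a h) f1 f2.
Proof.
move=> h0; have hV : 0 < h^-1 by rewrite invr_gt0.
pose C := 5 / 2 * (1 + h^-1 + h^-1 ^+ 2 + h^-1 ^+ 3).
have h2 : 0 < h^-1 ^+ 2 by rewrite exprn_gt0.
have h3 : 0 < h^-1 ^+ 3 by rewrite exprn_gt0.
exists C, (fun x => h^-1 * spline1 ((x - a) / h)),
  (fun x => h^-1 ^+ 2 * spline2 ((x - a) / h)).
have [m0 m1 m2] := measurable_spline.
have mA := measurable_affine a h.
split.
- split; first exact: measurableT_comp.
    by apply: measurable_funM => //; exact: measurableT_comp.
  by apply: measurable_funM => //; exact: measurableT_comp.
- move=> x; have /andP[s0 s1] := step01 a h x.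
  by rewrite ger0_norm// /C; lra.
- move=> x; rewrite normrM gtr0_norm//.
  have := spline1_bound ((x - a) / h); rewrite /C; nra.
- move=> x; rewrite normrM gtr0_norm//.
  have := spline2_bound ((x - a) / h); rewrite /C; nra.
move=> x u; have := spline_taylor ((x - a) / h) (u / h).
have -> : (x - a) / h + u / h = (x + u - a) / h by field; rewrite gt_eqF.
have -> : spline1 ((x - a) / h) * (u / h) = h^-1 * spline1 ((x - a) / h) * u.
  by ring.
have -> : spline2 ((x - a) / h) / 2 * (u / h) ^+ 2 =
    h^-1 ^+ 2 * spline2 ((x - a) / h) / 2 * u ^+ 2 by ring.
move=> /le_trans; apply.
rewrite normrM (gtr0_norm hV) !exprMn.
set m := Num.min (u ^+ 2) _.
have m_ge0 : 0 <= m by rewrite le_min sqr_ge0 exprn_ge0.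
have : Num.min (u ^+ 2 * h^-1 ^+ 2) (`|u| ^+ 3 * h^-1 ^+ 3) <=
    (h^-1 ^+ 2 + h^-1 ^+ 3) * m.
  have [mE|mE] : m = u ^+ 2 \/ m = `|u| ^+ 3.
    by rewrite /m; case: leP => _; [left|right].
  - rewrite mE ge_min; apply/orP; left; rewrite mulrC ler_wpM2r ?sqr_ge0//.
    by rewrite lerDl ltW.
  - rewrite mE ge_min; apply/orP; right; rewrite mulrC ler_wpM2r ?exprn_ge0//.
    by rewrite lerDr ltW.
by rewrite /C; nra.
Qed.

(** Boundedness serves for distant points, the expansion at y for close ones. *)
Lemma taylor_lipschitz C f f1 f2 : taylor C f f1 f2 ->
  forall x y, `|f x - f y| <= 3 * C * Num.min 1 `|x - y|.
Proof.
move=> [_ fC f1C f2C T] x y; set u := x - y.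
have u0 := normr_ge0 u.
have uu : u ^+ 2 = `|u| ^+ 2 by rewrite real_normK ?num_real.
have C0 : 0 <= C by exact: le_trans (fC 0).
have [u1|u1] := leP 1 `|u|.
  rewrite mulr1; have := fC x; have := fC y; rewrite !ler_norml.
  by move=> /andP[? ?] /andP[? ?]; lra.
have := T y u; rewrite (_ : y + u = x) /u; last by ring.
rewrite -/u => Txy.
have m2 : Num.min (u ^+ 2) (`|u| ^+ 3) <= `|u|.
  by rewrite ge_min uu; apply/orP; left; rewrite expr2 ler_piMl// ltW.
have a1 : `|f1 y * u| <= C * `|u| by rewrite normrM ler_wpM2r.
have a2 : `|f2 y / 2 * u ^+ 2| <= C * `|u|.
  rewrite normrM normrM [X in _ * X * _]gtr0_norm ?invr_gt0//.
  rewrite [X in _ * X]ger0_norm ?sqr_ge0// uu.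
  have := f2C y; have := normr_ge0 (f2 y).
  have : `|u| ^+ 2 <= `|u| by rewrite expr2 ler_piMl// ltW.
  have := sqr_ge0 `|u|; nra.
have : C * Num.min (u ^+ 2) (`|u| ^+ 3) <= C * `|u| by rewrite ler_wpM2l.
move: Txy a1 a2; rewrite !ler_norml.
by move=> /andP[? ?] /andP[? ?] /andP[? ?] ?; apply/andP; split; lra.
Qed.

End spline_step.

(** * The central limit theorem by Lindeberg replacement *)

Section one_step.
Context (R : realType).
Implicit Types f g : R -> R.

(** The second-order expansion of E f(x + Y) involves only the first two
    moments of Y. *)
Lemma taylor_expectation (dT : measure_display) (T : measurableType dT)
    (Q : probability T R) (Y : T -> R) (C : R) (f f1 f2 : R -> R) (x : R) :
  taylor C f f1 f2 -> measurable_fun setT Y ->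
  rintegrable Q (fun t => Y t ^+ 2) -> \int[Q]_t Y t = 0 ->
  `|\int[Q]_t f (x + Y t) - f x - f2 x / 2 * \int[Q]_t (Y t ^+ 2)| <=
    C * \int[Q]_t Num.min (Y t ^+ 2) (`|Y t| ^+ 3).
Proof.
move=> [[mf mf1 mf2] fC f1C f2C T3] mY Y2 Y0.
have Yi := ri_of_sqr mY Y2.
have mfY : measurable_fun setT (fun t => f (x + Y t)).
  by apply: (measurableT_comp mf); exact: measurable_funD.
have fYi : rintegrable Q (fun t => f (x + Y t)) by exact: (@ri_bounded _ _ _ Q C).
have mmin : measurable_fun setT (fun t => Num.min (Y t ^+ 2) (`|Y t| ^+ 3)).
  apply: measurable_minr; first exact: measurable_funX.
  by apply: measurable_funX; exact: measurableT_comp.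
have mini : rintegrable Q (fun t => Num.min (Y t ^+ 2) (`|Y t| ^+ 3)).
  apply: (ri_le mmin Y2) => t.
  by rewrite ger0_norm ?ge_min ?lexx// le_min sqr_ge0 exprn_ge0.
have E : \int[Q]_t f (x + Y t) - f x - f2 x / 2 * \int[Q]_t (Y t ^+ 2) =
    \int[Q]_t (f (x + Y t) - (f x + (f1 x * Y t + f2 x / 2 * Y t ^+ 2))).
  rewrite RintB//; last first.
    by apply: riD; [exact: ri_cst|apply: riD; exact: riZ].
  rewrite RintD; [|exact: ri_cst|by apply: riD; exact: riZ].
  rewrite RintD; [|exact: riZ|exact: riZ].
  by rewrite Rint_cst !RintZ// Y0; ring.
rewrite E; apply: le_trans (normr_Rint_le _) _.
  by apply: riB => //; apply: riD; [exact: ri_cst|apply: riD; exact: riZ].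
rewrite -RintZ//; apply: ler_Rint.
- apply: ri_abs.
  by apply: riB => //; apply: riD; [exact: ri_cst|apply: riD; exact: riZ].
- exact: riZ.
by move=> t; have := T3 x (Y t); congr (`|_| <= _); ring.
Qed.

(** Differentiation under the integral sign, in its integrated form. *)
Lemma taylor_smoothing (Q : probability (measurableTypeR R) R) (C : R) (f f1 f2 : R -> R) :
  taylor C f f1 f2 ->
  taylor C (fun x => \int[Q]_z f (x + z)) (fun x => \int[Q]_z f1 (x + z))
    (fun x => \int[Q]_z f2 (x + z)).
Proof.
move=> [[mf mf1 mf2] fC f1C f2C T3].
have mD g (x : R) : measurable_fun setT g ->
    measurable_fun setT (fun z : R => g (x + z)).
  by move=> mg; apply: (measurableT_comp mg); exact: measurable_funD.
have gi g (x : R) : measurable_fun setT g -> (forall x, `|g x| <= C) ->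
    rintegrable Q (fun z : R => g (x + z)).
  by move=> mg gC; apply: (@ri_bounded _ _ _ Q C) => //; exact: mD.
have mI g : measurable_fun setT g -> (forall x, `|g x| <= C) ->
    measurable_fun setT (fun x : R => \int[Q]_z g (x + z)).
  move=> mg gC.
  have h : rintegrable (Q \x Q)%E
      (fun p : measurableTypeR R * measurableTypeR R => g (p.1 + p.2)).
    apply: (@ri_bounded _ _ _ (Q \x Q)%E C) => //.
    exact: (measurableT_comp mg (@measurable_plus R)).
  exact: ri_measurable (ri_fubini h).
have Ib g (x : R) : measurable_fun setT g -> (forall x, `|g x| <= C) ->
    `|\int[Q]_z g (x + z)| <= C.
  move=> mg gC; apply: le_trans (normr_Rint_le (gi g x mg gC)) _.
  rewrite -[leRHS](Rint_cst Q); apply: ler_Rint => //; last exact: ri_cst.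
  exact/ri_abs/gi.
split.
- by split; exact: mI.
- by move=> x; exact: Ib.
- by move=> x; exact: Ib.
- by move=> x; exact: Ib.
move=> x u.
have i0 := gi f x mf fC. have iu := gi f (x + u) mf fC.
have i1 := gi f1 x mf1 f1C. have i2 := gi f2 x mf2 f2C.
have E : \int[Q]_z f (x + u + z) - \int[Q]_z f (x + z) -
    \int[Q]_z f1 (x + z) * u - (\int[Q]_z f2 (x + z)) / 2 * u ^+ 2 =
    \int[Q]_z (f (x + u + z) - (f (x + z) +
      (u * f1 (x + z) + u ^+ 2 / 2 * f2 (x + z)))).
  rewrite RintB//; last by apply: riD => //; apply: riD; exact: riZ.
  rewrite RintD//; last by apply: riD; exact: riZ.
  rewrite RintD; [|exact: riZ|exact: riZ].
  by rewrite !RintZ//; ring.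
have ri_ : rintegrable Q (fun z => f (x + u + z) - (f (x + z) +
      (u * f1 (x + z) + u ^+ 2 / 2 * f2 (x + z)))).
  by apply: riB => //; apply: riD => //; apply: riD; exact: riZ.
rewrite E; apply: le_trans (normr_Rint_le ri_) _.
rewrite -[leRHS](Rint_cst Q); apply: ler_Rint; [exact: ri_abs|exact: ri_cst|].
move=> z; have := T3 (x + z) u; rewrite (addrAC x z u).
by congr (`|_| <= _); ring.
Qed.

End one_step.

Section central_limit.
Context (R : realType) (K : nat) (d : 'I_K -> measure_display).
Context (S : forall k, measurableType (d k)).
Variable mu_ : forall k, probability (S k) R.
Let mu := prod_prob mu_.
Variable h : prodT S -> R.
Hypothesis mh : measurable_fun setT h.
Hypothesis h2 : rintegrable mu (fun x => h x ^+ 2).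
Hypothesis h0 : \int[mu]_x h x = 0.
Let v := \int[mu]_x (h x ^+ 2).
Let v0 : 0 <= v. Proof. by apply: Rintegral_ge0 => x _; exact: sqr_ge0. Qed.
Local Notation nu n := (array_prob mu_ n).
Local Notation gauss v := (gaussian (0 : R) v).

(** Splits off the first sample. *)
Lemma array_fubini n (F : array S n.+1 -> R) c : measurable_fun setT F ->
  (forall y, `|F y| <= c) ->
  \int[nu n.+1]_y F y =
  \int[nu n]_y \int[mu]_t F (@Defs.glue n.+1 _ (fun=> prodT S) ord0 (t, y)).
Proof.
move=> mF Fc.
have lawg : has_law (mu \x nu n)%E (@Defs.glue n.+1 _ (fun=> prodT S) ord0) (nu n.+1).
  exact: (@law_glue R n.+1 _ (fun=> prodT S) (fun=> mu) ord0).
rewrite -(law_Rint lawg mF).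
have Fi : rintegrable (mu \x nu n)%E (fun p => F (@Defs.glue n.+1 _ (fun=> prodT S) ord0 p)).
  apply: (@ri_bounded _ _ _ (mu \x nu n)%E c) => //.
  exact: (measurableT_comp mF lawg.1).
exact: esym (Rint_fubini21 Fi).
Qed.

Definition scaled_sum (c : R) n (y : array S n) : R := \sum_(i < n) c * h (y i).

Lemma measurable_scaled_sum c n : measurable_fun setT (@scaled_sum c n).
Proof.
apply: measurable_sum => i; apply: measurable_funM => //.
apply: (measurableT_comp mh); exact: (@measurable_coord _ _ (fun=> prodT S)).
Qed.

Lemma scaled_sum_glue c n t (y : array S n) :
  scaled_sum c (@Defs.glue n.+1 _ (fun=> prodT S) ord0 (t, y)) =
  scaled_sum c y + c * h t.
Proof.
rewrite /scaled_sum big_ord_recl addrC glue_self; congr (_ + _).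
by apply: eq_bigr => i _; rewrite glue_lift.
Qed.

(** c h(s) and a centred Gaussian of the same variance t have the same first two
    moments, so that their expansions differ by the remainders only. *)
Lemma lindeberg_swap (c t C : R) (f f1 f2 : R -> R) (x : R) :
  c ^+ 2 * v = t -> taylor C f f1 f2 ->
  `|\int[mu]_s f (x + c * h s) - \int[gauss t]_z f (x + z)| <=
  C * (\int[mu]_s Num.min ((c * h s) ^+ 2) (`|c * h s| ^+ 3) +
       29 * Num.sqrt t ^+ 3).
Proof.
move=> cvt T; have t0 : 0 <= t by rewrite -cvt mulr_ge0// sqr_ge0.
have C0 : 0 <= C by case: T => _ fC _ _ _; exact: le_trans (fC 0).
have hi := ri_of_sqr mh h2.
have mch : measurable_fun setT (fun s => c * h s) by exact: measurable_funM.
have ch2 : rintegrable mu (fun s => (c * h s) ^+ 2) by exact: ri_sqrZ.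
have ch0 : \int[mu]_s (c * h s) = 0 by rewrite RintZ// h0 mulr0.
have chv : \int[mu]_s ((c * h s) ^+ 2) = t.
  rewrite -cvt /v -RintZ//.
  by apply: eq_Rintegral => s _; rewrite exprMn.
have T1 := taylor_expectation x T mch ch2 ch0.
have T2 := @taylor_expectation R _ (measurableTypeR R) (gauss t) (fun z => z)
  C f f1 f2 x T (@measurable_id _ _ setT) (ri_gauss_sqr t0) (gauss_mean t0).
rewrite chv in T1; rewrite (gauss_sqr t0) in T2.
have cube : \int[gauss t]_z Num.min (z ^+ 2) (`|z| ^+ 3) <= 29 * Num.sqrt t ^+ 3.
  apply: le_trans (gauss_cube t0); apply: ler_Rint; last 2 first.
  - exact: ri_gauss_cube.
  - by move=> z; rewrite ge_min lexx orbT.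
  apply: (ri_le _ (ri_gauss_cube t0)).
    apply: measurable_minr; first exact: measurable_funX.
    by apply: measurable_funX; exact: normr_measurable.
  by move=> z; rewrite ger0_norm ?ge_min ?lexx ?orbT// le_min sqr_ge0 exprn_ge0.
have {}T2 := le_trans T2 (ler_wpM2l C0 cube).
set A := \int[mu]_s _ in T1 *; set B := \int[gauss t]_z f (x + z) in T2 *.
have -> : A - B = (A - f x - f2 x / 2 * t) - (B - f x - f2 x / 2 * t) by ring.
by rewrite mulrDr; apply: le_trans (ler_normB _ _) _; exact: lerD.
Qed.

(** One summand at a time is replaced by a Gaussian of variance t.  The Gaussian
    part of the sum is integrated first: G i is the test function convolved with
    the law of i Gaussian summands, and it satisfies the same Taylor estimate as
    g.  The intermediate expectations are a j, with j original
    summands left.  The variance of i Gaussian summands is tau i. *)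
Lemma lindeberg_telescope (c t C : R) (g g1 g2 : R -> R) (tau : nat -> R)
    (n : nat) :
  tau 0%N = 0 -> (forall i, tau i.+1 = t + tau i) ->
  c ^+ 2 * v = t -> taylor C g g1 g2 ->
  `|\int[nu n]_y g (scaled_sum c y) - \int[gauss (tau n)]_z g z| <=
  n%:R * (C * (\int[mu]_s Num.min ((c * h s) ^+ 2) (`|c * h s| ^+ 3) +
       29 * Num.sqrt t ^+ 3)).
Proof.
move=> tau0 tauS cvt T; have t0 : 0 <= t by rewrite -cvt mulr_ge0// sqr_ge0.
have tau_ge0 i : 0 <= tau i by elim: i => [|i IH]; rewrite ?tau0// tauS addr_ge0.
set delta := C * _.
have [[mg _ _] gC _ _ _] := T.
pose G i (x : R) := \int[gauss (tau i)]_z g (x + z).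
have TG i : taylor C (G i) (fun x => \int[gauss (tau i)]_z g1 (x + z))
    (fun x => \int[gauss (tau i)]_z g2 (x + z)) by exact: taylor_smoothing.
have mG i : measurable_fun setT (G i) by case: (TG i) => -[].
have GC i x : `|G i x| <= C by case: (TG i).
have GS i x : G i.+1 x = \int[gauss t]_z G i (x + z).
  have mgx : measurable_fun setT (fun z : R => g (x + z)).
    by apply: (measurableT_comp mg); exact: measurable_funD.
  rewrite /G tauS.
  apply: etrans (esym (gauss_convolution t0 (tau_ge0 i) mgx (fun z => gC (x + z)))) _.
  by apply: eq_Rintegral => z _; apply: eq_Rintegral => z' _; rewrite addrA.
pose a j := \int[nu j]_y G (n - j)%N (scaled_sum c y).
have mGS i m : measurable_fun setT (fun y => G i (@scaled_sum c m y)).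
  by apply: (measurableT_comp (mG i)); exact: measurable_scaled_sum.
have aS j : (j < n)%N -> `|a j.+1 - a j| <= delta.
  move=> jn; rewrite /a -[in X in _ - X]subnSK//; set i := (n - j.+1)%N.
  rewrite (array_fubini (mGS i j.+1) (fun y => GC i _)).
  have Fi : rintegrable (nu j \x mu)%E (fun p => G i (scaled_sum c p.1 + c * h p.2)).
    apply: (@ri_bounded _ _ _ (nu j \x mu)%E C) => //.
    apply: (measurableT_comp (mG i)); apply: measurable_funD.
      exact: (measurableT_comp (@measurable_scaled_sum c j) measurable_fst).
    apply: measurable_funM => //; exact: (measurableT_comp mh measurable_snd).
  have i1 : rintegrable (nu j) (fun y => \int[mu]_s G i (scaled_sum c y + c * h s)).
    exact: ri_fubini Fi.
  have i2 : rintegrable (nu j) (fun y => G i.+1 (scaled_sum c y)).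
    by apply: (@ri_bounded _ _ _ (nu j) C).
  under eq_Rintegral do under eq_Rintegral do rewrite scaled_sum_glue.
  rewrite -RintB//; apply: le_trans (normr_Rint_le (riB i1 i2)) _.
  rewrite -[leRHS](Rint_cst (nu j)); apply: ler_Rint; [exact/ri_abs/riB|exact: ri_cst|].
  by move=> y; rewrite GS; exact: (lindeberg_swap _ cvt (TG i)).
have -> : \int[nu n]_y g (scaled_sum c y) = a n.
  apply: eq_Rintegral => y _; rewrite subnn /G tau0 gauss0_Rint ?addr0//.
  by apply: (measurableT_comp mg); exact: measurable_funD.
have -> : \int[gauss (tau n)]_z g z = a 0%N.
  rewrite -[LHS](Rint_cst (nu 0)); apply: eq_Rintegral => y _.
  rewrite subn0 /scaled_sum big_ord0 /G.
  by apply: eq_Rintegral => z _; rewrite add0r.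
rewrite -(telescope_sumr a (leq0n n)); apply: le_trans (ler_norm_sum _ _ _) _.
rewrite big_mkord mulr_natl -[X in _ *+ X](card_ord n) -sumr_const.
by apply: ler_sum => j _; exact: aS.
Qed.

Context (dO : measure_display) (Omega : measurableType dO).
Variables (P : probability Omega R) (X : nat -> {RV P >-> prodT S}).
Hypothesis iidX : iid mu X.

(** Take t = v / N, c = 1 / sqrt N.  The N replacement errors add up to
    E min(h^2, |h|^3 / sqrt N) + O(1 / sqrt N), and the expectation tends to 0 by
    dominated convergence since h^2 is integrable. *)
Lemma clt_taylor (C : R) (g g1 g2 : R -> R) : taylor C g g1 g2 ->
  (fun N => \int[P]_omega g (Num.sqrt N%:R * emp_mean N h (X^~ omega)))
    @ \oo --> \int[gauss v]_z g z.
Proof.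
move=> T; have [[mg _ _] _ _ _ _] := T.
pose c (N : nat) : R := (Num.sqrt N%:R)^-1.
pose b1 (N : nat) := \int[mu]_s Num.min (h s ^+ 2) (`|h s| ^+ 3 * c N).
pose err (N : nat) := C * (b1 N + 29 * Num.sqrt v ^+ 3 * c N).
have cN2 N : (0 < N)%N -> N%:R * c N ^+ 2 = 1.
  by move=> N0; rewrite /c exprVn sqr_sqrtr// mulfV// pnatr_eq0 -lt0n.
have c_ge0 N : 0 <= c N by rewrite /c invr_ge0 sqrtr_ge0.
have c0 : c @ \oo --> 0.
  apply/cvgrPdist_le => e e0.
  have e2 : 0 < e ^+ 2 by rewrite exprn_gt0.
  have := @cvg_harmonic R => /cvgrPdist_le/(_ _ e2)[m _ mh2].
  exists m.+1 => //= -[//|N] /= mN.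
  have := mh2 N mN; rewrite /= !sub0r !normrN.
  rewrite [`|c _|]ger0_norm// ger0_norm ?invr_ge0// => hN.
  rewrite -(@ler_pXn2r _ 2) ?nnegrE ?(ltW e0) ?c_ge0//.
  by apply: le_trans hN; rewrite /c exprVn sqr_sqrtr.
have mmin N : measurable_fun setT
    (fun s => Num.min (h s ^+ 2) (`|h s| ^+ 3 * c N)).
  apply: measurable_minr; first exact: measurable_funX.
  apply: measurable_funM => //; apply: measurable_funX.
  exact: measurableT_comp.
have b10 : b1 @ \oo --> 0.
  rewrite -[X in _ --> X](Rint_cst mu 0).
  apply: (Rint_dct mmin h2) => [N s|s].
    by rewrite ger0_norm ?ge_min ?lexx// le_min sqr_ge0/= mulr_ge0.
  have lim0 : (fun N => `|h s| ^+ 3 * c N) @ \oo --> 0.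
    have := cvgMl_tmp (a := `|h s| ^+ 3) c0; rewrite mulr0; exact.
  apply: (squeeze_cvgr _ (cvg_cst 0) lim0).
  apply: nearW => N; rewrite ge_min lexx orbT andbT.
  by rewrite le_min sqr_ge0/= mulr_ge0.
have err0 : err @ \oo --> 0.
  have := cvgMl_tmp (a := C) (cvgD b10 (cvgMl_tmp (a := 29 * Num.sqrt v ^+ 3) c0)).
  rewrite mulr0 addr0 mulr0; exact.
have bound N : (0 < N)%N ->
    `|\int[P]_omega g (Num.sqrt N%:R * emp_mean N h (X^~ omega)) -
      \int[gauss v]_z g z| <= err N.
  move=> N0.
  have NR : 0 < N%:R :> R by rewrite ltr0n.
  have lawX := @law_entries _ _ _ _ mu_ _ _ P X iidX N (fun i _ => i)
    (fun k i j e => val_inj e).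
  have -> : \int[P]_omega g (Num.sqrt N%:R * emp_mean N h (X^~ omega)) =
      \int[nu N]_y g (scaled_sum (c N) y).
    rewrite -(law_Rint lawX); last first.
      by apply: (measurableT_comp mg); exact: measurable_scaled_sum.
    apply: eq_Rintegral => omega _; congr (g _).
    rewrite /emp_mean /scaled_sum -mulr_sumr mulrA; congr (_ * _).
    have sN : Num.sqrt N%:R != 0 :> R by rewrite gt_eqF// sqrtr_gt0.
    rewrite /c -[X in _ / X](@sqr_sqrtr _ N%:R)//.
    by field.
  have cvt : c N ^+ 2 * v = v / N%:R.
    by rewrite /c exprVn sqr_sqrtr// mulrC.
  have := lindeberg_telescope (tau := fun i => i%:R * (v / N%:R)) N (mul0r _) _ cvt T.
  have -> : N%:R * (v / N%:R) = v by field; rewrite gt_eqF.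
  have tauS i : i.+1%:R * (v / N%:R) = v / N%:R + i%:R * (v / N%:R).
    by rewrite -[i.+1]add1n natrD mulrDl mul1r.
  move=> /(_ tauS).
  move=> /le_trans; apply.
  rewrite le_eqVlt; apply/orP; left; apply/eqP.
  rewrite /err mulrCA; congr (_ * _); rewrite mulrDr; congr (_ + _).
    rewrite -RintZ; last first.
      have ch2 : rintegrable mu (fun s => (c N * h s) ^+ 2) by exact: ri_sqrZ.
      apply: (ri_le _ ch2) => [|s].
        apply: measurable_minr; first by apply: measurable_funX; exact: measurable_funM.
        apply: measurable_funX; apply: measurableT_comp => //; exact: measurable_funM.
      by rewrite ger0_norm ?ge_min ?lexx// le_min sqr_ge0 exprn_ge0.
    apply: eq_Rintegral => s _.
    rewrite minr_pMr ?ltW// !exprMn normrM (ger0_norm (c_ge0 N)) !exprMn.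
    congr Num.min; first by rewrite mulrA cN2// mul1r.
    have -> : N%:R * (c N ^+ 3 * `|h s| ^+ 3) =
        `|h s| ^+ 3 * c N * (N%:R * c N ^+ 2) by ring.
    by rewrite cN2// mulr1.
  rewrite sqrtrM// exprMn sqrtrV// -/(c N).
  have -> : N%:R * (29 * (Num.sqrt v ^+ 3 * c N ^+ 3)) =
      29 * Num.sqrt v ^+ 3 * c N * (N%:R * c N ^+ 2) by ring.
  by rewrite cN2// mulr1.
apply/cvgrPdist_le => e e0; have := err0 => /cvgrPdist_le/(_ _ e0) errN.
near=> N; rewrite distrC; apply: le_trans (bound N _) _.
  by near: N; exists 1%N.
have : `|0 - err N| <= e by near: N.
by rewrite sub0r normrN; exact: le_trans (ler_norm _).
Unshelve. all: by end_near. Qed.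

End central_limit.

(** * Approximating continuous functions by staircases *)

Section step_approximation.
Context (R : realType).
Implicit Types f : R -> R.

(** Uniform continuity on a segment, where only one of the two points has to lie
    in the segment. *)
Lemma uniform_continuity_segment f (a b eps : R) : continuous f -> 0 < eps ->
  exists2 n : nat, (0 < n)%N &
    forall x y, a <= x <= b -> `|x - y| <= n%:R^-1 -> `|f x - f y| <= eps.
Proof.
move=> cf e0.
have := (compact_near_coveringP `[a, b]).1 (@segment_compact R a b).
move=> /(_ nat \oo (fun n x => forall y, `|x - y| <= n.+1%:R^-1 -> `|f x - f y| <= eps) _).
case=> [x _|n _ hn].
  have e2 : 0 < eps / 2 by rewrite divr_gt0.
  have /cvgrPdist_le/(_ _ e2)/nbhs_ballP[r /= r0 fr] := cf x.
  have r2 : 0 < r / 2 by rewrite divr_gt0.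
  have [m _ mr] : \forall n \near \oo, `|0 - (n.+1%:R : R)^-1| <= r / 4.
    have r4 : 0 < r / 4 by rewrite divr_gt0.
    by have /cvgrPdist_le/(_ _ r4) := @cvg_harmonic R.
  exists (ball x (r / 2), [set n | (m <= n)%N]).
    by split; [exact: nbhsx_ballx|exists m].
  move=> [x' n] /= [xx' mn] y x'y.
  have := mr n mn; rewrite sub0r normrN ger0_norm// => nr.
  have bx' : ball x r x' by move: xx'; rewrite /ball /=; lra.
  have bxy : ball x r y.
    move: xx'; rewrite /ball /= => xx'.
    have -> : x - y = (x - x') + (x' - y) by ring.
    have d4 : `|x' - y| <= r / 4 by exact: le_trans x'y nr.
    have d2 : `|x - x'| < r / 2 by exact: xx'.
    by apply: le_lt_trans (ler_normD _ _) _; lra.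
  have h1 := fr _ bx'; have h2 := fr _ bxy.
  have -> : f x' - f y = (f x - f y) - (f x - f x') by ring.
  by apply: le_trans (ler_normB _ _) _; lra.
exists n.+1 => // x y xab; apply: (hn n) => //=.
Qed.

(** f is interpolated at the n + 1 points a + i delta by steps of width delta: on each
    interval between consecutive points exactly one step is under way (a step of parameter h takes length 3 h). *)
Definition staircase f (a delta : R) (n : nat) (x : R) : R :=
  f a + \sum_(i < n) (f (a + i.+1%:R * delta) - f (a + i%:R * delta)) *
                     step (a + i%:R * delta) (delta / 3) x.

Section staircase.
Variables (f : R -> R) (a delta eps : R).
Hypothesis delta0 : 0 < delta.
Local Notation grid i := (a + i%:R * delta).

Let step_lo i x : x <= grid i -> step (grid i) (delta / 3) x = 0.
Proof.
move=> xi; rewrite /step spline_le0// pmulr_lle0 ?subr_le0//.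
by rewrite invr_gt0 divr_gt0.
Qed.

Let step_hi i x : grid i.+1 <= x -> step (grid i) (delta / 3) x = 1.
Proof.
move=> xi; rewrite /step spline_ge3// ler_pdivlMr ?divr_gt0//.
have -> : 3 * (delta / 3) = delta by field.
by move: xi; rewrite -addn1 natrD mulrDl mul1r; lra.
Qed.

Let grid_mono i j : (i <= j)%N -> grid i <= grid j.
Proof. by move=> ij; rewrite lerD2l ler_wpM2r ?(ltW delta0)// ler_nat. Qed.

Lemma staircase_left n x : x <= a -> staircase f a delta n x = f a.
Proof.
move=> xa; rewrite /staircase big1 ?addr0// => i _; rewrite step_lo ?mulr0//.
by apply: le_trans xa _; rewrite lerDl mulr_ge0// ltW.
Qed.

Lemma staircase_right n x : grid n <= x -> staircase f a delta n x = f (grid n).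
Proof.
elim: n => [|n IH] xn; first by rewrite /staircase big_ord0 mul0r !addr0.
have xn' : grid n <= x by apply: le_trans xn; exact: grid_mono.
rewrite /staircase big_ord_recr/= addrA -/(staircase f a delta n x) IH//.
by rewrite step_hi// mulr1 addrC subrK.
Qed.

Lemma staircase_approx n x :
  (forall x y, a <= x <= grid n -> `|x - y| <= delta -> `|f x - f y| <= eps) ->
  a <= x <= grid n -> `|f x - staircase f a delta n x| <= 2 * eps.
Proof.
move=> fu /andP[ax]; elim: n fu => [|n IH] fu xn.
  have -> : x = a by apply/eqP; rewrite eq_le ax andbT; move: xn; rewrite mul0r addr0.
  rewrite staircase_left// subrr normr0.
  have : `|f a - f a| <= eps.
    by apply: fu; [rewrite mul0r addr0 lexx|rewrite subrr normr0 ltW].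
  by rewrite subrr normr0 => e0; rewrite mulr_ge0.
rewrite /staircase big_ord_recr/= addrA -/(staircase f a delta n x).
have gn : grid n.+1 = grid n + delta by rewrite -addn1 natrD; ring.
have [xle|xgt] := leP x (grid n).
  rewrite step_lo// mulr0 addr0; apply: IH => // y z /andP[ay yn]; apply: fu.
  by rewrite ay/= (le_trans yn)// grid_mono.
rewrite staircase_right ?(ltW xgt)//.
have an : a <= grid n by rewrite lerDl mulr_ge0// ltW.
have s01 := step01 (grid n) (delta / 3) x.
set s := step _ _ _ in s01 *; have /andP[s0 s1] := s01.
have h1 : `|f x - f (grid n)| <= eps.
  by apply: fu; [rewrite ax xn|rewrite ger0_norm; lra].
have h2 : `|f (grid n.+1) - f (grid n)| <= eps.
  by apply: fu; [rewrite (le_trans ax xn) lexx|rewrite ger0_norm; lra].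
have -> : f x - (f (grid n) + (f (grid n.+1) - f (grid n)) * s) =
  (f x - f (grid n)) - (f (grid n.+1) - f (grid n)) * s by ring.
apply: le_trans (ler_normB _ _) _.
have -> : 2 * eps = eps + eps by ring.
apply: lerD => //.
rewrite normrM (ger0_norm s0); apply: le_trans h2.
by rewrite ler_piMr.
Qed.

End staircase.

(** A smooth version of the indicator of [-M, M], made of two steps so that
    convergence on steps controls the mass outside. *)
Definition window (M : R) x : R := step (- M - 1) 3^-1 x - step M 3^-1 x.

Lemma window01 M x : 0 <= M -> 0 <= window M x <= 1.
Proof.
move=> M0; rewrite /window.
have /andP[a0 a1] := step01 (- M - 1) 3^-1 x; have /andP[b0 b1] := step01 M 3^-1 x.
have [xM|xM] := leP x M.
  have -> : step M 3^-1 x = 0.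
    by rewrite /step spline_le0// pmulr_lle0 ?subr_le0// invr_gt0.
  by lra.
have -> : step (- M - 1) 3^-1 x = 1.
  by rewrite /step spline_ge3// invrK; lra.
by lra.
Qed.

Lemma window_inside M x : `|x| <= M -> window M x = 1.
Proof.
rewrite ler_norml => /andP[Mx xM]; rewrite /window /step spline_ge3; last first.
  by rewrite invrK; lra.
by rewrite spline_le0 ?subr0// invrK; lra.
Qed.

Lemma window_outside M x : 0 <= M -> M + 1 <= `|x| -> window M x = 0.
Proof.
move=> M0; rewrite ler_normr => /orP[Mx|Mx]; rewrite /window /step.
  by rewrite !spline_ge3 ?subrr// invrK; lra.
by rewrite !spline_le0 ?subrr// invrK; lra.
Qed.

Lemma measurable_step a h : measurable_fun setT (@step R a h).
Proof.
by apply: measurableT_comp; [case: (@measurable_spline R)|exact: measurable_affine].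
Qed.

Lemma measurable_window M : measurable_fun setT (window M).
Proof. by apply: measurable_funB; exact: measurable_step. Qed.

Lemma measurable_staircase f a delta n : measurable_fun setT (staircase f a delta n).
Proof.
apply: measurable_funD => //; apply: measurable_sum => i.
by apply: measurable_funM => //; exact: measurable_step.
Qed.

End step_approximation.

(** * Convergence in distribution from smooth steps *)

Section convergence_in_distribution.
Context (R : realType) (dO : measure_display) (Omega : measurableType dO).
Variable P : probability Omega R.
Variable nu : probability (measurableTypeR R) R.
Implicit Types (Z A : nat -> Omega -> R).

(** Convergence of expectations, tested on smooth steps only. *)
Definition step_cvg Z := forall a h : R, 0 < h ->
  (fun N => \int[P]_omega step a h (Z N omega)) @ \oo --> \int[nu]_x step a h x.

Section portmanteau.
Variable Z : nat -> Omega -> R.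
Hypothesis mZ : forall N, measurable_fun setT (Z N).
Hypothesis sZ : step_cvg Z.

Let riP (g : R -> R) c N : measurable_fun setT g -> (forall x, `|g x| <= c) ->
  rintegrable P (fun omega => g (Z N omega)).
Proof.
move=> mg gc; apply: (@ri_bounded _ _ _ P c) => //.
exact: (measurableT_comp mg (mZ N)).
Qed.

Let rinu (g : R -> R) c : measurable_fun setT g -> (forall x, `|g x| <= c) ->
  rintegrable nu g.
Proof. by move=> mg gc; exact: (@ri_bounded _ _ _ nu c). Qed.

Let step1 (a h x : R) : `|step a h x| <= 1.
Proof. by have /andP[s0 s1] := step01 a h x; rewrite ger0_norm. Qed.

Lemma staircase_cvg (f : R -> R) (a delta : R) n : 0 < delta ->
  (fun N => \int[P]_omega staircase f a delta n (Z N omega)) @ \oo -->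
    \int[nu]_x staircase f a delta n x.
Proof.
move=> delta0; have d3 : 0 < delta / 3 by rewrite divr_gt0.
pose s (i : 'I_n) x := step (a + i%:R * delta) (delta / 3) x.
pose w (i : 'I_n) := f (a + i.+1%:R * delta) - f (a + i%:R * delta).
have E N : \int[P]_omega staircase f a delta n (Z N omega) =
    f a + \sum_(i < n) w i * \int[P]_omega s i (Z N omega).
  have si i := riP N (measurable_step _ _) (step1 (a + i%:R * delta) (delta / 3)).
  have wi i : rintegrable P (fun omega => w i * s i (Z N omega)) by exact: riZ (si i).
  transitivity (\int[P]_omega (f a + \sum_(i < n) w i * s i (Z N omega))) => //.
  rewrite RintD; [|exact: ri_cst|exact: ri_sum].
  rewrite Rint_cst Rint_sum//.
  by congr (_ + _); apply: eq_bigr => i _; exact: RintZ (si i).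
have -> : \int[nu]_x staircase f a delta n x =
    f a + \sum_(i < n) w i * \int[nu]_x s i x.
  have si i := rinu (measurable_step _ _) (step1 (a + i%:R * delta) (delta / 3)).
  have wi i : rintegrable nu (fun x => w i * s i x) by exact: riZ (si i).
  transitivity (\int[nu]_x (f a + \sum_(i < n) w i * s i x)) => //.
  rewrite RintD; [|exact: ri_cst|exact: ri_sum].
  rewrite Rint_cst Rint_sum//.
  by congr (_ + _); apply: eq_bigr => i _; exact: RintZ (si i).
under eq_fun do rewrite E.
apply: cvgD; first exact: cvg_cst.
apply: cvg_big => [|i _]; last by apply: cvgMl_tmp; exact: sZ.
exact: add_continuous.
Qed.

Lemma window_cvg M : 
  (fun N => \int[P]_omega (1 - window M (Z N omega))) @ \oo -->
    \int[nu]_x (1 - window M x).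
Proof.
have h3 : 0 < (3^-1 : R) by rewrite invr_gt0.
have E N : \int[P]_omega (1 - window M (Z N omega)) =
    1 - (\int[P]_omega step (- M - 1) 3^-1 (Z N omega) -
         \int[P]_omega step M 3^-1 (Z N omega)).
  have si a := riP N (measurable_step _ _) (step1 a 3^-1).
  rewrite RintB; [|exact: ri_cst|exact: riB].
  by rewrite Rint_cst RintB.
have -> : \int[nu]_x (1 - window M x) =
    1 - (\int[nu]_x step (- M - 1) 3^-1 x - \int[nu]_x step M 3^-1 x).
  have si a := rinu (measurable_step _ _) (step1 a 3^-1).
  rewrite RintB; [|exact: ri_cst|exact: riB].
  by rewrite Rint_cst RintB.
under eq_fun do rewrite E.
apply: cvgB; first exact: cvg_cst.
by apply: cvgB; exact: sZ.
Qed.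

(** The window tends to 1 pointwise. *)
Lemma tight eps : 0 < eps -> exists M : nat, \int[nu]_x (1 - window M%:R x) <= eps.
Proof.
move=> e0.
have h : (fun M : nat => \int[nu]_x (1 - window M%:R x)) @ \oo --> 0.
  rewrite -[X in _ --> X](Rint_cst nu 0).
  apply: (@Rint_dct _ _ _ nu _ _ (fun=> 1)) => [M||M x|x].
  - by apply: measurable_funB => //; exact: measurable_window.
  - exact: ri_cst.
  - have /andP[w0 w1] := window01 x (ler0n R M).
    by rewrite ger0_norm ?subr_ge0// gerBl.
  apply: cvg_near_cst; near=> M; rewrite window_inside ?subrr//.
  by near: M; exact: nbhs_infty_ger.
have /cvgrPdist_le/(_ _ e0)[M _ /(_ M (leqnn M))/=] := h.
rewrite sub0r normrN => hM; exists M.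
exact: le_trans (ler_norm _) hM.
Unshelve. all: by end_near. Qed.

(** The staircase runs over [-M-1, M+1], which has 2M + 2 units of n cells each, and
    is constant beyond; there the error is
    bounded by 2B, which is charged to 1 - window. *)
Lemma staircase_window (f : R -> R) (B eps : R) (M n : nat) :
  (forall x, `|f x| <= B) -> 0 <= eps -> (0 < n)%N ->
  (forall x y, - M%:R - 1 <= x <= M%:R + 1 -> `|x - y| <= n%:R^-1 ->
    `|f x - f y| <= eps) ->
  let g := staircase f (- M%:R - 1) n%:R^-1 ((2 * M + 2) * n) in
  forall x, `|f x - g x| <= 2 * eps + 2 * B * (1 - window M%:R x).
Proof.
move=> fB eps0 n0 fu g x.
have n0R : 0 < n%:R :> R by rewrite ltr0n.
have delta0 : 0 < n%:R^-1 :> R by rewrite invr_gt0.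
have B0 : 0 <= B by exact: le_trans (fB 0).
have gridE : - M%:R - 1 + ((2 * M + 2) * n)%:R * n%:R^-1 = M%:R + 1 :> R.
  by rewrite natrM mulfK ?gt_eqF// natrD natrM; ring.
have /andP[w0 w1] := window01 x (ler0n R M).
have outside y : M%:R + 1 <= `|x| -> g x = f y ->
    `|f x - g x| <= 2 * eps + 2 * B * (1 - window M%:R x).
  move=> xM ->; rewrite window_outside// subr0 mulr1.
  apply: le_trans (ler_normB _ _) _.
  by have := fB x; have := fB y; lra.
have [xa|ax] := leP x (- M%:R - 1).
  apply: (outside (- M%:R - 1)); last exact: staircase_left.
  by rewrite ler_normr; apply/orP; right; lra.
have [bx|xb] := leP (M%:R + 1) x.
  apply: (outside (M%:R + 1)); first by rewrite ler_normr bx.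
  by rewrite /g staircase_right ?gridE.
apply: (@le_trans _ _ (2 * eps)).
  apply: staircase_approx => //; first by rewrite gridE.
  by rewrite gridE (ltW ax) (ltW xb).
by rewrite lerDl !mulr_ge0// subr_ge0.
Qed.

(** A continuous f is replaced by a staircase, a finite combination of steps.  The
    error is small except for the mass outside the window, which is small under
    nu by tightness, hence also under the law of Z N for large N since
    the window is a difference of two steps. *)
Theorem portmanteau : cvg_in_distribution P Z nu.
Proof.
split=> // f cf bf.
have mf : measurable_fun setT f by exact: continuous_measurable_fun.
have [B B0 fB] : exists2 B, 0 < B & forall x, `|f x| <= B.
  case: bf => B [_ fB]; exists (Num.max B 0 + 1).
    by rewrite ltr_wpDl// le_max lexx orbT.
  move=> x; apply: fB => //; apply: le_lt_trans (_ : Num.max B 0 < _).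
    by rewrite le_max lexx.
  by rewrite ltrDl.
apply/cvgrPdist_le => e e0.
have d0 : 0 < 6 + 6 * B by lra.
(* The errors below add up to 5 eps + 6 B eps. *)
pose eps := e / (6 + 6 * B).
have eps0 : 0 < eps by rewrite divr_gt0.
have eE : 6 * eps + 6 * B * eps = e by rewrite /eps; field; rewrite gt_eqF.
have [M tM] := tight eps0.
have [n n0 fu] := uniform_continuity_segment (- M%:R - 1) (M%:R + 1) cf eps0.
have := staircase_window fB (ltW eps0) n0 fu.
set g := staircase _ _ _ _ => /= fg.
have n0R : 0 < n%:R :> R by rewrite ltr0n.
have delta0 : 0 < n%:R^-1 :> R by rewrite invr_gt0.
have mg : measurable_fun setT g by exact: measurable_staircase.
have w1 (x : R) : `|1 - window M%:R x| <= 1.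
  have /andP[w0 w1] := window01 x (ler0n R M).
  by rewrite ger0_norm ?subr_ge0// gerBl.
have mw : measurable_fun setT (fun x : R => 1 - window M%:R x : R).
  by apply: measurable_funB => //; exact: measurable_window.
pose C := B + (2 * eps + 2 * B).
have gC (x : R) : `|g x| <= C.
  have -> : g x = f x - (f x - g x) by ring.
  apply: le_trans (ler_normB _ _) _; rewrite lerD//.
  apply: le_trans (fg x) _; rewrite lerD2l ler_piMr ?mulr_ge0 ?(ltW B0)//.
  by have := w1 x; exact: le_trans (ler_norm _).
have err (dT : measure_display) (T : measurableType dT) (Q : probability T R)
    (h : T -> R) : measurable_fun setT h ->
    `|\int[Q]_t f (h t) - \int[Q]_t g (h t)| <=
      2 * eps + 2 * B * \int[Q]_t (1 - window M%:R (h t)).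
  move=> mh.
  have ri (u : R -> R) c : measurable_fun setT u -> (forall x, `|u x| <= c) ->
      rintegrable Q (fun t => u (h t)).
    move=> mu uc; apply: (@ri_bounded _ _ _ Q c) => //.
    exact: (measurableT_comp mu mh).
  have fi := ri f B mf fB; have gi := ri g C mg gC.
  have wi := ri (fun x : R => 1 - window M%:R x) 1 mw w1.
  rewrite -RintB//; apply: le_trans (normr_Rint_le (riB fi gi)) _.
  rewrite -(RintZ _ wi) -[X in X + _](Rint_cst Q) -RintD; last 2 first.
  - exact: ri_cst.
  - exact: riZ.
  apply: ler_Rint => [| |t]; [exact: ri_abs (riB fi gi)| |exact: fg].
  by apply: riD; [exact: ri_cst|exact: riZ].
have /cvgrPdist_le/(_ _ eps0) gN := @staircase_cvg f (- M%:R - 1) _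
  ((2 * M + 2) * n) delta0.
have /cvgrPdist_le/(_ _ eps0) wN := @window_cvg M%:R.
near=> N.
have gN1 : `|\int[nu]_x g x - \int[P]_omega g (Z N omega)| <= eps by near: N.
have wN1 : `|\int[nu]_x (1 - window M%:R x) -
    \int[P]_omega (1 - window M%:R (Z N omega))| <= eps by near: N.
have errP := err _ _ P (Z N) (mZ N).
have errnu := err _ _ nu idfun (@measurable_id _ _ _).
have wP : \int[P]_omega (1 - window M%:R (Z N omega)) <= 2 * eps.
  by move: wN1; rewrite ler_norml => /andP[]; lra.
have BP := ler_wpM2l (ltW B0) wP; have Bnu := ler_wpM2l (ltW B0) tM.
move: errP errnu gN1 BP Bnu; rewrite !ler_norml => /andP[? ?] /andP[? ?] /andP[? ?] ? ?.
by rewrite /=; apply/andP; split; lra.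
Unshelve. all: by end_near. Qed.

End portmanteau.

(** Steps are bounded and Lipschitz, so the difference of expectations is
    dominated by E min(1, |Z - A|). *)
Lemma step_cvg_slutsky Z A :
  (forall N, measurable_fun setT (Z N)) -> (forall N, measurable_fun setT (A N)) ->
  step_cvg A ->
  (fun N => \int[P]_omega Num.min 1 `|Z N omega - A N omega|) @ \oo --> 0 ->
  step_cvg Z.
Proof.
move=> mZ mA sA ZA a h h0; have [C [f1 [f2 fT]]] := step_taylor a h0.
have lip := taylor_lipschitz fT.
have ri (Y : nat -> Omega -> R) N : measurable_fun setT (Y N) ->
    rintegrable P (fun omega => step a h (Y N omega)).
  move=> mY; apply: (@ri_bounded _ _ _ P 1) => [|omega].
    exact: (measurableT_comp (measurable_step a h) mY).
  by have /andP[s0 s1] := step01 a h (Y N omega); rewrite ger0_norm.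
have rim N : rintegrable P (fun omega => Num.min 1 `|Z N omega - A N omega|).
  apply: (@ri_bounded _ _ _ P 1) => [|omega].
    apply: measurable_minr => //; apply: measurableT_comp => //.
    exact: measurable_funB.
  by rewrite ger0_norm ?ge_min ?lexx// le_min ler01 normr_ge0.
have D0 : (fun N => \int[P]_omega step a h (Z N omega) -
    \int[P]_omega step a h (A N omega)) @ \oo --> 0.
  apply/cvgrPdist_le => e e0.
  have ZA3 : (fun N => 3 * C * \int[P]_omega Num.min 1 `|Z N omega - A N omega|)
      @ \oo --> 0.
    by have := cvgMl_tmp (a := 3 * C) ZA; rewrite mulr0; exact.
  move: ZA3 => /cvgrPdist_le/(_ _ e0); apply: filterS => N.
  rewrite !sub0r !normrN => Ne; apply: le_trans Ne.
  rewrite -RintB; [|exact: ri|exact: ri].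
  apply: le_trans (normr_Rint_le _) _; first by apply: riB; exact: ri.
  apply: le_trans (ler_norm _); rewrite -RintZ//.
  apply: ler_Rint => [| |omega]; last exact: lip.
    by apply: ri_abs; apply: riB; exact: ri.
  exact: riZ.
rewrite -[X in _ --> X]add0r.
rewrite (_ : (fun N => _) = fun N =>
  (\int[P]_omega step a h (Z N omega) - \int[P]_omega step a h (A N omega)) +
  \int[P]_omega step a h (A N omega)); last by apply/funext => N; rewrite subrK.
by apply: cvgD; [exact: D0|exact: sA].
Qed.

End convergence_in_distribution.

Local Open Scope charge_scope.

(** * Integrals against a normalized measure with a density *)

Section normalized_density.
Context (R : realType) (dT : measure_display) (T : measurableType dT).
Variables (mu : probability T R) (gamma : {finite_measure set T -> \bar R}).
Variable w : T -> R.
Hypothesis gamma0 : (0 < gamma setT)%E.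
Hypothesis gamma_mu : gamma `<< mu.
Hypothesis mw : measurable_fun setT w.
Hypothesis w_density :
  ae_eq mu setT (EFin \o w) ('d (charge_of_finite_measure gamma) '/d mu).

Let G := fine (gamma setT).
Let ppi := mnormalize gamma mu.

Let gammaE : gamma setT = G%:E.
Proof. by rewrite /G fineK// fin_num_measure. Qed.

Lemma mass_gt0 : 0 < G.
Proof. by rewrite -lte_fin -gammaE. Qed.

Let G0 : 0 < G := mass_gt0.
Let v x := Num.max (w x) 0 / G.

Let mv : measurable_fun setT v.
Proof. by apply: measurable_funM => //; exact: measurable_maxr. Qed.

Let v0 x : 0 <= v x.
Proof. by rewrite divr_ge0 ?(ltW G0)// le_max lexx orbT. Qed.

Let density_ge0 :
  {ae mu, forall x, Radon_Nikodym_SigmaFinite.f gamma mu x = (Num.max (w x) 0)%:E}.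
Proof.
have := ae_eq_Radon_Nikodym_SigmaFinite gamma_mu measurableT.
apply: filterS2 w_density => x /= wx fx.
have fw : Radon_Nikodym_SigmaFinite.f gamma mu x = (w x)%:E.
  by rewrite fx// -wx.
have := Radon_Nikodym_SigmaFinite.f_ge0 gamma_mu x.
by rewrite fw lee_fin => w0; rewrite max_l.
Qed.

Let v_ae : {ae mu, forall x, w x / G = v x}.
Proof.
have := ae_eq_Radon_Nikodym_SigmaFinite gamma_mu measurableT.
apply: filterS2 w_density => x /= wx fx.
have fw : Radon_Nikodym_SigmaFinite.f gamma mu x = (w x)%:E.
  by rewrite fx// -wx.
have := Radon_Nikodym_SigmaFinite.f_ge0 gamma_mu x.
by rewrite /v fw lee_fin => w0; rewrite max_l.
Qed.

Let ge0_integral_normalized (g : T -> R) : measurable_fun setT g ->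
  (forall x, 0 <= g x) ->
  (\int[ppi]_x (g x)%:E = \int[mu]_x (g x * v x)%:E)%E.
Proof.
move=> mg g0.
have Gi0 : 0 <= G^-1 by rewrite invr_ge0 ltW.
have mgE : measurable_fun setT (EFin \o g) by exact/measurable_EFinP.
have fi := Radon_Nikodym_SigmaFinite.f_integrable gamma_mu.
rewrite (@eq_measure_integral _ _ _ _ (mscale (NngNum Gi0) gamma)); last first.
  move=> A _ _; rewrite /= /mnormalize /mscale/= gammaE eqe gt_eqF//=.
  by rewrite muleC.
rewrite ge0_integral_mscale//=; last by move=> x _; rewrite lee_fin.
rewrite -(Radon_Nikodym_SigmaFinite.change_of_variables gamma_mu)//=.
rewrite -ge0_integralZl//; last 2 first.
- by apply: emeasurable_funM => //; exact: measurable_int fi.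
- move=> x _; rewrite mule_ge0 ?lee_fin//.
  exact: Radon_Nikodym_SigmaFinite.f_ge0.
apply: ae_eq_integral => //.
- apply: emeasurable_funM => //; apply: emeasurable_funM => //.
  exact: measurable_int fi.
- by apply/measurable_EFinP; exact: measurable_funM.
apply: filterS density_ge0 => x fx _; rewrite fx -!EFinM; congr EFin.
by rewrite /v; ring.
Qed.

(** w agrees almost everywhere with a nonnegative density of gamma; with v the
    nonnegative version of w / G, the formula holds separately for the positive
    and the negative part of f. *)
Lemma normalized_Rint f : measurable_fun setT f ->
  \int[ppi]_x f x = \int[mu]_x (w x / G * f x).
Proof.
move=> mf; rewrite (@ae_eq_Rint _ _ _ mu _ (fun x => f x * v x)); last first.
- by apply: filterS v_ae => x ->; rewrite mulrC.
- exact: measurable_funM.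
- by apply: measurable_funM => //; exact: measurable_funM.
congr fine; rewrite integralE [in RHS]integralE; congr (_ - _)%E.
  rewrite [LHS](_ : _ = \int[ppi]_x (Num.max (f x) 0)%:E)%E; last first.
    by apply: eq_integral => x _; rewrite !funeposE -EFin_max.
  rewrite ge0_integral_normalized; last 2 first.
  - exact: measurable_maxr.
  - by move=> x; rewrite le_max lexx orbT.
  by apply: eq_integral => x _; rewrite !funeposE -EFin_max maxr_pMl// mul0r.
rewrite [LHS](_ : _ = \int[ppi]_x (Num.max (- f x) 0)%:E)%E; last first.
  by apply: eq_integral => x _; rewrite !funenegE -EFinN -EFin_max.
rewrite ge0_integral_normalized; last 2 first.
- by apply: measurable_maxr => //; exact: measurableT_comp.
- by move=> x; rewrite le_max lexx orbT.
apply: eq_integral => x _.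
by rewrite !funenegE -EFinN -EFin_max maxr_pMl// mul0r mulNr.
Qed.

Lemma ri_density : rintegrable mu (fun x => w x / G).
Proof.
have vi : rintegrable mu v.
  apply/integrableP; split; first exact/measurable_EFinP.
  rewrite (_ : \int[mu]_x _ = \int[ppi]_x 1%:E)%E.
    by rewrite integral_cst//= mul1e probability_setT ltry.
  rewrite ge0_integral_normalized//; apply: eq_integral => x _ /=.
  by rewrite ger0_norm// mul1r.
apply: (ri_ae_le _ vi); first exact: measurable_funM.
by apply: filterS v_ae => x ->; rewrite ger0_norm.
Qed.

Lemma density_Rint1 : \int[mu]_x (w x / G) = 1.
Proof.
have := @normalized_Rint (fun=> 1) (measurable_cst _).
by under [RHS]eq_Rintegral do rewrite mulr1; rewrite Rint_cst.
Qed.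

End normalized_density.

(** * Replacing a random denominator by its limit *)

Section ratio.
Context (R : realType) (dO : measure_display) (Omega : measurableType dO).
Variable P : probability Omega R.
Implicit Types A B D Z : nat -> Omega -> R.

Let min1_ge0 (x : R) : 0 <= Num.min 1 `|x|.
Proof. by rewrite le_min ler01 normr_ge0. Qed.

Let ri_min1 D N : measurable_fun setT (D N) ->
  rintegrable P (fun omega => Num.min 1 `|D N omega|).
Proof.
move=> mD; apply: (@ri_bounded _ _ _ P 1) => [|omega].
  by apply: measurable_minr => //; exact: measurableT_comp.
by rewrite ger0_norm// ge_min lexx.
Qed.

(** x <= e / 2 + x^2 / (2 e). *)
Lemma min1_cvg0_of_sqr D : (forall N, measurable_fun setT (D N)) ->
  (forall N, rintegrable P (fun omega => D N omega ^+ 2)) ->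
  (fun N => \int[P]_omega (D N omega ^+ 2)) @ \oo --> 0 ->
  (fun N => \int[P]_omega Num.min 1 `|D N omega|) @ \oo --> 0.
Proof.
move=> mD D2 D20; apply/cvgrPdist_le => e e0.
have e2 : 0 < e ^+ 2 by rewrite exprn_gt0.
move: D20 => /cvgrPdist_le/(_ _ e2); apply: filterS => N.
rewrite !sub0r !normrN => De.
have {}De : \int[P]_omega (D N omega ^+ 2) <= e ^+ 2 by exact: le_trans (ler_norm _) De.
rewrite ger0_norm; last exact: Rintegral_ge0.
apply: (@le_trans _ _ (\int[P]_omega (e / 2 + (2 * e)^-1 * D N omega ^+ 2))).
  apply: ler_Rint => [| |omega]; first exact: ri_min1.
    by apply: riD; [exact: ri_cst|exact: riZ].
  rewrite ge_min; apply/orP; right; set x := `|_|.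
  have -> : D N omega ^+ 2 = x ^+ 2 by rewrite real_normK ?num_real.
  rewrite -subr_ge0 (_ : _ - _ = (x - e) ^+ 2 / (2 * e)).
    by rewrite divr_ge0 ?sqr_ge0// mulr_ge0// ltW.
  by field; rewrite gt_eqF.
rewrite RintD; [|exact: ri_cst|exact: riZ].
rewrite Rint_cst RintZ//.
have e2V : 0 <= (2 * e)^-1 by rewrite invr_ge0 mulr_ge0// ltW.
apply: (@le_trans _ _ (e / 2 + (2 * e)^-1 * e ^+ 2)).
  by rewrite lerD2l; exact: ler_wpM2l De.
by rewrite le_eqVlt; apply/orP; left; apply/eqP; field; rewrite gt_eqF.
Qed.

(** If b is far from 1 the second term exceeds 1; otherwise b >= 1/2, and
    |a / b - a| <= 2 |a| |b - 1| <= eta |a|. *)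
Lemma ratio_deviation (a b z eta : R) : 0 < eta -> eta <= 1 ->
  (b != 0 -> z = a / b) ->
  Num.min 1 `|z - a| <= eta * (1 + a ^+ 2) + 2 / eta * `|b - 1|.
Proof.
move=> eta0 eta1 zE.
have a2 : 0 <= eta * (1 + a ^+ 2) by rewrite mulr_ge0 ?(ltW eta0)// addr_ge0// sqr_ge0.
have [b1|b1] := leP (eta / 2) `|b - 1|.
  rewrite ge_min; apply/orP; left.
  apply: (@le_trans _ _ (2 / eta * `|b - 1|)); last by rewrite lerDr.
  have e2 : 0 <= 2 / eta by rewrite divr_ge0// ltW.
  apply: le_trans (ler_wpM2l e2 b1).
  by rewrite le_eqVlt; apply/orP; left; apply/eqP; field; rewrite gt_eqF.
have b2 : 1 / 2 <= b by move: b1; rewrite ltr_norml => /andP[]; lra.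
have b0 : 0 < b by lra.
rewrite ge_min zE ?gt_eqF//; apply/orP; right.
apply: (@le_trans _ _ (eta * (1 + a ^+ 2))); last first.
  by rewrite lerDl mulr_ge0// divr_ge0// ltW.
have -> : a / b - a = a * (1 - b) / b by field; rewrite gt_eqF.
rewrite normrM normrM (distrC 1 b) normfV (gtr0_norm b0) ler_pdivrMr//.
have aa : `|a| <= (1 + a ^+ 2).
  have -> : a ^+ 2 = `|a| ^+ 2 by rewrite real_normK ?num_real.
  by rewrite -subr_ge0 (_ : _ - _ = (`|a| - 1 / 2) ^+ 2 + 3 / 4) ?addr_ge0 ?sqr_ge0//; field.
apply: (@le_trans _ _ ((1 + a ^+ 2) * (eta / 2))).
  by rewrite ler_pM// ltW.
rewrite (_ : (1 + a ^+ 2) * (eta / 2) = eta * (1 + a ^+ 2) * (1 / 2)); last by field.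
by rewrite ler_wpM2l.
Qed.

(** Boundedness of E A_N^2 is the form of tightness that lets a denominator
    tending to 1 in L1 be dropped. *)
Lemma ratio_slutsky A B Z (C : R) :
  (forall N, measurable_fun setT (A N)) -> (forall N, measurable_fun setT (Z N)) ->
  (forall N, rintegrable P (fun omega => A N omega ^+ 2)) ->
  (forall N, (0 < N)%N -> \int[P]_omega (A N omega ^+ 2) <= C) ->
  (forall N, rintegrable P (B N)) ->
  (fun N => \int[P]_omega `|B N omega - 1|) @ \oo --> 0 ->
  (forall N omega, B N omega != 0 -> Z N omega = A N omega / B N omega) ->
  (fun N => \int[P]_omega Num.min 1 `|Z N omega - A N omega|) @ \oo --> 0.
Proof.
move=> mA mZ A2 AC Bi B1 ZE.
have C0 : 0 <= C by by apply: le_trans (AC 1%N isT); apply: Rintegral_ge0 => omega _; exact: sqr_ge0.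
have iB N : rintegrable P (fun omega => `|B N omega - 1|).
  by apply: ri_abs; apply: riB => //; exact: ri_cst.
apply/cvgrPdist_le => e e0.
have d0 : 0 < 2 * (1 + C) by lra.
pose eta := Num.min 1 (e / (2 * (1 + C))).
have eta0 : 0 < eta by rewrite lt_min ltr01 divr_gt0.
have eta1 : eta <= 1 by rewrite ge_min lexx.
have etaC : eta * (1 + C) <= e / 2.
  have h : eta <= e / (2 * (1 + C)) by rewrite ge_min lexx orbT.
  have C1 : 0 <= 1 + C by lra.
  apply: le_trans (ler_wpM2r C1 h) _.
  by rewrite le_eqVlt; apply/orP; left; apply/eqP; field; rewrite gt_eqF//; lra.
have t0 : 0 < e * eta / 4 by rewrite divr_gt0// mulr_gt0.
move: B1 => /cvgrPdist_le/(_ _ t0) BN.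
near=> N.
have BN1 : \int[P]_omega `|B N omega - 1| <= e * eta / 4.
  have : `|0 - \int[P]_omega `|B N omega - 1| | <= e * eta / 4 by near: N.
  by rewrite sub0r normrN; exact: le_trans (ler_norm _).
have N0 : (0 < N)%N by near: N; exists 1%N.
rewrite sub0r normrN ger0_norm; last exact: Rintegral_ge0.
apply: (@le_trans _ _ (\int[P]_omega
    (eta * (1 + A N omega ^+ 2) + 2 / eta * `|B N omega - 1|))).
  apply: ler_Rint => [| |omega].
  - apply: (@ri_min1 (fun N omega => Z N omega - A N omega)); exact: measurable_funB.
  - apply: riD; last exact: riZ.
    by apply: riZ; apply: riD => //; exact: ri_cst.
  - by apply: ratio_deviation => //; exact: ZE.
have i1 : rintegrable P (fun omega => 1 + A N omega ^+ 2).
  by apply: riD => //; exact: ri_cst.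
rewrite RintD; [|exact: riZ|exact: riZ].
rewrite !RintZ// RintD//; last exact: ri_cst.
rewrite Rint_cst.
have e1 : eta * (1 + \int[P]_omega (A N omega ^+ 2)) <= eta * (1 + C).
  by rewrite ler_pM2l// lerD2l AC.
have e2 : 2 / eta * \int[P]_omega `|B N omega - 1| <= e / 2.
  apply: (@le_trans _ _ (2 / eta * (e * eta / 4))).
    by rewrite ler_wpM2l// divr_ge0// ltW.
  by rewrite le_eqVlt; apply/orP; left; apply/eqP; field; rewrite gt_eqF.
by apply: le_trans (lerD e1 e2) _; lra.
Unshelve. all: by end_near. Qed.

End ratio.

(** * Asymptotic normality of the self-normalized estimators *)

Lemma measurable_inv (R : realType) : measurable_fun setT (fun x : R => x^-1).
Proof.
rewrite -(setUv [set (0 : R)]).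
apply/measurable_funU; [exact: measurable_set1|apply: measurableC; exact: measurable_set1|split].
  exact: measurable_fun_set1.
have openC0 : open (~` [set (0 : R)]) by apply: closed_openC; exact: closed_eq.
have cont : {in ~` [set (0 : R)], continuous (fun x : R => x^-1)}.
  by move=> x /set_mem /eqP x0; exact: inv_continuous.
exact: (open_continuous_measurable_fun openC0 cont).
Qed.

Section self_normalized.
Context (R : realType) (K : nat) (d : 'I_K -> measure_display).
Context (S : forall k, measurableType (d k)).
Variable mu_ : forall k, probability (S k) R.
Let mu := prod_prob mu_.
Context (dO : measure_display) (Omega : measurableType dO).
Variables (P : probability Omega R) (X : nat -> {RV P >-> prodT S}).
Hypothesis iidX : iid mu X.
Variables (w phi : prodT S -> R) (theta G : R).
Hypotheses (mw : measurable_fun setT w) (mphi : measurable_fun setT phi).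
Hypothesis G0 : 0 < G.
Let wG x := w x / G.
Let psi x := wG x * (phi x - theta).
Hypothesis wG_ri : rintegrable mu wG.
Hypothesis wG1 : \int[mu]_x wG x = 1.
Hypothesis psi_sqri : sqri mu_ psi.
Hypothesis psi0 : \int[mu]_x psi x = 0.

Let GV : G != 0. Proof. by rewrite gt_eqF. Qed.

Let psiE x : psi x = G^-1 * (w x * phi x - theta * w x).
Proof. by rewrite /psi /wG; ring. Qed.

Let centred_ratio (s a b : R) : b / G != 0 ->
  s * (a / b - theta) = s * (G^-1 * (a - theta * b)) / (b / G).
Proof.
rewrite mulf_eq0 invr_eq0 (negbTE GV) orbF => b0.
by field; rewrite ?b0 ?GV.
Qed.

(** The numerator is linear: mu^N(psi) = (mu^N(w phi) - theta mu^N(w)) / G. *)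
Lemma snis_centred N x : emp_mean N wG x != 0 ->
  Num.sqrt N%:R * (snis N w phi x - theta) =
  Num.sqrt N%:R * emp_mean N psi x / emp_mean N wG x.
Proof.
have -> : emp_mean N wG x = emp_mean N w x / G.
  by rewrite /emp_mean -mulr_suml mulrA.
have -> : emp_mean N psi x =
    G^-1 * (emp_mean N (w \* phi) x - theta * emp_mean N w x).
  rewrite /emp_mean; under eq_bigr do rewrite psiE.
  by rewrite -mulr_sumr sumrB -mulr_sumr /=; ring.
exact: centred_ratio.
Qed.

Lemma snis_cross_centred N x : emp_mean_cross N wG x != 0 ->
  Num.sqrt N%:R * (snis_cross N w phi x - theta) =
  Num.sqrt N%:R * emp_mean_cross N psi x / emp_mean_cross N wG x.
Proof.
have -> : emp_mean_cross N wG x = emp_mean_cross N w x / G.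
  by rewrite /emp_mean_cross -mulr_suml mulrA.
have -> : emp_mean_cross N psi x =
    G^-1 * (emp_mean_cross N (w \* phi) x - theta * emp_mean_cross N w x).
  rewrite /emp_mean_cross; under eq_bigr do rewrite psiE.
  by rewrite -mulr_sumr sumrB -mulr_sumr /=; ring.
exact: centred_ratio.
Qed.

Lemma measurable_emp_mean N f : measurable_fun setT f ->
  measurable_fun setT (fun omega => emp_mean N f (X^~ omega) : R).
Proof.
move=> mf; apply: measurable_funM => //; apply: measurable_sum => n.
exact: (measurableT_comp mf).
Qed.

Let measurable_ratio (s : R) (a b : Omega -> R) : measurable_fun setT a ->
  measurable_fun setT b -> measurable_fun setT (fun omega => s * (a omega / b omega - theta)).
Proof.
move=> ma mb; apply: measurable_funM => //; apply: measurable_funB => //.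
by apply: measurable_funM => //; exact: (measurableT_comp (@measurable_inv R) mb).
Qed.

(** Steps are admissible test functions for the central limit theorem. *)
Lemma step_cvg_emp_mean h : sqri mu_ h -> \int[mu]_x h x = 0 ->
  step_cvg P (gaussian 0 (\int[mu]_x (h x ^+ 2)))
    (fun N omega => Num.sqrt N%:R * emp_mean N h (X^~ omega)).
Proof.
move=> [mh h2] h0 a e e0; have [C [f1 [f2 fT]]] := step_taylor a e0.
exact: (clt_taylor mh h2 h0 iidX fT).
Qed.

Let scaled_sqr N (u : Omega -> R) c : (0 < N)%N ->
  rintegrable P (fun omega => u omega ^+ 2) ->
  \int[P]_omega (u omega ^+ 2) <= c / N%:R ->
  \int[P]_omega ((Num.sqrt N%:R * u omega) ^+ 2) <= c.
Proof.
move=> N0 u2 uc; under eq_Rintegral do rewrite exprMn sqr_sqrtr//.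
rewrite RintZ// -ler_pdivlMl ?ltr0n//; last by rewrite mulrC.
Qed.

Let ri_scaled N (u : Omega -> R) : rintegrable P (fun omega => u omega ^+ 2) ->
  rintegrable P (fun omega => (Num.sqrt N%:R * u omega) ^+ 2).
Proof. exact: ri_sqrZ. Qed.

Lemma snis_clt : asymptotically_normal P
  (fun N omega => snis N w phi (X^~ omega)) theta (\int[mu]_x (psi x ^+ 2)).
Proof.
have [mpsi psi2] := psi_sqri.
have mwphi : measurable_fun setT (w \* phi) by exact: measurable_funM.
have mZ N : measurable_fun setT
    (fun omega => Num.sqrt N%:R * (snis N w phi (X^~ omega) - theta)).
  by apply: measurable_ratio; exact: measurable_emp_mean.
have mA N : measurable_fun setT
    (fun omega => Num.sqrt N%:R * emp_mean N psi (X^~ omega)).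
  by apply: measurable_funM => //; exact: measurable_emp_mean.
have u2 N : rintegrable P (fun omega => emp_mean N psi (X^~ omega) ^+ 2).
  under eq_fun do rewrite emp_meanE.
  exact: (ri_average_sqr (fun i : 'I_N => law_single iidX i)).
apply: portmanteau => //.
apply: (step_cvg_slutsky mZ mA (step_cvg_emp_mean psi_sqri psi0)).
apply: (ratio_slutsky (B := fun N omega => emp_mean N wG (X^~ omega))
  (C := \int[mu]_x (psi x ^+ 2)) mA mZ).
- by move=> N; exact: ri_scaled.
- move=> N N0; apply: scaled_sqr => //.
  by have := std_sqr_le iidX N0 mpsi psi2 psi0; rewrite div1r mulrC.
- move=> N; under eq_fun do rewrite emp_meanE.
  exact: (ri_average (fun i : 'I_N => law_single iidX i)).
- by have := std_L1_lln iidX wG_ri; rewrite wG1.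
- by move=> N omega; exact: snis_centred.
Qed.

(** Three approximations in turn: sqrt N times the sample average of the projection
    (central limit theorem), sqrt N U_N(psi) (second moment of the residual), and
    the ratio (its denominator tends to 1). *)
Lemma snis_cross_clt : asymptotically_normal P
  (fun N omega => snis_cross N w phi (X^~ omega)) theta (proj_var mu_ psi).
Proof.
have [mpsi psi2] := psi_sqri.
have mwphi : measurable_fun setT (w \* phi) by exact: measurable_funM.
have mZ N : measurable_fun setT
    (fun omega => Num.sqrt N%:R * (snis_cross N w phi (X^~ omega) - theta)).
  by apply: measurable_ratio; exact: measurable_emp_mean_cross.
have mA N : measurable_fun setT
    (fun omega => Num.sqrt N%:R * emp_mean_cross N psi (X^~ omega)).
  by apply: measurable_funM => //; exact: measurable_emp_mean_cross.
have hs := sqri_hajek psi_sqri; have [mh h2] := hs.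
have mH N : measurable_fun setT
    (fun omega => Num.sqrt N%:R * emp_mean N (hajek mu_ psi) (X^~ omega)).
  by apply: measurable_funM => //; exact: measurable_emp_mean.
have u2 N : rintegrable P (fun omega => emp_mean_cross N psi (X^~ omega) ^+ 2).
  under eq_fun do rewrite emp_mean_crossE.
  exact: (ri_average_sqr (fun n : {ffun 'I_K -> 'I_N} => law_mixed iidX (fun k => n k))).
have v2 N : rintegrable P (fun omega => emp_mean N (hajek mu_ psi) (X^~ omega) ^+ 2).
  under eq_fun do rewrite emp_meanE.
  exact: (ri_average_sqr (fun i : 'I_N => law_single iidX i)).
have sA : step_cvg P (gaussian 0 (proj_var mu_ psi))
    (fun N omega => Num.sqrt N%:R * emp_mean_cross N psi (X^~ omega)).
  apply: (step_cvg_slutsky mA mH).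
    have := step_cvg_emp_mean hs (hajek0 psi_sqri psi0).
    by rewrite -/mu (hajek_sqr psi_sqri psi0).
  apply: min1_cvg0_of_sqr => [N|N|].
  - exact: measurable_funB.
  - by apply: ri_sqrB => //; exact: ri_scaled.
  pose c := K%:R ^+ 2 * \int[mu]_x (residual mu_ psi x ^+ 2).
  have c0 : (fun N : nat => c / N%:R) @ \oo --> 0.
    have h : (fun n => c * (n.+1%:R : R)^-1) @ \oo --> c * 0.
      exact: cvgMl_tmp (@cvg_harmonic R).
    by rewrite mulr0 in h; rewrite -cvg_shiftS; exact: h.
  apply: (squeeze_cvgr _ (cvg_cst 0) c0).
  exists 1%N => // N /= N0; rewrite Rintegral_ge0 => [|omega _]; last exact: sqr_ge0.
  exact: hajek_approximation.
apply: portmanteau => //.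
apply: (step_cvg_slutsky mZ mA sA).
apply: (ratio_slutsky (B := fun N omega => emp_mean_cross N wG (X^~ omega))
  (C := K%:R * \int[mu]_x (psi x ^+ 2)) mA mZ).
- by move=> N; exact: ri_scaled.
- move=> N N0; apply: scaled_sqr => //.
  by rewrite mulrAC; exact: cross_sqr_le.
- move=> N; under eq_fun do rewrite emp_mean_crossE.
  exact: (ri_average (fun n : {ffun 'I_K -> 'I_N} => law_mixed iidX (fun k => n k))).
- by have := cross_L1_lln iidX wG_ri; rewrite wG1.
- by move=> N omega; exact: snis_cross_centred.
Qed.

End self_normalized.

(** * Consistency, asymptotic normality and comparison of variances *)

Theorem corollary3 (R : realType) (K : nat) (hK : (1 < K)%N)
    (d : 'I_K -> measure_display) (S : forall k, measurableType (d k))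
    (mu_ : forall k, probability (S k) R)
    (gamma : {finite_measure set (prodT S) -> \bar R})
    (w phi : prodT S -> R)
    (dO : measure_display) (Omega : measurableType dO)
    (P : probability Omega R) (X : nat -> {RV P >-> prodT S})
    (mu := prod_prob mu_)
    (ppi := mnormalize gamma mu)
    (ppi_phi := \int[ppi]_x phi x)
    (w_ppi := fun x : prodT S => w x / fine (gamma setT))
    (psi := fun x : prodT S => w_ppi x * (phi x - ppi_phi))
    (ppi_cross := fun (N : nat) (omega : Omega) =>
      snis_cross N w phi (fun n => X n omega))
    (ppi_std := fun (N : nat) (omega : Omega) =>
      snis N w phi (fun n => X n omega)) :
  iid mu X ->
  (0 < gamma setT)%E ->
  gamma `<< mu ->
  measurable_fun setT w ->
  ae_eq mu setT (EFin \o w) ('d (charge_of_finite_measure gamma) '/d mu) ->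
  measurable_fun setT phi ->
  (w \* phi) \in Lfun mu 2%:E ->
  [/\ {ae P, forall omega, (fun N => ppi_cross N omega) @ \oo --> ppi_phi},
      (sigma2 mu_ psi < +oo)%E ->
        asymptotically_normal P ppi_cross ppi_phi
          (fine (sigma2_cross mu_ psi)) /\
        asymptotically_normal P ppi_std ppi_phi (fine (sigma2 mu_ psi))
    & (sigma2_cross mu_ psi <= sigma2 mu_ psi)%E].
Proof.
move=> iidX gamma0 gamma_mu mw w_density mphi wphi_L2.
pose G := fine (gamma setT).
have G0 : 0 < G by exact: mass_gt0.
have GV : G != 0 by rewrite gt_eqF.
have wG_ri : rintegrable mu w_ppi by exact: ri_density.
have wG1 : \int[mu]_x w_ppi x = 1 by exact: density_Rint1.
have mwG := ri_measurable wG_ri.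
have w_ri : rintegrable mu w.
  rewrite (_ : w = fun x => G * w_ppi x); first exact: riZ.
  by apply/funext => x; rewrite /w_ppi -/G; field.
have wE : \int[mu]_x w x = G.
  rewrite -[RHS]mulr1 -wG1 -RintZ//; apply: eq_Rintegral => x _.
  by rewrite /w_ppi -/G; field.
have wphi_ri : rintegrable mu (w \* phi).
  apply: ri_of_sqr; first exact: measurable_funM.
  exact: Lfun2_integrable_sqr.
have thetaE : ppi_phi = (\int[mu]_x (w \* phi) x) / G.
  rewrite /ppi_phi /ppi (normalized_Rint gamma0 gamma_mu mw w_density mphi).
  rewrite mulrC -RintZ//; apply: eq_Rintegral => x _.
  by rewrite /= -/G; field.
have psiE x : psi x = G^-1 * (w \* phi) x - ppi_phi * w_ppi x.
  by rewrite /psi /w_ppi /=; ring.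
have psi_ri : rintegrable mu psi.
  rewrite (_ : psi = fun x => G^-1 * (w \* phi) x - ppi_phi * w_ppi x).
    by apply: riB; exact: riZ.
  exact/funext.
have psi0 : \int[mu]_x psi x = 0.
  under eq_Rintegral do rewrite psiE.
  rewrite RintB; [|exact: riZ|exact: riZ].
  by rewrite !RintZ// wG1 thetaE; ring.
have mpsi := ri_measurable psi_ri.
have sqri_psi : (sigma2 mu_ psi < +oo)%E -> sqri mu_ psi.
  move=> s2; split => //; apply/integrableP; split.
    by apply/measurable_EFinP; exact: measurable_funX.
  move: s2; rewrite /sigma2 -/mu psi0; congr (_ < _)%E; apply: eq_integral => x _.
  by rewrite /= subr0 ger0_norm// sqr_ge0.
split.
- have := cross_strong_law iidX w_ri; rewrite wE.
  apply: filterS2 (cross_strong_law iidX wphi_ri) => omega num den.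
  by rewrite thetaE; apply: cvgM => //; exact: cvgV.
- move=> s2; have ps := sqri_psi s2.
  rewrite (sigma2E ps psi0) (sigma2_crossE ps psi0).
  split; [exact: snis_cross_clt|exact: snis_clt].
have [s2|] := ltP (sigma2 mu_ psi) +oo%E; last first.
  by rewrite leye_eq => /eqP ->; rewrite leey.
have ps := sqri_psi s2; rewrite (sigma2E ps psi0) (sigma2_crossE ps psi0) lee_fin.
exact: proj_var_le.
Qed.
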